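(* Let $S=M_{d_1}(\mathbb{C})\oplus\dots\oplus M_{d_k}(\mathbb{C})$ be a finite dimensional semi-simple algebra, $\mathbb{D}S=T_S\mathrm{Der}(S,S\otimes S)$, and $Q_S$ its double derivation quiver. Then the graded Lie algebra $\mathbb{D}S/[\mathbb{D}S,\mathbb{D}S][1]$, with the bracket $\{-,-\}_s$ induced by the double Schouten bracket, is isomorphic as a graded Lie algebra to $\mathbb{C}Q_S/[\mathbb{C}Q_S,\mathbb{C}Q_S]_{super}$ (with degrees shifted by one in the same way), with bracket defined as follows. Fix representatives in $\mathbb{C}Q_S$, namely closed paths $\omega_1=v_1v_2\cdots v_n$ and $\omega_2=u_1u_2\cdots u_m$ with $u_i,v_j$ arrows of $Q_S$. Then $$\{\omega_1,\omega_2\}=\sum_{i=0}^{m-1}\sum_{j=0}^{n-1}\Big((-1)^{(i+j)(n-1)}A_{ij}-(-1)^{(i+j+1)(n-1)}B_{ij}\Big)$$ (an empty sum, hence $0$, if one of the two is a vertex), where: (a) If $t(u_{i+1})=h(v_{j+1})$ and the secondary colour of $u_{i+1}$ equals the primary colour of $v_{j+1}$, then $A_{ij}=u_1\cdots u_i\,v_{j+2}\cdots v_n v_1\cdots v_j\,w\,u_{i+2}\cdots u_m$, where $w$ is the arrow from $t(v_{j+1})$ to $h(u_{i+1})$ with primary colour that of $u_{i+1}$ and secondary colour that of $v_{j+1}$; otherwise $A_{ij}=0$. (That is, $u_{i+1}$ and $v_{j+1}$ are removed, the two closed paths are glued at the vertex $a=t(u_{i+1})=h(v_{j+1})$, and the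 loose ends are connected by $w$.) (b) If $h(u_{i+1})=t(v_{j+1})$ and the primary colour of $u_{i+1}$ equals the secondary colour of $v_{j+1}$, then $B_{ij}=u_1\cdots u_i\,w'\,v_{j+2}\cdots v_nv_1\cdots v_j\,u_{i+2}\cdots u_m$, where $w'$ is the arrow from $t(u_{i+1})$ to $h(v_{j+1})$ with primary colour that of $v_{j+1}$ and secondary colour that of $u_{i+1}$; otherwise $B_{ij}=0$. Whenever $w$ or $w'$ is a loop at a vertex $a$ with bi-colour $(1,1)$, it stands for $-\sum_{r=2}^{d_a}$ (loop at $a$ with bi-colour $(r,r)$).
   Context: $\mathbb{C}$ is an algebraically closed field of characteristic $0$, $\otimes=\otimes_{\mathbb{C}}$. Double derivations: $\mathrm{Der}(S,S\otimes S)$ is the space of derivations $S\to S\otimes S$ for the outer structure $a\cdot(a'\otimes a'')\cdot b=aa'\otimes a''b$; it is an $S$-bimodule by $(s\vartheta t)(u)=\vartheta(u)'t\otimes s\vartheta(u)''$, where $\vartheta(u)=\vartheta(u)'\otimes\vartheta(u)''$ (Sweedler notation, sum understood). $\mathbb{D}S$ is its tensor algebra over $S$, graded with $S$ in degree $0$ and double derivations in degree $1$. $[\mathbb{D}S,\mathbb{D}S]$ is the span of graded commutators $ab-(-1)^{|a||b|}ba$, and $[1]$ means the degree is shifted so that an element of degree $n$ of $\mathbb{D}S$ has degree $n-1$. Double Schouten bracket $\{\!\!\{-,-\}\!\!\}_s:\mathbb{D}S\otimes\mathbb{D}S\to\mathbb{D}S\otimes\mathbb{D}S$: it is determined by, for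 $s,t\in S$ and double derivations $\delta,\Delta$, $\{\!\!\{s,t\}\!\!\}_s=0$, $\{\!\!\{\delta,s\}\!\!\}_s=\delta(s)$, $\{\!\!\{\delta,\Delta\}\!\!\}_s=\{\!\!\{\delta,\Delta\}\!\!\}_l+\{\!\!\{\delta,\Delta\}\!\!\}_r$ with $\{\!\!\{\delta,\Delta\}\!\!\}_l=\tau_{(23)}((\delta\otimes1)\Delta-(1\otimes\Delta)\delta)$ viewed in $\mathrm{Der}(S,S\otimes S)\otimes S$ (where $\eta\otimes t$ is the map $s\mapsto\eta(s)'\otimes\eta(s)''\otimes t$) and $\{\!\!\{\delta,\Delta\}\!\!\}_r=\tau_{(12)}((1\otimes\delta)\Delta-(\Delta\otimes1)\delta)$ viewed in $S\otimes\mathrm{Der}(S,S\otimes S)$ (where $t\otimes\eta$ is the map $s\mapsto t\otimes\eta(s)'\otimes\eta(s)''$), $\tau$ permuting tensor factors; together with the graded derivation property $\{\!\!\{a,bc\}\!\!\}=(-1)^{(|a|-1)|b|}b\{\!\!\{a,c\}\!\!\}+\{\!\!\{a,b\}\!\!\}c$ (outer bimodule structure) and graded antisymmetry $\{\!\!\{a,b\}\!\!\}=-(-1)^{(|a|-1)(|b|-1)}\sigma_{(12)}\{\!\!\{b,a\}\!\!\}$, with $\sigma_{(12)}(x\otimes y)=(-1)^{|x||y|}y\otimes x$. Composing with the multiplication gives $\{a,b\}_s$, which induces the graded Lie bracket on $\mathbb{D}S/[\mathbb{D}S,\mathbb{D}S][1]$. Double derivation quiver $Q_S$: vertices $1,\dots,k$;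 for $i\ne j$ there are $d_id_j$ arrows $j\to i$, indexed by bi-colours $(p,q)$ with $1\le p\le d_i$, $1\le q\le d_j$; there are $d_i^2-1$ loops at $i$, indexed by bi-colours $(p,q)\in\{1,\dots,d_i\}^2\setminus\{(1,1)\}$. The first index is the primary colour and the second index is the secondary colour. $h(a)$, $t(a)$ denote head and tail of an arrow. In the path algebra $\mathbb{C}Q_S$ paths are written left to right: $ab\neq0$ only if $h(a)=t(b)$. $\mathbb{C}Q_S$ is graded with arrows in degree $1$ and vertex idempotents in degree $0$, and $[\mathbb{C}Q_S,\mathbb{C}Q_S]_{super}$ is the span of graded commutators $ab-(-1)^{|a||b|}ba$; the quotient is spanned by vertices and closed paths.
   Formalization: The displayed formula is not graded antisymmetric on the shifted space when n+m is odd (already for M_2), so the Lie bracket proved isomorphic to the Schouten bracket is (-1)^{n-1} times the displayed formula, n being the length of the first closed path. *)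

(* Defs.v *)
From HB Require Import structures.
From mathcomp Require Import all_boot all_order all_algebra.
From mathcomp Require Import finmap monalg.
From mathcomp Require Import mathcomp_extra boolp functions.

Set Implicit Arguments.
Unset Strict Implicit.
Unset Printing Implicit Defensive.

Import GRing.Theory.
Local Open Scope ring_scope.

Section LinearQuotient.
Variables (C : fieldType) (V : lmodType C) (G : V -> Prop).

Inductive span : V -> Prop :=
  | span0 : span 0
  | spanG x : G x -> span x
  | spanD x y : span x -> span y -> span (x + y)
  | spanZ c x : span x -> span (c *: x).

Definition in_span : {pred V} := fun x => `[< span x >].

Lemma in_span_zmod : zmod_closed in_span.
Proof.
split; first by apply/asboolP; exact: span0.
move=> x y /asboolP sx /asboolP sy; apply/asboolP.
by rewrite -scaleN1r; apply: spanD => //; apply: spanZ.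
Qed.
HB.instance Definition _ := GRing.isZmodClosed.Build V in_span in_span_zmod.

Definition lquot : Type := Quotient.quot in_span.
HB.instance Definition _ := GRing.Zmodule.on lquot.

Definition qproj (x : V) : lquot := \pi_(Quotient.quot in_span)%qT x.
Definition qrepr (q : lquot) : V := repr (q : Quotient.quot in_span).

Lemma qreprK : cancel qrepr qproj.
Proof. by move=> q; rewrite /qproj /qrepr reprK. Qed.

Lemma qproj_eqP x y : qproj x = qproj y <-> span (x - y).
Proof.
split=> [/eqP|h]; first by rewrite /qproj piE Quotient.equivE => /asboolP.
by apply/eqP; rewrite /qproj piE Quotient.equivE; apply/asboolP.
Qed.

Lemma qproj_zmod_morphism : zmod_morphism qproj.
Proof. by move=> x y; rewrite /qproj raddfB. Qed.
HB.instance Definition _ :=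
  GRing.isZmodMorphism.Build V lquot qproj qproj_zmod_morphism.

Definition qscale (c : C) (q : lquot) : lquot := qproj (c *: qrepr q).

Lemma qscaleE c x : qscale c (qproj x) = qproj (c *: x).
Proof.
apply/qproj_eqP; rewrite -scalerBr; apply: spanZ.
by apply/qproj_eqP; rewrite qreprK.
Qed.

Lemma qscaleA a b v : qscale a (qscale b v) = qscale (a * b) v.
Proof. by rewrite -(qreprK v) !qscaleE scalerA. Qed.
Lemma qscale1 : left_id 1 qscale.
Proof. by move=> v; rewrite -(qreprK v) qscaleE scale1r. Qed.
Lemma qscaleDr : right_distributive qscale +%R.
Proof.
move=> a u v; rewrite -(qreprK u) -(qreprK v) -raddfD !qscaleE.
by rewrite scalerDr raddfD.
Qed.
Lemma qscaleDl v : {morph qscale^~ v : a b / a + b}.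
Proof. by move=> a b; rewrite -(qreprK v) !qscaleE scalerDl raddfD. Qed.
HB.instance Definition _ := GRing.Zmodule_isLmodule.Build C lquot
  qscaleA qscale1 qscaleDr qscaleDl.

Lemma qproj_scalable : scalable qproj.
Proof. by move=> c x; rewrite -qscaleE. Qed.
HB.instance Definition _ :=
  GRing.isScalable.Build C V lquot *:%R qproj qproj_scalable.

Lemma qprojP c x y z : G (x - c *: y - z) -> qproj x = c *: qproj y + qproj z.
Proof.
move=> Gx; rewrite -linearP; apply/qproj_eqP.
by rewrite opprD addrA; apply: spanG.
Qed.

End LinearQuotient.

Arguments qproj {C V} G x.

Lemma lin_0 (C : fieldType) (V W : lmodType C) (f : V -> W) : linear f -> f 0 = 0.
Proof. by move=> /(_ (-1) 0 0); rewrite scaler0 addr0 scaleN1r addNr. Qed.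
Lemma lin_add (C : fieldType) (V W : lmodType C) (f : V -> W) :
  linear f -> {morph f : x y / x + y}.
Proof. by move=> fL x y; have := fL 1 x y; rewrite !scale1r. Qed.
Lemma lin_scale (C : fieldType) (V W : lmodType C) (f : V -> W) :
  linear f -> forall c, {morph f : x / c *: x}.
Proof. by move=> fL c x; have := fL c x 0; rewrite (lin_0 fL) !addr0. Qed.

Lemma lin_comb_swap (C : fieldType) (V : lmodType C) (a c : C) (x y x' y' : V) :
  c *: (a *: x + y) + (a *: x' + y') = a *: (c *: x + x') + (c *: y + y').
Proof. by rewrite !scalerDr !scalerA (mulrC c a) addrACA. Qed.

Section FreeModule.
Variables (C : fieldType) (K : choiceType).
Local Notation F := {malg C[K]}.

Section Ext.
Variables (U : lmodType C) (b : K -> U).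

Definition mext (x : F) : U := \sum_(k <- msupp x) x@_k *: b k.

Lemma mextw (D : {fset K}) x : (msupp x `<=` D)%fset ->
  mext x = \sum_(k <- D) x@_k *: b k.
Proof.
move=> sD; rewrite /mext (big_fset_incl _ sD) //= => k _ /mcoeff_outdom ->.
by rewrite scale0r.
Qed.

Lemma mext_linear : linear mext.
Proof.
move=> c x y; pose D := (msupp (c *: x + y) `|` (msupp x `|` msupp y))%fset.
rewrite !(@mextw D); try by apply/fsubsetP=> k; rewrite /D !in_fsetU => ->;
  rewrite ?orbT.
rewrite scaler_sumr -big_split /=; apply: eq_bigr => k _.
by rewrite mcoeffD mcoeffZ scalerDl scalerA.
Qed.
HB.instance Definition _ := GRing.isLinear.Build C F U *:%R mext mext_linear.

Lemma mextU k : mext << k >> = b k.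
Proof.
by rewrite (@mextw [fset k]%fset) ?msuppU_le // big_seq_fset1 mcoeffUU scale1r.
Qed.

End Ext.

Lemma mext_linear_fun (V U : lmodType C) (b : K -> V -> U) x :
  (forall k, linear (b k)) -> linear (fun v => mext (fun k => b k v) x).
Proof.
move=> bL c u v; rewrite /mext scaler_sumr -big_split /=.
apply: eq_bigr => k _; rewrite bL scalerDr; congr (_ + _).
by rewrite !scalerA mulrC.
Qed.

Lemma mext_unique (U : lmodType C) (f : F -> U) :
  linear f -> forall x, f x = mext (fun k => f << k >>) x.
Proof.
move=> fL x; rewrite {1}[x]monalgE /mext; elim: (enum_fset _) => [|k s IH].
  by rewrite !big_nil (lin_0 fL).
rewrite !big_cons -IH.
have -> : << x@_k *g k >> = x@_k *: << k >> :> F.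
  by apply/malgP=> l; rewrite mcoeffZ !mcoeffU mulrnAr mulr1.
exact: fL.
Qed.

Lemma malg_lin_ext (U : lmodType C) (f g : F -> U) :
  linear f -> linear g -> (forall k, f << k >> = g << k >>) -> f =1 g.
Proof.
move=> fL gL fg x; rewrite (mext_unique fL) (mext_unique gL) /mext.
by apply: eq_bigr => k _; rewrite fg.
Qed.

End FreeModule.

Definition bilin (C : fieldType) (V W U : lmodType C) (b : V -> W -> U) :=
  (forall w, linear (b^~ w)) /\ (forall v, linear (b v)).

Section TensorType.
Variables (C : fieldType) (V W : lmodType C).

Inductive tensor_rel : {malg C[(V * W)%type]} -> Prop :=
  | tensor_rel_l c v v' w :
      tensor_rel (<< (c *: v + v', w) >> - c *: << (v, w) >> - << (v', w) >>)
  | tensor_rel_r c v w w' :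
      tensor_rel (<< (v, c *: w + w') >> - c *: << (v, w) >> - << (v, w') >>).

(* The phantoms only serve to infer the module structures in V \ox W. *)
Definition tensor (_ : phant V) (_ : phant W) : Type := lquot tensor_rel.
HB.instance Definition _ phV phW := GRing.Lmodule.on (tensor phV phW).
End TensorType.

Notation "V \ox W" := (tensor (Phant V) (Phant W))
  (at level 40, left associativity) : type_scope.

(* tens and tlift are sealed only to keep conversion checks cheap. *)
HB.lock Definition tens (C : fieldType) (V W : lmodType C) (v : V) (w : W) :
  V \ox W := qproj (@tensor_rel C V W) << (v, w) >>.
Canonical tens_unlockable := Unlockable tens.unlock.
Arguments tens {C V W} v w.

(* The linear map on V (x) W sending v (x) w to b v w; meaningful only for *)
(* bilinear b (see tlift_tens).                                            *)
HB.lock Definition tlift (C : fieldType) (V W U : lmodType C)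
    (b : V -> W -> U) (z : V \ox W) : U :=
  mext (fun p => b p.1 p.2) (qrepr z).
Canonical tlift_unlockable := Unlockable tlift.unlock.
Arguments tlift {C V W U} b z.

Section Tensor.
Variables (C : fieldType) (V W : lmodType C).

Lemma tens_linl (w : W) : linear (fun v : V => tens v w).
Proof. by rewrite unlock => c v v'; exact: (qprojP (tensor_rel_l c v v' w)). Qed.
Lemma tens_linr (v : V) : linear (fun w : W => tens v w).
Proof. by rewrite unlock => c w w'; exact: (qprojP (tensor_rel_r c v w w')). Qed.
Lemma tens_bilin : bilin (@tens C V W).
Proof. by split; [exact: tens_linl | exact: tens_linr]. Qed.

Lemma tens_sum (z : V \ox W) : exists s : seq (V * W), z = \sum_(p <- s) tens p.1 p.2.
Proof.
exists [seq ((qrepr z)@_p *: p.1, p.2) | p <- msupp (qrepr z)].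
rewrite big_map -{1}(qreprK z) {1}[qrepr z]monalgE linear_sum /=.
apply: eq_bigr => -[v w] _ /=; set c := (_)@_(_).
have -> : << c *g (v, w) >> = c *: << (v, w) >> :> {malg C[(V * W)%type]}.
  by apply/malgP=> k; rewrite mcoeffZ !mcoeffU mulrnAr mulr1.
rewrite linearZ /=.
have -> : qproj (@tensor_rel C V W) << (v, w) >> = tens v w by rewrite unlock.
rewrite -[c *: v]addr0 tens_linl -[LHS]addr0; congr (_ + _).
by rewrite -[0 in RHS]addr0 -{1}(scaler0 V (-1)) tens_linl scaleN1r addNr.
Qed.

Section Lift.
Variables (U : lmodType C) (b : V -> W -> U).

Let ext : {malg C[(V * W)%type]} -> U := mext (fun p => b p.1 p.2).
HB.instance Definition _ :=
  GRing.isLinear.Build C _ U *:%R ext (mext_linear (fun p => b p.1 p.2)).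
Let extU v w : ext << (v, w) >> = b v w. Proof. exact: mextU. Qed.

Hypothesis bP : bilin b.

Let ext_rel x : span (@tensor_rel C V W) x -> ext x = 0.
Proof.
elim=> [|{}x [c v v' w|c v w w']|{}x y _ ex _ ey|c {}x _ ex].
- exact: linear0.
- by rewrite !linearB linearZ /= !extU bP.1 addrAC addrK subrr.
- by rewrite !linearB linearZ /= !extU bP.2 addrAC addrK subrr.
- by rewrite linearD /= ex ey addr0.
- by rewrite linearZ /= ex scaler0.
Qed.

Let tliftE (x : {malg C[(V * W)%type]}) : tlift b (qproj (@tensor_rel C V W) x) = ext x.
Proof.
rewrite tlift.unlock -/(ext _); apply/eqP; rewrite -subr_eq0 -linearB /=.
by apply/eqP/ext_rel/qproj_eqP; exact: qreprK.
Qed.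

Lemma tlift_tens v w : tlift b (tens v w) = b v w.
Proof. by rewrite tens.unlock tliftE extU. Qed.

Lemma tlift_linear : linear (tlift b).
Proof.
move=> c x y.
have {1}-> : c *: x + y = qproj (@tensor_rel C V W) (c *: qrepr x + qrepr y).
  by rewrite linearP /= !qreprK.
by rewrite tliftE linearP tlift.unlock.
Qed.

End Lift.
End Tensor.

Definition tmap (C : fieldType) (V W V' W' : lmodType C)
    (f : V -> V') (g : W -> W') : V \ox W -> V' \ox W' :=
  tlift (fun v w => tens (f v) (g w)).

Definition fword (X : Type) : Type := seq X.

Section FreeWord.
Variable X : choiceType.
HB.instance Definition _ := Choice.copy (fword X) (seq X).

Lemma fword_unit (x y : fword X) : x ++ y = [::] -> x = [::] /\ y = [::].
Proof. by case: x => //=. Qed.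
HB.instance Definition _ := Choice_isMonomialDef.Build (fword X)
  (@catA X) (@cat0s X) (@cats0 X) fword_unit.
End FreeWord.

Definition falg (C : fieldType) (X : choiceType) : Type := {malg C[fword X]}.

Section FreeAlgebra.
Variables (C : fieldType) (X : choiceType).
HB.instance Definition _ := GRing.Lmodule.on (falg C X).
HB.instance Definition _ := GRing.PzRing.on (falg C X).

Lemma falg_scaleAl c (x y : falg C X) : c *: (x * y) = (c *: x) * y.
Proof. exact: fgscaleAl. Qed.
Lemma falg_scaleAr c (x y : falg C X) : c *: (x * y) = x * (c *: y).
Proof.
rewrite (malgMEw (fsubset_refl _) (fsubset_refl (msupp y))) scaler_sumr.
rewrite (malgMEw (fsubset_refl _) (msuppZ_le c y)).
apply: eq_bigr => k _; rewrite scaler_sumr; apply: eq_bigr => l _.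
apply/malgP=> m; rewrite mcoeffZ !mcoeffU mcoeffZ mulrnAr.
by rewrite mulrCA.
Qed.
End FreeAlgebra.

Definition fletter (C : fieldType) (X : choiceType) (x : X) : falg C X :=
  << ([:: x] : fword X) >>.
Arguments fletter C {X} x.

Section SemiSimple.
Variables (C : fieldType) (k : nat) (d : 'I_k -> nat).

Definition ssalg : Type := {dffun forall i : 'I_k, 'M[C]_(d i)}.
HB.instance Definition _ := Choice.on ssalg.

Implicit Types (x y z : ssalg) (c : C).

Definition ss_mk (f : forall i : 'I_k, 'M[C]_(d i)) : ssalg := finfun f.

Lemma ssP x y : (forall i, x i = y i) -> x = y.
Proof. by move=> xy; apply/ffunP. Qed.

Definition ss0 : ssalg := ss_mk (fun i => 0).
Definition ss1 : ssalg := ss_mk (fun i => 1%:M).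
Definition ssD x y : ssalg := ss_mk (fun i => x i + y i).
Definition ssN x : ssalg := ss_mk (fun i => - x i).
Definition ssZ c x : ssalg := ss_mk (fun i => c *: x i).
Definition ssM x y : ssalg := ss_mk (fun i => x i *m y i).

Lemma ssDA : associative ssD.
Proof. by move=> x y z; apply: ssP => i; rewrite !ffunE addrA. Qed.
Lemma ssDC : commutative ssD.
Proof. by move=> x y; apply: ssP => i; rewrite !ffunE addrC. Qed.
Lemma ss0D : left_id ss0 ssD.
Proof. by move=> x; apply: ssP => i; rewrite !ffunE add0r. Qed.
Lemma ssND : left_inverse ss0 ssN ssD.
Proof. by move=> x; apply: ssP => i; rewrite !ffunE addNr. Qed.
HB.instance Definition _ := GRing.isZmodule.Build ssalg ssDA ssDC ss0D ssND.

Lemma ssMA : associative ssM.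
Proof. by move=> x y z; apply: ssP => i; rewrite !ffunE mulmxA. Qed.
Lemma ss1M : left_id ss1 ssM.
Proof. by move=> x; apply: ssP => i; rewrite !ffunE mul1mx. Qed.
Lemma ssM1 : right_id ss1 ssM.
Proof. by move=> x; apply: ssP => i; rewrite !ffunE mulmx1. Qed.
Lemma ssMDl : left_distributive ssM +%R.
Proof. by move=> x y z; apply: ssP => i; rewrite !ffunE mulmxDl. Qed.
Lemma ssMDr : right_distributive ssM +%R.
Proof. by move=> x y z; apply: ssP => i; rewrite !ffunE mulmxDr. Qed.
HB.instance Definition _ :=
  GRing.Zmodule_isPzRing.Build ssalg ssMA ss1M ssM1 ssMDl ssMDr.

Lemma ssZA a b x : ssZ a (ssZ b x) = ssZ (a * b) x.
Proof. by apply: ssP => i; rewrite !ffunE scalerA. Qed.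
Lemma ss1Z : left_id 1 ssZ.
Proof. by move=> x; apply: ssP => i; rewrite !ffunE scale1r. Qed.
Lemma ssZDr : right_distributive ssZ +%R.
Proof. by move=> c x y; apply: ssP => i; rewrite !ffunE scalerDr. Qed.
Lemma ssZDl x : {morph ssZ^~ x : a b / a + b}.
Proof. by move=> a b; apply: ssP => i; rewrite !ffunE scalerDl. Qed.
HB.instance Definition _ :=
  GRing.Zmodule_isLmodule.Build C ssalg ssZA ss1Z ssZDr ssZDl.

Lemma ss_mull_linear x : linear (fun y : ssalg => (x * y : ssalg)).
Proof.
move=> c y z; rewrite mulrDr; congr (_ + _).
by apply: ssP => i; rewrite !ffunE scalemxAr.
Qed.
Lemma ss_mulr_linear x : linear (fun y : ssalg => (y * x : ssalg)).
Proof.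
move=> c y z; rewrite mulrDl; congr (_ + _).
by apply: ssP => i; rewrite !ffunE scalemxAl.
Qed.

End SemiSimple.

Section TensorMap.
Variables (C : fieldType) (V W V' W' : lmodType C).

Lemma tlin_ext (U : lmodType C) (f g : V \ox W -> U) :
  linear f -> linear g -> (forall v w, f (tens v w) = g (tens v w)) -> f =1 g.
Proof.
move=> fL gL fg z; have [s ->] := tens_sum z.
elim: s => [|p s IH]; first by rewrite big_nil (lin_0 fL) (lin_0 gL).
by rewrite big_cons (lin_add fL) (lin_add gL) fg IH.
Qed.

Variables (f : V -> V') (g : W -> W').
Hypotheses (fL : linear f) (gL : linear g).

Lemma tmap_bilin : bilin (fun v w => tens (f v) (g w)).
Proof.
by split=> u c x y; rewrite ?fL ?gL ?tens_linl ?tens_linr.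
Qed.
Lemma tmap_tens v w : tmap f g (tens v w) = tens (f v) (g w).
Proof. exact: (tlift_tens tmap_bilin). Qed.
Lemma tmap_linear : linear (tmap f g).
Proof. exact: (tlift_linear tmap_bilin). Qed.

End TensorMap.

Section DoubleDerivation.
Variables (C : fieldType) (k : nat) (d : 'I_k -> nat).
Local Notation S := (ssalg C d).
Local Notation S2 := (S \ox S)%type.

Definition outl (a : S) : S2 -> S2 := tmap (fun x : S => (a * x : S)) id.
Definition outr (b : S) : S2 -> S2 := tmap id (fun y : S => (y * b : S)).
Definition innl (s : S) : S2 -> S2 := tmap id (fun y : S => (s * y : S)).
Definition innr (t : S) : S2 -> S2 := tmap (fun x : S => (x * t : S)) id.

Let idL (V : lmodType C) : linear (@id V). Proof. by []. Qed.

Lemma outl_linear a : linear (outl a).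
Proof. exact: (tmap_linear (@ss_mull_linear _ _ _ a) (@idL _)). Qed.
Lemma outr_linear a : linear (outr a).
Proof. exact: (tmap_linear (@idL _) (@ss_mulr_linear _ _ _ a)). Qed.
Lemma innl_linear a : linear (innl a).
Proof. exact: (tmap_linear (@idL _) (@ss_mull_linear _ _ _ a)). Qed.
Lemma innr_linear a : linear (innr a).
Proof. exact: (tmap_linear (@ss_mulr_linear _ _ _ a) (@idL _)). Qed.

Lemma outl_tens a x y : outl a (tens x y) = tens (a * x) y.
Proof. exact: (tmap_tens (@ss_mull_linear _ _ _ a) (@idL _)). Qed.
Lemma outr_tens a x y : outr a (tens x y) = tens x (y * a).
Proof. exact: (tmap_tens (@idL _) (@ss_mulr_linear _ _ _ a)). Qed.
Lemma innl_tens a x y : innl a (tens x y) = tens x (a * y).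
Proof. exact: (tmap_tens (@idL _) (@ss_mull_linear _ _ _ a)). Qed.
Lemma innr_tens a x y : innr a (tens x y) = tens (x * a) y.
Proof. exact: (tmap_tens (@ss_mulr_linear _ _ _ a) (@idL _)). Qed.

Definition is_dder (f : S -> S2) : Prop :=
  linear f /\ forall a b, f (a * b) = outl a (f b) + outr b (f a).

Definition dder_pred : {pred S -> S2} := fun f => `[< is_dder f >].

Lemma dder_submod : submod_closed dder_pred.
Proof.
split.
  apply/asboolP; split=> [c x y|a b] /=; first by rewrite scaler0 addr0.
  by rewrite (lin_0 (outl_linear a)) (lin_0 (outr_linear b)) addr0.
move=> c f g /asboolP[fL fD] /asboolP[gL gD]; apply/asboolP; split.
  move=> a x y.
  change (c *: f (a *: x + y) + g (a *: x + y) =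
    a *: (c *: f x + g x) + (c *: f y + g y)).
  by rewrite fL gL; exact: lin_comb_swap.
move=> a b.
change (c *: f (a * b) + g (a * b) =
  outl a (c *: f b + g b) + outr b (c *: f a + g a)).
by rewrite fD gD (outl_linear a c) (outr_linear b c) scalerDr addrACA.
Qed.
HB.instance Definition _ := GRing.isSubmodClosed.Build C (S -> S2) dder_pred
  dder_submod.

Record dder : Type := DDer { dder_fun :> S -> S2; dderP : dder_fun \in dder_pred }.
HB.instance Definition _ := [isSub for dder_fun].
HB.instance Definition _ := [Choice of dder by <:].
HB.instance Definition _ := [SubChoice_isSubLmodule of dder by <:].

Lemma innl_outl s a z : innl s (outl a z) = outl a (innl s z).
Proof.
move: z; apply: (@tlin_ext _ _ _ _ (fun z => innl s (outl a z))
  (fun z => outl a (innl s z))) => [c x y|c x y|x y].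
- by rewrite (outl_linear a) (innl_linear s).
- by rewrite (innl_linear s) (outl_linear a).
- by rewrite !outl_tens !innl_tens outl_tens.
Qed.
Lemma innl_outr s a z : innl s (outr a z) = outr a (innl s z).
Proof.
move: z; apply: (@tlin_ext _ _ _ _ (fun z => innl s (outr a z))
  (fun z => outr a (innl s z))) => [c x y|c x y|x y].
- by rewrite (outr_linear a) (innl_linear s).
- by rewrite (innl_linear s) (outr_linear a).
- by rewrite outr_tens !innl_tens outr_tens mulrA.
Qed.
Lemma innr_outl s a z : innr s (outl a z) = outl a (innr s z).
Proof.
move: z; apply: (@tlin_ext _ _ _ _ (fun z => innr s (outl a z))
  (fun z => outl a (innr s z))) => [c x y|c x y|x y].
- by rewrite (outl_linear a) (innr_linear s).
- by rewrite (innr_linear s) (outl_linear a).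
- by rewrite outl_tens !innr_tens outl_tens mulrA.
Qed.
Lemma innr_outr s a z : innr s (outr a z) = outr a (innr s z).
Proof.
move: z; apply: (@tlin_ext _ _ _ _ (fun z => innr s (outr a z))
  (fun z => outr a (innr s z))) => [c x y|c x y|x y].
- by rewrite (outr_linear a) (innr_linear s).
- by rewrite (innr_linear s) (outr_linear a).
- by rewrite !outr_tens !innr_tens outr_tens.
Qed.

Lemma dderl_subproof s (D : dder) : (fun u => innl s (D u)) \in dder_pred.
Proof.
have /asboolP[DL DD] := dderP D; apply/asboolP; split=> [c x y|a b].
  by rewrite (DL c x y) (innl_linear s).
by rewrite (DD a b) (lin_add (innl_linear s)) innl_outl innl_outr.
Qed.

Lemma dderr_subproof (D : dder) t : (fun u => innr t (D u)) \in dder_pred.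
Proof.
have /asboolP[DL DD] := dderP D; apply/asboolP; split=> [c x y|a b].
  by rewrite (DL c x y) (innr_linear t).
by rewrite (DD a b) (lin_add (innr_linear t)) innr_outl innr_outr.
Qed.

(* (s D t)(u) = D(u)' t (x) s D(u)'' *)
Definition dderl (s : S) (D : dder) : dder := DDer (dderl_subproof s D).
Definition dderr (D : dder) (t : S) : dder := DDer (dderr_subproof D t).

End DoubleDerivation.

Section TensorAlgebra.
Variables (C : fieldType) (k : nat) (d : 'I_k -> nat).
Local Notation S := (ssalg C d).
Local Notation Der := (dder C d).

Definition dsletter : Type := (S + Der)%type.
HB.instance Definition _ := Choice.on dsletter.

Definition dsfree : Type := falg C dsletter.
HB.instance Definition _ := GRing.Lmodule.on dsfree.
HB.instance Definition _ := GRing.PzRing.on dsfree.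

Definition fS (s : S) : dsfree := fletter C (inl s : dsletter).
Definition fD (D : Der) : dsfree := fletter C (inr D : dsletter).

(* The tensor algebra T_S(Der) is the free algebra on the disjoint union of *)
(* S and Der modulo the two-sided ideal which makes fS a morphism of        *)
(* C-algebras and fD a morphism of S-bimodules.                             *)
Inductive ds_rel : dsfree -> Prop :=
  | ds_rel_S c s t : ds_rel (fS (c *: s + t) - (c *: fS s + fS t))
  | ds_rel_1 : ds_rel (fS 1 - 1)
  | ds_rel_M s t : ds_rel (fS (s * t) - fS s * fS t)
  | ds_rel_D c D E : ds_rel (fD (c *: D + E) - (c *: fD D + fD E))
  | ds_rel_l s D : ds_rel (fD (dderl s D) - fS s * fD D)
  | ds_rel_r D t : ds_rel (fD (dderr D t) - fD D * fS t).

Inductive ds_ideal : dsfree -> Prop :=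
  | DsIdeal a r b : ds_rel r -> ds_ideal (a * r * b).

Definition DD : Type := lquot ds_ideal.
HB.instance Definition _ := GRing.Lmodule.on DD.

Definition dd_proj (x : dsfree) : DD := qproj ds_ideal x.
Definition dd_repr (x : DD) : dsfree := qrepr x.

Lemma span_idealMl (a x : dsfree) : span ds_ideal x -> span ds_ideal (a * x).
Proof.
elim=> [|_ [b r c rr]|y z _ sy _ sz|c y _ sy].
- by rewrite mulr0; exact: span0.
- by apply: spanG; rewrite !mulrA; exact: DsIdeal.
- by rewrite mulrDr; exact: spanD.
- by have <- := falg_scaleAr c a y; exact: spanZ.
Qed.

Lemma span_idealMr (a x : dsfree) : span ds_ideal x -> span ds_ideal (x * a).
Proof.
elim=> [|_ [b r c rr]|y z _ sy _ sz|c y _ sy].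
- by rewrite mul0r; exact: span0.
- by apply: spanG; rewrite -!mulrA (mulrA b); exact: DsIdeal.
- by rewrite mulrDl; exact: spanD.
- by have <- := falg_scaleAl c y a; exact: spanZ.
Qed.

Definition dd_one : DD := dd_proj 1.
Definition dd_mul (x y : DD) : DD := dd_proj (dd_repr x * dd_repr y).

Lemma dd_mulE (x y : dsfree) : dd_mul (dd_proj x) (dd_proj y) = dd_proj (x * y).
Proof.
have e z : span ds_ideal (dd_repr (dd_proj z) - z).
  by apply/qproj_eqP; exact: qreprK.
apply/qproj_eqP; set x' := dd_repr _; set y' := dd_repr _.
have -> : x' * y' - x * y = (x' - x) * y' + x * (y' - y).
  by rewrite mulrBl mulrBr addrA subrK.
by apply: spanD; [apply: span_idealMr; exact: e | apply: span_idealMl; exact: e].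
Qed.

Lemma dd_ind (P : DD -> Prop) : (forall x, P (dd_proj x)) -> forall x, P x.
Proof. by move=> h x; have := h (qrepr x); rewrite /dd_proj qreprK. Qed.

Lemma dd_projD x y : dd_proj (x + y) = dd_proj x + dd_proj y.
Proof. exact: raddfD. Qed.

Lemma dd_mulA : associative dd_mul.
Proof.
elim/dd_ind=> x; elim/dd_ind=> y; elim/dd_ind=> z.
by rewrite !dd_mulE mulrA.
Qed.
Lemma dd_mul1 : left_id dd_one dd_mul.
Proof. by elim/dd_ind=> x; rewrite dd_mulE mul1r. Qed.
Lemma dd_mulr1 : right_id dd_one dd_mul.
Proof. by elim/dd_ind=> x; rewrite dd_mulE mulr1. Qed.
Lemma dd_mulDl : left_distributive dd_mul +%R.
Proof.
elim/dd_ind=> x; elim/dd_ind=> y; elim/dd_ind=> z.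
by rewrite -dd_projD !dd_mulE mulrDl dd_projD.
Qed.
Lemma dd_mulDr : right_distributive dd_mul +%R.
Proof.
elim/dd_ind=> x; elim/dd_ind=> y; elim/dd_ind=> z.
by rewrite -dd_projD !dd_mulE mulrDr dd_projD.
Qed.
HB.instance Definition _ :=
  GRing.Zmodule_isPzRing.Build DD dd_mulA dd_mul1 dd_mulr1 dd_mulDl dd_mulDr.

End TensorAlgebra.

(* The two canonical maps, sealed like tens. *)
HB.lock Definition iS (C : fieldType) (k : nat) (d : 'I_k -> nat)
  (s : ssalg C d) : DD C d := dd_proj (fS s).
Canonical iS_unlockable := Unlockable iS.unlock.
Arguments iS {C k d} s.

HB.lock Definition iD (C : fieldType) (k : nat) (d : 'I_k -> nat)
  (D : dder C d) : DD C d := dd_proj (fD D).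
Canonical iD_unlockable := Unlockable iD.unlock.
Arguments iD {C k d} D.

Section Grading.
Variables (C : fieldType) (k : nat) (d : 'I_k -> nat).

(* The degree n part of DD: spanned by the products of elements of S and of *)
(* double derivations with exactly n factors of the second kind.            *)
Definition is_der (l : dsletter C d) : bool := if l is inr _ then true else false.
Definition dd_letter (l : dsletter C d) : DD C d :=
  match l with inl s => iS s | inr D => iD D end.
Definition dd_homog (n : nat) : DD C d -> Prop :=
  span (fun x => exists2 w : seq (dsletter C d),
    count is_der w = n & x = \prod_(l <- w) dd_letter l).

End Grading.

Section Schouten.
Variables (C : fieldType) (k : nat) (d : 'I_k -> nat).
Local Notation S := (ssalg C d).
Local Notation Der := (dder C d).
Local Notation D := (DD C d).

Definition tau12 (z : S \ox S \ox S) : S \ox S \ox S :=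
  tlift (fun (xy : S \ox S) (z : S) =>
    tlift (fun x y : S => tens (tens y x) z) xy) z.
Definition tau23 (z : S \ox S \ox S) : S \ox S \ox S :=
  tlift (fun (xy : S \ox S) (z : S) =>
    tlift (fun x y : S => tens (tens x z) y) xy) z.

(* f (x) 1 and 1 (x) f; triple tensors are bracketed to the left *)
Definition tens_l (f : S -> S \ox S) (z : S \ox S) : S \ox S \ox S :=
  tlift (fun x y : S => tens (f x) y) z.
Definition tens_r (f : S -> S \ox S) (z : S \ox S) : S \ox S \ox S :=
  tlift (fun x y : S => tlift (fun y' y'' : S => tens (tens x y') y'') (f y)) z.

(* Der (x) S and S (x) Der as maps S -> S (x) S (x) S *)
Definition eval_l (L : Der \ox S) (s : S) : S \ox S \ox S :=
  tlift (fun (E : Der) (t : S) => tens (E s) t) L.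
Definition eval_r (R : S \ox Der) (s : S) : S \ox S \ox S :=
  tlift (fun (t : S) (E : Der) =>
    tlift (fun y' y'' : S => tens (tens t y') y'') (E s)) R.

Definition is_brl (E F : Der) (L : Der \ox S) : Prop :=
  forall s, eval_l L s = tau23 (tens_l E (F s) - tens_r F (E s)).
Definition is_brr (E F : Der) (R : S \ox Der) : Prop :=
  forall s, eval_r R s = tau12 (tens_r E (F s) - tens_l F (E s)).

Definition dd_outl (b : D) : D \ox D -> D \ox D := tmap (fun x : D => (b * x : D)) id.
Definition dd_outr (c : D) : D \ox D -> D \ox D := tmap id (fun y : D => (y * c : D)).

Definition is_gswap (sigma : D \ox D -> D \ox D) : Prop :=
  linear sigma /\ forall m n (x y : D), dd_homog m x -> dd_homog n y ->
    sigma (tens x y) = (-1) ^+ (m * n) *: tens y x.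

(* In signs, m.+1 stands for m - 1. *)
Definition double_schouten (br : D -> D -> D \ox D) : Prop :=
  [/\ bilin br,
      [/\ forall s t : S, br (iS s) (iS t) = 0,
          forall (E : Der) (s : S), br (iD E) (iS s) = tmap (@iS C k d) (@iS C k d) (E s)
        & forall E F : Der, exists (L : Der \ox S) (R : S \ox Der),
            [/\ is_brl E F L, is_brr E F R &
                br (iD E) (iD F) = tmap (@iD C k d) (@iS C k d) L
                                   + tmap (@iS C k d) (@iD C k d) R]],
      forall m n (a b c : D), dd_homog m a -> dd_homog n b ->
        br a (b * c) = (-1) ^+ (m.+1 * n) *: dd_outl b (br a c)
                       + dd_outr c (br a b)
    & exists2 sigma, is_gswap sigma &
        forall m n (a b : D), dd_homog m a -> dd_homog n b ->
          br a b = - ((-1) ^+ (m.+1 * n.+1) *: sigma (br b a))].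

Definition dd_tmul (z : D \ox D) : D := tlift (fun x y : D => (x * y : D)) z.

End Schouten.

Section Quiver.
Variables (k : nat) (d : 'I_k -> nat).

(* ((i, j), p, q): an arrow j -> i with primary colour p, secondary colour q *)
Definition arrow_ok (x : 'I_k * 'I_k * nat * nat) : bool :=
  let: (i, j, p, q) := x in
  [&& 1 <= p <= d i, 1 <= q <= d j & ~~ [&& i == j, p == 1 & q == 1]]%N.

Record arrow : Type :=
  Arrow { arrow_val : 'I_k * 'I_k * nat * nat; _ : arrow_ok arrow_val }.
HB.instance Definition _ := [isSub for arrow_val].
HB.instance Definition _ := [Choice of arrow by <:].

Definition head (a : arrow) : 'I_k := (arrow_val a).1.1.1.
Definition tail (a : arrow) : 'I_k := (arrow_val a).1.1.2.
Definition prim (a : arrow) : nat := (arrow_val a).1.2.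
Definition sec (a : arrow) : nat := (arrow_val a).2.

(* (i, a_1 ... a_n): the path a_1 ... a_n starting at the vertex i *)
Fixpoint composable (i : 'I_k) (s : seq arrow) : bool :=
  if s is a :: s' then (tail a == i) && composable (head a) s' else true.

Record qpath : Type :=
  QPath { qpath_val : 'I_k * seq arrow; _ : composable qpath_val.1 qpath_val.2 }.
HB.instance Definition _ := [isSub for qpath_val].
HB.instance Definition _ := [Choice of qpath by <:].

Definition qsource (p : qpath) : 'I_k := (qpath_val p).1.
Definition qarrows (p : qpath) : seq arrow := (qpath_val p).2.
Definition qtarget (p : qpath) : 'I_k := last (qsource p) (map head (qarrows p)).

Lemma composable_cat i s t : composable i (s ++ t) =
  composable i s && composable (last i (map head s)) t.
Proof. by elim: s i => //= a s IH i; rewrite IH andbA. Qed.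

Lemma qcat_subproof (p q : qpath) (pq : qtarget p = qsource q) :
  composable (qsource p) (qarrows p ++ qarrows q).
Proof.
rewrite composable_cat -[last _ _]/(qtarget p) pq.
by case: p q {pq} => [[i s] /= ->] [[j t] /= ct].
Qed.

Definition qcat (p q : qpath) : option qpath :=
  if qtarget p =P qsource q is ReflectT pq
  then Some (@QPath (_, _) (qcat_subproof pq)) else None.

Definition qvertex (i : 'I_k) : qpath := @QPath (i, [::]) isT.

Lemma qpathP (p q : qpath) :
  qsource p = qsource q -> qarrows p = qarrows q -> p = q.
Proof.
case: p q => [[i s] ip] [[j t] iq]; rewrite /qsource /qarrows /= => ij st.
by apply: val_inj; rewrite /= ij st.
Qed.

Lemma qcatP p q r : qcat p q = Some r <->
  [/\ qtarget p = qsource q, qsource r = qsource p,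
      qtarget r = qtarget q & qarrows r = qarrows p ++ qarrows q].
Proof.
rewrite /qcat; case: (qtarget p =P qsource q) => [pq|npq]; last by split=> // -[].
have tE : last (qsource p) (map head (qarrows p ++ qarrows q)) = qtarget q.
  by rewrite map_cat last_cat -[last (qsource p) _]/(qtarget p) pq.
split=> [[<-]|[_ rs rt ra]]; first by split.
by congr Some; apply: qpathP; rewrite ?rs ?ra.
Qed.

Lemma qcat_def p q : qtarget p = qsource q -> {r | qcat p q = Some r}.
Proof. by rewrite /qcat; case: eqP => // pq _; eexists. Qed.

Lemma qcat_none p q : qtarget p <> qsource q -> qcat p q = None.
Proof. by rewrite /qcat; case: eqP. Qed.

Lemma qcatA p q r : obind (qcat p) (qcat q r) = obind (qcat^~ r) (qcat p q).
Proof.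
case: (qtarget q =P qsource r) => [qr|nqr]; last first.
  rewrite (qcat_none nqr) /=; case pqE: (qcat p q) => [x|] //=.
  by have /qcatP[_ _ xt _] := pqE; rewrite qcat_none // xt.
have [y yE] := qcat_def qr; have /qcatP[_ ys yt ya] := yE; rewrite yE /=.
case: (qtarget p =P qsource q) => [pq|npq]; last first.
  by rewrite (qcat_none npq) qcat_none // ys.
have [x xE] := qcat_def pq; have /qcatP[_ xs xt xa] := xE; rewrite xE /=.
have [z zE] : {z | qcat p y = Some z} by apply: qcat_def; rewrite ys.
rewrite zE; apply/esym/qcatP; have /qcatP[_ zs zt za] := zE.
by split; rewrite ?xt ?zs ?xs ?zt ?yt // za xa ya catA.
Qed.

Lemma qcat1p i p : qcat (qvertex i) p = if i == qsource p then Some p else None.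
Proof.
case: eqP => [e|ne]; last exact: qcat_none.
by apply/qcatP; split.
Qed.

Lemma qcatp1 i p : qcat p (qvertex i) = if qtarget p == i then Some p else None.
Proof.
case: eqP => [e|ne]; last exact: qcat_none.
by apply/qcatP; split; rewrite // /qarrows /= cats0.
Qed.

End Quiver.

Arguments qvertex {k} d i.

Definition pathalg (C : fieldType) (k : nat) (d : 'I_k -> nat) : Type :=
  {malg C[qpath d]}.
HB.instance Definition _ C k d := GRing.Lmodule.on (@pathalg C k d).

HB.lock Definition pbase (C : fieldType) (k : nat) (d : 'I_k -> nat)
  (p : qpath d) : pathalg C d := << p >>.
Canonical pbase_unlockable := Unlockable pbase.unlock.

Section PathAlgebra.
Variables (C : fieldType) (k : nat) (d : 'I_k -> nat).
Local Notation path := (qpath d).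
Local Notation pathalg := (pathalg C d).
Local Notation pbase := (@pbase C k d).

Definition obase (o : option path) : pathalg := if o is Some p then pbase p else 0.

Definition pa_one : pathalg := \sum_(i < k) pbase (qvertex d i).
Definition pa_mul (x y : pathalg) : pathalg :=
  mext (fun p => mext (fun q => obase (qcat p q)) y) x.

Lemma pa_mul_linearl y : linear (fun x => pa_mul x y).
Proof. exact: mext_linear. Qed.
Lemma pa_mul_linearr x : linear (fun y => pa_mul x y).
Proof. by apply: mext_linear_fun => p; exact: mext_linear. Qed.

Lemma obaseS p : obase (Some p) = pbase p. Proof. by []. Qed.
Lemma obaseN : obase None = 0. Proof. by []. Qed.

Lemma pa_mulU p q : pa_mul (pbase p) (pbase q) = obase (qcat p q).
Proof. by rewrite /pa_mul pbase.unlock !mextU. Qed.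

Lemma pa_ext (U : lmodType C) (f g : pathalg -> U) :
  linear f -> linear g -> (forall p, f (pbase p) = g (pbase p)) -> f =1 g.
Proof.
move=> fL gL fg; apply: malg_lin_ext => // p; have := fg p.
by rewrite pbase.unlock.
Qed.

Lemma pa_mul0 x : pa_mul x 0 = 0.
Proof. exact: (lin_0 (pa_mul_linearr x)). Qed.
Lemma pa_0mul x : pa_mul 0 x = 0.
Proof. exact: (lin_0 (pa_mul_linearl x)). Qed.

Lemma pa_mulA : associative pa_mul.
Proof.
move=> x y z; move: x; apply: pa_ext => [c x x'|c x x'|p].
- by rewrite pa_mul_linearl.
- by rewrite !pa_mul_linearl.
move: y; apply: pa_ext => [c y y'|c y y'|q].
- by rewrite pa_mul_linearl pa_mul_linearr.
- by rewrite pa_mul_linearr pa_mul_linearl.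
move: z; apply: pa_ext => [c z z'|c z z'|r].
- by rewrite (pa_mul_linearr (pbase q)) (pa_mul_linearr (pbase p)).
- exact: pa_mul_linearr.
rewrite !pa_mulU; have := qcatA p q r.
case: (qcat q r) => [y|]; case: (qcat p q) => [x|] e; rewrite ?obaseS ?obaseN.
- by rewrite !pa_mulU; congr obase; exact: e.
- by rewrite pa_0mul pa_mulU -obaseN; congr obase; exact: e.
- by rewrite pa_mul0 pa_mulU -obaseN; congr obase; exact: e.
- by rewrite pa_mul0 pa_0mul.
Qed.

Lemma pa_mul1 : left_id pa_one pa_mul.
Proof.
apply: pa_ext => [c x y|//|p]; first by rewrite pa_mul_linearr.
have -> : pa_mul pa_one (pbase p)
    = \sum_(i < k) pa_mul (pbase (qvertex d i)) (pbase p).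
  rewrite /pa_one; elim/big_rec2: _ => [|i y x _ <-]; first exact: pa_0mul.
  exact: (lin_add (pa_mul_linearl (pbase p))).
rewrite (bigD1 (qsource p)) //= big1 => [|i /negbTE ip];
  by rewrite pa_mulU qcat1p ?eqxx ?ip //= addr0.
Qed.

Lemma pa_mulr1 : right_id pa_one pa_mul.
Proof.
apply: pa_ext => [c x y|//|p]; first by rewrite pa_mul_linearl.
have -> : pa_mul (pbase p) pa_one
    = \sum_(i < k) pa_mul (pbase p) (pbase (qvertex d i)).
  rewrite /pa_one; elim/big_rec2: _ => [|i y x _ <-]; first exact: pa_mul0.
  exact: (lin_add (pa_mul_linearr (pbase p))).
rewrite (bigD1 (qtarget p)) //= big1 => [|i /negbTE ip].
  by rewrite pa_mulU qcatp1 eqxx addr0.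
by rewrite pa_mulU qcatp1 eq_sym ip.
Qed.

Lemma pa_mulDl : left_distributive pa_mul +%R.
Proof. by move=> x y z; exact: (lin_add (pa_mul_linearl z)). Qed.
Lemma pa_mulDr : right_distributive pa_mul +%R.
Proof. by move=> x; exact: (lin_add (pa_mul_linearr x)). Qed.

HB.instance Definition _ := GRing.Zmodule_isPzRing.Build pathalg
  pa_mulA pa_mul1 pa_mulr1 pa_mulDl pa_mulDr.

Definition vert (i : 'I_k) : pathalg := pbase (qvertex d i).

Lemma arr_subproof (a : arrow d) : composable (tail a) [:: a].
Proof. by rewrite /= eqxx. Qed.
Definition arr (a : arrow d) : pathalg := pbase (@QPath _ _ (_, _) (arr_subproof a)).

Definition pa_homog (n : nat) : pathalg -> Prop :=
  span (fun x => exists2 p : path, size (qarrows p) = n & x = pbase p).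

End PathAlgebra.

Section Necklace.
Variables (C : fieldType) (k : nat) (d : 'I_k -> nat).
Local Notation P := (pathalg C d).

Definition arr_at (i j : 'I_k) (p q : nat) : P :=
  if insub (i, j, p, q) is Some a then arr C a else 0.

(* The arrow j -> i with colours (p, q), where a loop with colours (1, 1), *)
(* which is not an arrow of the quiver, stands for - \sum_(r >= 2) (r, r). *)
Definition conn (j i : 'I_k) (p q : nat) : P :=
  if [&& i == j, p == 1%N & q == 1%N]
  then - \sum_(2 <= r < (d i).+1) arr_at i i r r
  else arr_at i j p q.

Definition word (s : seq (arrow d)) : P := \prod_(a <- s) arr C a.

(* u_{i+1}, v_{j+1} and (i, j) are indexed from 0 on *)
Definition termA (v u : seq (arrow d)) (i : 'I_(size u)) (j : 'I_(size v)) : P :=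
  let ui := tnth (in_tuple u) i in let vj := tnth (in_tuple v) j in
  if (tail ui == head vj) && (sec ui == prim vj)
  then word (take i u) * word (drop j.+1 v) * word (take j v)
       * conn (tail vj) (head ui) (prim ui) (sec vj) * word (drop i.+1 u)
  else 0.

Definition termB (v u : seq (arrow d)) (i : 'I_(size u)) (j : 'I_(size v)) : P :=
  let ui := tnth (in_tuple u) i in let vj := tnth (in_tuple v) j in
  if (head ui == tail vj) && (prim ui == sec vj)
  then word (take i u) * conn (tail ui) (head vj) (prim vj) (sec ui)
       * word (drop j.+1 v) * word (take j v) * word (drop i.+1 u)
  else 0.

Definition necklace (v u : seq (arrow d)) : P :=
  \sum_(i < size u) \sum_(j < size v)
    ((-1) ^+ ((i + j) * (size v).-1) *: termA i j
     - (-1) ^+ ((i + j + 1) * (size v).-1) *: termB i j).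

(* Vertices are excluded: they are the elements vert i. *)
Definition closed_path (s : seq (arrow d)) : bool :=
  (0 < size s)%N && cycle (fun a b => head a == tail b) s.

End Necklace.

Section SuperCyclic.
Variables (C : fieldType) (A : lmodType C).
Variables (mul : A -> A -> A) (hom : nat -> A -> Prop).

Inductive supercomm : A -> Prop :=
  | SuperComm m n a b : hom m a -> hom n b ->
      supercomm (mul a b - (-1) ^+ (m * n) *: mul b a).

Definition cyc : Type := lquot supercomm.
HB.instance Definition _ := GRing.Lmodule.on cyc.

Definition cyc_proj (a : A) : cyc := qproj supercomm a.

(* The grading shifted by one: elements of degree n get degree n - 1. *)
Definition cyc_shift (z : int) (x : cyc) : Prop :=
  if (z + 1)%R is Posz n then exists2 a, hom n a & x = cyc_proj a else x = 0.

End SuperCyclic.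

Section GradedLie.
Variables (C : fieldType) (L : lmodType C) (deg : int -> L -> Prop).

Definition grading : Prop :=
  [/\ forall z c x y, deg z x -> deg z y -> deg z (c *: x + y),
      forall x, exists (s : seq int) (f : int -> L),
        (forall z, deg z (f z)) /\ x = \sum_(z <- s) f z
    & forall (s : seq int) (f : int -> L), uniq s -> (forall z, deg z (f z)) ->
        \sum_(z <- s) f z = 0 -> forall z, z \in s -> f z = 0].

Definition graded_lie (br : L -> L -> L) : Prop :=
  [/\ grading /\ bilin br,
      forall y z a b, deg y a -> deg z b -> deg (y + z) (br a b),
      forall y z a b, deg y a -> deg z b ->
        br a b = - ((-1) ^ (y * z) *: br b a)
    & forall y z a b c, deg y a -> deg z b ->
        br a (br b c) = br (br a b) c + (-1) ^ (y * z) *: br b (br a c)].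

(* br' x y = (-1)^|x| br x y, where |x| is the (shifted) degree of x: the    *)
(* sign which turns a bracket of degree -1 on an unshifted graded space with *)
(* br x y = (-1)^(m * n) br y x for x, y of unshifted degrees m, n into a    *)
(* bracket on the shifted space which is graded antisymmetric.               *)
Definition shifted_bracket (br br' : L -> L -> L) : Prop :=
  bilin br' /\ forall z x y, deg z x -> br' x y = (-1) ^ z *: br x y.

End GradedLie.

Definition graded_lie_iso (C : fieldType) (L M : lmodType C)
    (degL : int -> L -> Prop) (degM : int -> M -> Prop)
    (brL : L -> L -> L) (brM : M -> M -> M) (phi : {linear L -> M}) : Prop :=
  [/\ bijective phi, forall z x, degL z x <-> degM z (phi x)
    & forall x y, phi (brL x y) = brM (phi x) (phi y)].

Section Brackets.
Variables (C : fieldType) (k : nat) (d : 'I_k -> nat).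

Definition DDcyc : Type := cyc (@GRing.mul (DD C d)) (@dd_homog C k d).
HB.instance Definition _ := GRing.Lmodule.on DDcyc.
Definition DDcyc_proj (a : DD C d) : DDcyc := cyc_proj _ _ a.
Definition DDcyc_deg (z : int) (x : DDcyc) : Prop := cyc_shift z x.

Definition CQcyc : Type := cyc (@GRing.mul (pathalg C d)) (@pa_homog C k d).
HB.instance Definition _ := GRing.Lmodule.on CQcyc.
Definition CQcyc_proj (a : pathalg C d) : CQcyc := cyc_proj _ _ a.
Definition CQcyc_deg (z : int) (x : CQcyc) : Prop := cyc_shift z x.

Definition schouten_induced (dbr : DD C d -> DD C d -> DD C d \ox DD C d)
    (br : DDcyc -> DDcyc -> DDcyc) : Prop :=
  forall a b, br (DDcyc_proj a) (DDcyc_proj b) = DDcyc_proj (dd_tmul (dbr a b)).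

Definition necklace_bracket (br : CQcyc -> CQcyc -> CQcyc) : Prop :=
  [/\ bilin br,
      forall v u : seq (arrow d), closed_path v -> closed_path u ->
        br (CQcyc_proj (word C v)) (CQcyc_proj (word C u))
        = CQcyc_proj (necklace C v u)
    & forall i x, br (CQcyc_proj (vert C d i)) x = 0
               /\ br x (CQcyc_proj (vert C d i)) = 0].

End Brackets.

(* Main.v *)
(* S is separable, so every double derivation of S is inner and the bimodule  *)
(* of double derivations is generated by E : s |-> s (x) 1 - 1 (x) s; hence   *)
(* DD is spanned by words in E and elements of S. The double bracket gives    *)
(* {{E, x}} = x (x) 1 - 1 (x) x for all x, so that {a, -} is, up to sign,     *)
(* the derivation which kills E and maps s in S to the commutator of s with   *)
(* the cyclic derivative of a in E. The Jacobi identity reduces to the        *)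
(* symmetry of the second cyclic derivative.                                  *)
(* For x in DD, the elements e_(1 al) x e_(be 1), with al and be coloured     *)
(* vertices, are the entries of a matrix over the path algebra (Morita        *)
(* equivalence). The entries for x = E are the arrows, subject only to        *)
(* \sum_p e_(1 p) E e_(p 1) = 0 at each vertex, which is why the loop with    *)
(* bi-colour (1, 1) is minus the sum of the others. The trace of this matrix  *)
(* gives the isomorphism. Changing {a, -} by an inner derivation, which does  *)
(* not affect the induced bracket, one obtains the derivation which kills S   *)
(* and maps E to the commutator of E and the cyclic derivative of a; its      *)
(* values on closed paths are the two families of terms of the necklace       *)
(* bracket.                                                                   *)
Require Import Defs.
From HB Require Import structures.
From mathcomp Require Import all_boot all_order all_algebra.
From mathcomp Require Import finmap monalg.
From mathcomp Require Import mathcomp_extra boolp functions.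
Import Defs.

Set Implicit Arguments.
Unset Strict Implicit.
Unset Printing Implicit Defensive.

Import GRing.Theory.
Local Open Scope ring_scope.

(** The computation takes place on words in elements of S and the class E = [gE] of the double
    derivation s |-> s (x) 1 - 1 (x) s. By [innerP] a double derivation f is the commutator with
    [primitive f], which the separability idempotent of S provides; hence [iD_inner] expresses f
    through E, and the degree in [DD] counts the letters E ([homog_wspan]).

    The axioms of the double Schouten bracket then determine its values: see [br_gE] and [brS_word].
    For the single bracket, {a, -} kills E ([lbE]) and sends s to the commutator of s with the
    cyclic derivative [cder] of a, up to sign ([lb_word_iS]). Since {a, -} is a graded derivation,
    the Jacobi identity need only be checked with a single letter as last argument. For E it is
    trivial. For an element of S it follows from [lb2_br_word], which says that {a, -}, extended to
    tensors, is a derivation of {{t, -}}; its core is [br_cder_sym], the symmetry of the second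
    cyclic derivative. The outcome, [lb_jacobi], holds in [DD] itself. Antisymmetry holds modulo
    supercommutators ([proj_lb_anti]), and so does the vanishing on supercommutators
    ([proj_lb_comm]), which gives the induced bracket ([cyc_bracketE]).

    Let e be the sum over i of the matrix units e^i_(1 1). The map [psi] identifies paths with
    elements of the corner e DD e: the arrow j -> i with colours (p, q) becomes e_(1 q) E e_(p 1).
    In the other direction, [rho] represents [DD] by matrices over the path algebra. The relation
    [gauge_rel] satisfied by E corresponds to the convention for the loop of bi-colour (1, 1)
    ([sum_conn]). By [psi_rho] and [rho_path], the trace of [rho] and [psi] are inverse to each
    other modulo supercommutators ([cyc_phiK], [cyc_psiK]).

    For the formula, {a, -} is corrected by the inner derivation of [cder a], which is invisible
    modulo supercommutators. What remains kills S and replaces E by a graded commutator of E with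
    [cder a] ([lb_word_word], [proj_lb_word]). On words of arrows, products e_(1 q) e_(p 1) appear
    at the cuts; they vanish unless vertices and colours match ([inl_outr]), and the two halves of
    the commutator are the terms A and B ([psi_necklace]). The necklace formula and the transported
    Lie bracket differ by the sign of the shifted degree of the first argument, which [CQpar]
    supplies. *)

(** * Linear maps, spans and quotients *)

Section LinearFunctions.
Variables (C : fieldType) (V U : lmodType C) (f : V -> U).
Hypothesis fL : linear f.

Lemma lin_opp : {morph f : x / - x}.
Proof. by move=> x; rewrite -!scaleN1r (lin_scale fL). Qed.
Lemma lin_sub : {morph f : x y / x - y}.
Proof. by move=> x y; rewrite (lin_add fL) lin_opp. Qed.
Lemma lin_addZ x l y : f (x + l *: y) = f x + l *: f y.
Proof. by rewrite (lin_add fL) (lin_scale fL). Qed.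
Lemma lin_sum I (r : seq I) (P : pred I) (F : I -> V) :
  f (\sum_(i <- r | P i) F i) = \sum_(i <- r | P i) f (F i).
Proof. exact: (big_morph f (lin_add fL) (lin_0 fL)). Qed.
End LinearFunctions.

Lemma lin_comp (C : fieldType) (V W U : lmodType C) (f : W -> U) (g : V -> W) :
  linear f -> linear g -> linear (fun x => f (g x)).
Proof. by move=> fL gL c x y; rewrite gL fL. Qed.

Lemma lin_id (C : fieldType) (V : lmodType C) : linear (fun x : V => x).
Proof. by []. Qed.

Lemma lin_sumf (C : fieldType) (V U : lmodType C) I (r : seq I) (P : pred I)
    (f : I -> V -> U) :
  (forall i, linear (f i)) -> linear (fun x => \sum_(i <- r | P i) f i x).
Proof.
move=> fL c x y; rewrite scaler_sumr -big_split /=.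
by apply: eq_bigr => i _; rewrite fL.
Qed.

Lemma lin_addf (C : fieldType) (V U : lmodType C) (f g : V -> U) :
  linear f -> linear g -> linear (fun x => f x + g x).
Proof. by move=> fL gL c x y; rewrite fL gL scalerDr addrACA. Qed.

Lemma lin_scalef (C : fieldType) (V U : lmodType C) (a : C) (f : V -> U) :
  linear f -> linear (fun x => a *: f x).
Proof. by move=> fL c x y; rewrite fL scalerDr !scalerA mulrC. Qed.

Lemma lin_oppf (C : fieldType) (V U : lmodType C) (f : V -> U) :
  linear f -> linear (fun x => - f x).
Proof. by move=> fL c x y; rewrite fL opprD scalerN. Qed.

Lemma lin_subf (C : fieldType) (V U : lmodType C) (f g : V -> U) :
  linear f -> linear g -> linear (fun x => f x - g x).
Proof. by move=> fL gL; exact: (lin_addf fL (lin_oppf gL)). Qed.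

Lemma lin_cst0 (C : fieldType) (V U : lmodType C) : linear (fun _ : V => 0 : U).
Proof. by move=> c x y; rewrite scaler0 addr0. Qed.

Section Span.
Variables (C : fieldType) (V : lmodType C).
Implicit Types (G H : V -> Prop) (x y : V).

Lemma span_lin G c x y : span G x -> span G y -> span G (c *: x + y).
Proof. by move=> hx hy; apply: spanD => //; exact: spanZ. Qed.
Lemma spanN G x : span G x -> span G (- x).
Proof. by rewrite -scaleN1r; exact: spanZ. Qed.
Lemma spanB G x y : span G x -> span G y -> span G (x - y).
Proof. by move=> hx hy; apply: spanD => //; exact: spanN. Qed.
Lemma span_sum G I (r : seq I) (P : pred I) (F : I -> V) :
  (forall i, P i -> span G (F i)) -> span G (\sum_(i <- r | P i) F i).
Proof. by move=> h; apply: big_ind => //; [exact: span0 | exact: spanD]. Qed.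

Lemma span_map (W : lmodType C) G (K : W -> Prop) (f : V -> W) :
  linear f -> (forall x, G x -> span K (f x)) -> forall x, span G x -> span K (f x).
Proof.
move=> fL h x; elim=> [|{}x /h //|{}x y _ hx _ hy|c {}x _ hx].
- by rewrite (lin_0 fL); exact: span0.
- by rewrite (lin_add fL); exact: spanD.
- by rewrite (lin_scale fL); exact: spanZ.
Qed.

Lemma span_lin_ext (W : lmodType C) G (f g : V -> W) :
  linear f -> linear g -> (forall x, G x -> f x = g x) ->
  forall x, span G x -> f x = g x.
Proof.
move=> fL gL h x; elim=> [|{}x /h //|{}x y _ hx _ hy|c {}x _ hx].
- by rewrite (lin_0 fL) (lin_0 gL).
- by rewrite (lin_add fL) (lin_add gL) hx hy.
- by rewrite (lin_scale fL) (lin_scale gL) hx.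
Qed.
End Span.

Section QuotientLift.
Variables (C : fieldType) (V U : lmodType C) (G : V -> Prop) (f : V -> U).
Hypotheses (fL : linear f) (fG : forall x, G x -> f x = 0).

Definition qlift (q : lquot G) : U := f (qrepr q).

Lemma qliftE x : qlift (qproj G x) = f x.
Proof.
apply/eqP; rewrite -subr_eq0 -(lin_sub fL); apply/eqP.
apply: (span_lin_ext fL (@lin_cst0 _ _ _) fG).
by apply/qproj_eqP; exact: qreprK.
Qed.

Lemma qlift_linear : linear qlift.
Proof. by move=> c p q; rewrite -{1}(qreprK p) -{1}(qreprK q) -linearP qliftE fL. Qed.
End QuotientLift.

Lemma qproj_linear (C : fieldType) (V : lmodType C) (G : V -> Prop) : linear (qproj G).
Proof. by move=> c x y; rewrite linearP. Qed.

Lemma qproj_0 (C : fieldType) (V : lmodType C) (G : V -> Prop) x :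
  span G x -> qproj G x = 0.
Proof. by move=> Gx; rewrite -(raddf0 (qproj G)); apply/qproj_eqP; rewrite subr0. Qed.

Lemma sgn_eq (R : pzRingType) a b : odd a = odd b -> (-1) ^+ a = (-1) ^+ b :> R.
Proof. by move=> ab; rewrite -signr_odd ab signr_odd. Qed.

Lemma sgn_scale (C : fieldType) (V : lmodType C) a b (x : V) :
  odd a = odd b -> (-1) ^+ a *: x = (-1) ^+ b *: x.
Proof. by move=> ab; rewrite (sgn_eq C ab). Qed.

Lemma sgn_scaleN (C : fieldType) (V : lmodType C) a b c (x : V) :
  odd (a + b) = ~~ odd c -> (-1) ^+ a *: ((-1) ^+ b *: x) = - ((-1) ^+ c *: x).
Proof.
move=> abc; rewrite scalerA -exprD -scaleNr -[- _ ^+ c]mulN1r -exprS.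
by apply: sgn_scale; rewrite abc.
Qed.

Lemma signZK (C : fieldType) (V : lmodType C) n (x : V) :
  (-1) ^+ n *: ((-1) ^+ n *: x) = x.
Proof. by rewrite scalerA -exprMn mulrNN mul1r expr1n scale1r. Qed.

Section FreeWords.
Variables (C : fieldType) (X : choiceType).

Definition fbase (w : seq X) : falg C X := << (w : fword X) >>.

Lemma fbaseM (u v : seq X) : fbase u * fbase v = fbase (u ++ v).
Proof. by rewrite /fbase malgM_def fgmulUU mulr1. Qed.
Lemma fbase0 : fbase [::] = 1. Proof. by []. Qed.
Lemma fbase_cons x (w : seq X) : fbase (x :: w) = fletter C x * fbase w.
Proof. by rewrite -[fletter C x]/(fbase [:: x]) fbaseM. Qed.

Lemma falg_ext (U : lmodType C) (f g : falg C X -> U) :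
  linear f -> linear g -> (forall w, f (fbase w) = g (fbase w)) -> f =1 g.
Proof. exact: malg_lin_ext. Qed.

Lemma falg_mull_linear (x : falg C X) :
  linear (fun y : falg C X => (x * y : falg C X)).
Proof. by move=> c y z; rewrite mulrDr -falg_scaleAr. Qed.
Lemma falg_mulr_linear (x : falg C X) :
  linear (fun y : falg C X => (y * x : falg C X)).
Proof. by move=> c y z; rewrite mulrDl -falg_scaleAl. Qed.

End FreeWords.
Arguments fbase C {X} w.

(** * Algebra structure of [DD] *)

Section DDAlgebra.
Variables (C : fieldType) (k : nat) (d : 'I_k -> nat).
Local Notation D := (DD C d).
Local Notation S := (ssalg C d).

Lemma dd_proj_linear : linear (@dd_proj C k d).
Proof. exact: qproj_linear. Qed.
Lemma dd_projZ c (x : dsfree C d) : dd_proj (c *: x) = c *: dd_proj x.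
Proof. exact: (lin_scale dd_proj_linear). Qed.

Lemma dd_mulP (x y : dsfree C d) : dd_proj (x * y) = dd_proj x * dd_proj y.
Proof. by rewrite -[RHS]/(dd_mul _ _) dd_mulE. Qed.

Lemma dd_scaleAl c (x y : D) : c *: (x * y) = (c *: x) * y.
Proof.
elim/dd_ind: x => x; elim/dd_ind: y => y.
by rewrite -dd_mulP -!dd_projZ -dd_mulP; congr dd_proj; exact: falg_scaleAl.
Qed.
Lemma dd_scaleAr c (x y : D) : c *: (x * y) = x * (c *: y).
Proof.
elim/dd_ind: x => x; elim/dd_ind: y => y.
by rewrite -dd_mulP -!dd_projZ -dd_mulP; congr dd_proj; exact: falg_scaleAr.
Qed.

Lemma dd_mull_linear (x : D) : linear (fun y : D => (x * y : D)).
Proof. by move=> c y z; rewrite mulrDr -dd_scaleAr. Qed.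
Lemma dd_mulr_linear (x : D) : linear (fun y : D => (y * x : D)).
Proof. by move=> c y z; rewrite mulrDl -dd_scaleAl. Qed.

Lemma ds_rel0 r : ds_rel r -> dd_proj r = 0 :> D.
Proof.
move=> rr; apply: qproj_0; apply: spanG.
by rewrite -[r]mulr1 -[r]mul1r; exact: DsIdeal.
Qed.

Lemma iS_linear : linear (@iS C k d).
Proof.
move=> c s t; rewrite unlock; apply/eqP; rewrite -subr_eq0 -dd_projZ -dd_projD.
by rewrite -raddfB; apply/eqP; exact: ds_rel0 (ds_rel_S c s t).
Qed.
Lemma iD_linear : linear (@iD C k d).
Proof.
move=> c s t; rewrite unlock; apply/eqP; rewrite -subr_eq0 -dd_projZ -dd_projD.
by rewrite -raddfB; apply/eqP; exact: ds_rel0 (ds_rel_D c s t).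
Qed.
Lemma iSM (s t : S) : iS (s * t) = iS s * iS t.
Proof.
rewrite unlock; apply/eqP; rewrite -subr_eq0 -dd_mulP.
by rewrite -raddfB; apply/eqP; exact: ds_rel0 (ds_rel_M s t).
Qed.
Lemma iS1 : iS (1 : S) = 1.
Proof.
rewrite unlock; apply/eqP; rewrite -subr_eq0.
have /eqP := ds_rel0 (@ds_rel_1 C k d).
by rewrite /dd_proj raddfB.
Qed.
Lemma iD_l (s : S) f : iD (dderl s f) = iS s * iD f.
Proof.
rewrite !unlock; apply/eqP; rewrite -subr_eq0 -dd_mulP.
by rewrite -raddfB; apply/eqP; exact: ds_rel0 (ds_rel_l s f).
Qed.
Lemma iD_r f (t : S) : iD (dderr f t) = iD f * iS t.
Proof.
rewrite !unlock; apply/eqP; rewrite -subr_eq0 -dd_mulP.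
by rewrite -raddfB; apply/eqP; exact: ds_rel0 (ds_rel_r f t).
Qed.

Lemma dd_proj1 : dd_proj (1 : dsfree C d) = 1. Proof. by []. Qed.

Lemma dd_proj_word (w : seq (dsletter C d)) :
  dd_proj (fbase C w : dsfree C d) = \prod_(l <- w) dd_letter l.
Proof.
elim: w => [|l w IH]; first by rewrite big_nil -dd_proj1 fbase0.
rewrite big_cons -IH fbase_cons dd_mulP; congr (_ * _).
by case: l => x; rewrite /= unlock.
Qed.

Lemma dd_words (x : D) :
  span (fun y => exists w : seq (dsletter C d), y = \prod_(l <- w) dd_letter l) x.
Proof.
elim/dd_ind: x => x; rewrite (mext_unique dd_proj_linear); apply: span_sum => w _.
by apply: spanZ; apply: spanG; exists w; exact: dd_proj_word.
Qed.

End DDAlgebra.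

(** * Inner double derivations and words in E *)

Section MatrixUnits.
Variables (C : fieldType) (k : nat) (d : 'I_k -> nat).
Local Notation S := (ssalg C d).

(* The matrix units e^i_(1 p) and e^i_(p 1), with rows and columns numbered *)
(* from 1 on, like the colours of the arrows.                               *)
Definition eL (i : 'I_k) (p : nat) : S := ss_mk (fun i' =>
  \matrix_(r, c) ([&& i' == i, r == 0 :> nat & c.+1 == p])%:R).
Definition eR (i : 'I_k) (p : nat) : S := ss_mk (fun i' =>
  \matrix_(r, c) ([&& i' == i, c == 0 :> nat & r.+1 == p])%:R).

Lemma ssDE (x y : S) i : (x + y) i = x i + y i. Proof. exact: ffunE. Qed.
Lemma ssZE c (x : S) i : (c *: x) i = c *: x i. Proof. exact: ffunE. Qed.
Lemma ssME (x y : S) i : (x * y) i = x i *m y i. Proof. exact: ffunE. Qed.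
Lemma ss0E i : (0 : S) i = 0. Proof. exact: ffunE. Qed.
Lemma ss1E i : (1 : S) i = 1%:M. Proof. exact: ffunE. Qed.
Lemma ss_sumE I (r : seq I) (P : pred I) (F : I -> S) i :
  (\sum_(j <- r | P j) F j) i = \sum_(j <- r | P j) F j i.
Proof. by apply: (big_morph (fun x : S => x i)) => [x y|]; [exact: ssDE | exact: ss0E]. Qed.
Lemma eLE i p i' r c : eL i p i' r c = [&& i' == i, r == 0 :> nat & c.+1 == p]%:R.
Proof. by rewrite ffunE mxE. Qed.
Lemma eRE i p i' r c : eR i p i' r c = [&& i' == i, c == 0 :> nat & r.+1 == p]%:R.
Proof. by rewrite ffunE mxE. Qed.

Lemma eL1 i : eL i 1 = eR i 1.
Proof.
apply: ssP => i'; apply/matrixP=> r c; rewrite eLE eRE !eqSS.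
by congr (_ && _)%:R; rewrite andbC.
Qed.

Lemma eLs i (p : 'I_(d i)) (s : S) : eL i p.+1 * s = \sum_(r < d i) s i p r *: eL i r.+1.
Proof.
apply: ssP => i'; apply/matrixP=> r c; rewrite ss_sumE ssME mxE summxE.
under [RHS]eq_bigr do rewrite ssZE mxE eLE.
case: (eqVneq i' i) r c => [->{i'}|ne] r c; last first.
  by rewrite !big1 // => q _; rewrite ?mulr0 // eLE (negbTE ne) mul0r.
have [r0|nr0] := eqVneq (r : nat) 0%N; last first.
  by rewrite !big1 // => q _; rewrite ?mulr0 // eLE (negbTE nr0) andbF mul0r.
rewrite [RHS](bigD1 c) //= eqxx mulr1 [X in _ = _ + X]big1 ?addr0; last first.
  by move=> q qc; rewrite eqSS (inj_eq val_inj) eq_sym (negbTE qc) mulr0.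
rewrite (bigD1 p) //= eLE !eqxx r0 /= mul1r big1 ?addr0 // => q qp.
by rewrite eLE eqSS (inj_eq val_inj) (negbTE qp) !andbF mul0r.
Qed.

Lemma seR i (p : 'I_(d i)) (s : S) : s * eR i p.+1 = \sum_(r < d i) s i r p *: eR i r.+1.
Proof.
apply: ssP => i'; apply/matrixP=> r c; rewrite ss_sumE ssME mxE summxE.
under [RHS]eq_bigr do rewrite ssZE mxE eRE.
case: (eqVneq i' i) r c => [->{i'}|ne] r c; last first.
  by rewrite !big1 // => q _; rewrite ?mulr0 // eRE (negbTE ne) mulr0.
have [c0|nc0] := eqVneq (c : nat) 0%N; last first.
  by rewrite !big1 // => q _; rewrite ?mulr0 // eRE (negbTE nc0) andbF mulr0.
rewrite [RHS](bigD1 r) //= eqxx mulr1 [X in _ = _ + X]big1 ?addr0; last first.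
  by move=> q qc; rewrite eqSS (inj_eq val_inj) eq_sym (negbTE qc) mulr0.
rewrite (bigD1 p) //= eRE !eqxx c0 /= mulr1 big1 ?addr0 // => q qp.
by rewrite eRE eqSS (inj_eq val_inj) (negbTE qp) !andbF mulr0.
Qed.

(** The tensor behind this sum, with (x) in place of the product, is the separability idempotent of
    S. *)
Lemma sum_eRL : \sum_(i < k) \sum_(p < d i) eR i p.+1 * eL i p.+1 = 1 :> S.
Proof.
apply: ssP => i; apply/matrixP=> r c; rewrite ss_sumE ss1E mxE summxE.
rewrite (bigD1 i) //= [X in _ + X]big1 ?addr0 => [|j ji]; last first.
  rewrite ss_sumE summxE big1 // => p _; rewrite ssME mxE big1 // => q _.
  by rewrite eRE eq_sym (negbTE ji) mul0r.
rewrite ss_sumE summxE (bigD1 r) //= [X in _ + X]big1 ?addr0 => [|p pr]; last first.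
  rewrite ssME mxE big1 // => q _.
  by rewrite eRE eqSS (inj_eq val_inj) [r == p]eq_sym (negbTE pr) !andbF mul0r.
pose o : 'I_(d i) := Ordinal (leq_ltn_trans (leq0n r) (ltn_ord r)).
rewrite ssME !mxE (bigD1 o) //= [X in _ + X]big1 ?addr0 => [|q qo]; last first.
  by move: qo; rewrite eRE -(inj_eq val_inj) /= => /negbTE ->; rewrite andbF mul0r.
by rewrite eRE eLE !eqxx mul1r eqSS eq_sym.
Qed.

Lemma eLR i (p : 'I_(d i)) j (q : 'I_(d j)) :
  eL i p.+1 * eR j q.+1 = ((i == j) && (p == q :> nat))%:R *: eL i 1.
Proof.
apply: ssP => i'; apply/matrixP=> r c; rewrite ssME ssZE !mxE eLE.
case: (eqVneq i' i) r c => [->{i'}|ne] r c /=; last first.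
  by rewrite mulr0 big1 // => l _; rewrite eLE (negbTE ne) mul0r.
rewrite (bigD1 p) //= eLE !eqxx andbT big1 ?addr0 => [|l lp]; last first.
  by rewrite eLE eqSS (inj_eq val_inj) (negbTE lp) !andbF mul0r.
rewrite eRE !eqSS; case: (i == j); case: (nat_of_ord r == 0%N);
  by case: (nat_of_ord c == 0%N); rewrite ?andbF ?andbT ?mulr0 ?mul0r ?mul1r ?mulr1.
Qed.

Section Nonzero.
Hypothesis d_gt0 : forall i, (0 < d i)%N.

Lemma colour_ord i p : (0 < p <= d i)%N -> exists p' : 'I_(d i), p = p'.+1.
Proof. by case: p => //= p pd; exists (Ordinal pd). Qed.

Lemma eL_eR i j p q : (0 < p <= d i)%N -> (0 < q <= d j)%N ->
  eL i p * eR j q = ((i == j) && (p == q))%:R *: eL i 1.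
Proof. by move=> /colour_ord[p' ->] /colour_ord[q' ->]; rewrite eLR eqSS. Qed.

Lemma e11_eL i j p : (0 < p <= d j)%N -> eL i 1 * eL j p = (i == j)%:R *: eL j p.
Proof.
have i1 : (0 < 1 <= d i)%N by rewrite d_gt0.
have [i' e] := colour_ord i1; move=> /colour_ord[q ->]; rewrite [1%N]e eLs.
rewrite (eq_bigr (fun r : 'I_(d i) => (if (i == j) && (r == q :> nat) then 1 else 0) *: eL i r.+1)); last first.
  move=> r _; rewrite eLE !eqSS; congr (_ *: _).
  by case: e => <-; rewrite eqxx; case: (i == j); case: (_ == _).
have [ij|ij] /= := eqVneq i j; last by rewrite big1 ?scale0r // => r _; rewrite scale0r.
case: _ / ij q => q.
rewrite (bigD1 q) //= eqxx big1 ?addr0 // => r rq.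
by rewrite (inj_eq val_inj) (negbTE rq) scale0r.
Qed.

Lemma eR_e11 i j p : (0 < p <= d j)%N -> eR j p * eL i 1 = (i == j)%:R *: eR j p.
Proof.
have i1 : (0 < 1 <= d i)%N by rewrite d_gt0.
have [i' e] := colour_ord i1; move=> /colour_ord[q ->]; rewrite eL1 [1%N]e seR.
rewrite (eq_bigr (fun r : 'I_(d i) => (if (i == j) && (r == q :> nat) then 1 else 0) *: eR i r.+1)); last first.
  move=> r _; rewrite eRE !eqSS; congr (_ *: _).
  by case: e => <-; rewrite eqxx; case: (i == j); case: (_ == _).
have [ij|ij] /= := eqVneq i j; last by rewrite big1 ?scale0r // => r _; rewrite scale0r.
case: _ / ij q => q.
rewrite (bigD1 q) //= eqxx big1 ?addr0 // => r rq.
by rewrite (inj_eq val_inj) (negbTE rq) scale0r.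
Qed.

Lemma e11_e11 i j : eL i 1 * eL j 1 = (i == j)%:R *: eL j 1 :> S.
Proof. by apply: e11_eL; rewrite d_gt0. Qed.

(** The entry of s at row p and column q if i = j, and 0 otherwise. The sum over r avoids a
    transport of q along an equality of vertices. *)
Definition scoef (s : S) i (p : 'I_(d i)) j (q : 'I_(d j)) : C :=
  \sum_(r < d i) s i p r * ((i == j) && (r == q :> nat))%:R.

Lemma eLsR i (p : 'I_(d i)) (s : S) j (q : 'I_(d j)) :
  eL i p.+1 * s * eR j q.+1 = scoef s p q *: eL i 1.
Proof.
rewrite eLs mulr_suml scaler_suml; apply: eq_bigr => r _.
by rewrite (lin_scale (ss_mulr_linear (eR j q.+1))) eLR scalerA.
Qed.

Lemma scoef_linear i (p : 'I_(d i)) j (q : 'I_(d j)) : linear (fun s => scoef s p q : C^o).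
Proof.
move=> c s t; rewrite scaler_sumr -big_split /=; apply: eq_bigr => r _.
by rewrite ssDE ssZE !mxE mulrDl -mulrA.
Qed.

Lemma eL1_inj i : injective (fun c : C => c *: eL i 1).
Proof.
move=> a b /(congr1 (fun x : S => x i)); rewrite !ssZE.
have o : 'I_(d i) by exact: Ordinal (d_gt0 i).
by move/matrixP/(_ (Ordinal (d_gt0 i)) (Ordinal (d_gt0 i))); rewrite !mxE eLE !eqxx !mulr1.
Qed.

(** Insert the resolution of 1 from [sum_eRL] between s and t. *)
Lemma scoefM (s t : S) i (p : 'I_(d i)) j (q : 'I_(d j)) :
  scoef (s * t) p q = \sum_(l < k) \sum_(r < d l) scoef s p r * scoef t r q.
Proof.
apply: (@eL1_inj i); rewrite -eLsR.
have -> : s * t = s * 1 * t by rewrite mulr1.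
rewrite -sum_eRL mulr_sumr.
rewrite mulr_suml mulr_sumr mulr_suml scaler_suml; apply: eq_bigr => l _.
rewrite mulr_sumr mulr_suml mulr_sumr mulr_suml scaler_suml; apply: eq_bigr => r _.
rewrite !mulrA eLsR -!mulrA [X in _ * X = _]mulrA eLsR.
rewrite (lin_scale (ss_mulr_linear _)) (lin_scale (ss_mull_linear _)) !scalerA.
rewrite e11_e11; have [il|ne] := eqVneq i l.
  by rewrite scale1r; have -> : eL l 1 = eL i 1 by rewrite il.
rewrite scale0r scaler0; have -> : scoef s p r = 0; last by rewrite mul0r scale0r.
by rewrite /scoef big1 // => a _; rewrite (negbTE ne) mulr0.
Qed.

Lemma scoef1 i (p : 'I_(d i)) j (q : 'I_(d j)) :
  scoef 1 p q = ((i == j) && (p == q :> nat))%:R.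
Proof. by apply: (@eL1_inj i); rewrite -eLsR mulr1 eLR. Qed.

End Nonzero.
End MatrixUnits.

Section Inner.
Variables (C : fieldType) (k : nat) (d : 'I_k -> nat).
Local Notation S := (ssalg C d).
Local Notation D := (DD C d).

Definition gauge_fun (s : S) : S \ox S := tens s (1 : S) - tens (1 : S) s.
Lemma gauge_subproof : gauge_fun \in @dder_pred C k d.
Proof.
apply/asboolP; split=> [c x y|a b].
  rewrite /gauge_fun (tens_linl (1 : S)) (tens_linr (1 : S) c x y) scalerBr opprD.
  by rewrite addrACA.
rewrite /gauge_fun (lin_sub (outl_linear a)) (lin_sub (outr_linear b)).
by rewrite !outl_tens !outr_tens !mulr1 !mul1r addrA subrK.
Qed.
(* The double derivation s |-> s (x) 1 - 1 (x) s generates the bimodule of  *)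
(* double derivations, since all of them are inner.                         *)
Definition gauge : dder C d := DDer gauge_subproof.

(* The separability idempotent \sum_p e_(p 1) (x) e_(1 p) makes the double  *)
(* derivation f the inner one of primitive f.                               *)
Definition primitive (f : dder C d) : S \ox S :=
  \sum_(i < k) \sum_(p < d i) outl (eR C d i p.+1) (f (eL C d i p.+1)).

Lemma primitive_linear : linear primitive.
Proof.
apply: lin_sumf => i; apply: lin_sumf => p c f g.
by rewrite -(outl_linear (eR C d i p.+1)).
Qed.

(** The separability idempotent is S-central, so s times [primitive f] is the sum of e_(p 1) f(e_(1
    p) s). The Leibniz rule splits this into f(s), because the e_(p 1) e_(1 p) add up to 1, and
    [primitive f] times s. *)
Lemma innerP (f : dder C d) (s : S) :
  f s = outl s (primitive f) - outr s (primitive f).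
Proof.
have /asboolP[fL fM] := dderP f.
have outlM a b z : outl a (outl b z) = outl (a * b) z :> S \ox S.
  move: z; apply: tlin_ext.
  - exact: (lin_comp (outl_linear a) (outl_linear b)).
  - exact: outl_linear.
  by move=> x y; rewrite !outl_tens mulrA.
have outlr a b z : outr a (outl b z) = outl b (outr a z) :> S \ox S.
  move: z; apply: tlin_ext.
  - exact: (lin_comp (outr_linear a) (outl_linear b)).
  - exact: (lin_comp (outl_linear b) (outr_linear a)).
  by move=> x y; rewrite !outl_tens !outr_tens outl_tens.
have outl_linl (z : S \ox S) : linear (fun a : S => outl a z).
  have [r ->] := tens_sum z; move=> c x y; rewrite !(lin_sum (outl_linear _)).
  rewrite scaler_sumr -big_split; apply: eq_bigr => -[u v] _ /=.
  by rewrite !outl_tens (ss_mulr_linear u) tens_linl.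
apply/eqP; rewrite eq_sym subr_eq; apply/eqP; rewrite /primitive.
(* Centrality: s passes from the left tensor factor to the right one. *)
transitivity (\sum_(i < k) \sum_(p < d i) outl (eR C d i p.+1) (f (eL C d i p.+1 * s))).
  rewrite (lin_sum (outl_linear s)); apply: eq_bigr => i _.
  rewrite (lin_sum (outl_linear s)).
  transitivity (\sum_(p < d i) \sum_(r < d i) s i r p *: outl (eR C d i r.+1) (f (eL C d i p.+1))).
    apply: eq_bigr => p _; rewrite outlM seR (lin_sum (outl_linl _)).
    by apply: eq_bigr => r _; rewrite (lin_scale (outl_linl _)).
  rewrite exchange_big; apply: eq_bigr => p _ /=; rewrite eLs.
  rewrite (lin_sum fL) (lin_sum (outl_linear _)); apply: eq_bigr => r _.
  by rewrite (lin_scale fL) (lin_scale (outl_linear _)).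
rewrite (lin_sum (outr_linear s)).
have -> : f s = \sum_(i < k) \sum_(p < d i) outl (eR C d i p.+1 * eL C d i p.+1) (f s).
  under eq_bigr do rewrite -(lin_sum (outl_linl _)).
  rewrite -(lin_sum (outl_linl _)) sum_eRL; move: (f s); apply: tlin_ext => //.
    exact: outl_linear.
  by move=> x y; rewrite outl_tens mul1r.
rewrite -big_split; apply: eq_bigr => i _ /=.
rewrite (lin_sum (outr_linear s)) -big_split; apply: eq_bigr => p _ /=.
by rewrite fM (lin_add (outl_linear _)) outlM outlr addrC.
Qed.
End Inner.

Section Words.
Variables (C : fieldType) (k : nat) (d : 'I_k -> nat).
Local Notation S := (ssalg C d).
Local Notation D := (DD C d).

Definition gE : D := iD (@gauge C k d).

Lemma sandwich_bilin : bilin (fun x y : S => iS y * gE * iS x).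
Proof.
split=> [y|x].
  exact: (lin_comp (dd_mull_linear _) (@iS_linear C k d)).
exact: (lin_comp (dd_mulr_linear _) (lin_comp (dd_mulr_linear _) (@iS_linear C k d))).
Qed.

Lemma dder_sumE I (r : seq I) (P : pred I) (F : I -> dder C d) (u : S) :
  (\sum_(j <- r | P j) F j) u = \sum_(j <- r | P j) F j u.
Proof. by apply: (big_morph (fun f : dder C d => f u)). Qed.

Lemma dderP_ext (f g : dder C d) : (forall u : S, f u = g u) -> f = g.
Proof. by move=> fg; apply: val_inj; apply/funext. Qed.

Lemma gauge_sandwich (x y u : S) :
  dderl y (dderr (gauge C d) x) u = tens (u * x) y - tens x (y * u).
Proof.
rewrite /= /gauge_fun (lin_sub (innr_linear x)) (lin_sub (innl_linear y)).
by rewrite !innr_tens !innl_tens mul1r mulr1.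
Qed.

(** The bimodule structure is the inner one: y E x sends u to u x (x) y - x (x) y u. Hence x (x) y
    in the primitive becomes the word y E x, with the factors in reverse order. *)
Lemma iD_inner (f : dder C d) :
  iD f = tlift (fun x y : S => iS y * gE * iS x) (primitive f).
Proof.
have [r rE] := tens_sum (primitive f).
have {1}-> : f = \sum_(p <- r) dderl p.2 (dderr (gauge C d) p.1).
  apply: dderP_ext => u; rewrite innerP rE (lin_sum (outl_linear u)).
  rewrite (lin_sum (outr_linear u)) -sumrB dder_sumE; apply: eq_bigr => p _.
  by rewrite gauge_sandwich outl_tens outr_tens.
rewrite rE (lin_sum (@iD_linear C k d)) (lin_sum (tlift_linear sandwich_bilin)).
by apply: eq_bigr => p _; rewrite tlift_tens ?iD_l ?iD_r ?mulrA //; exact: sandwich_bilin.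
Qed.

(** Evaluated at u, this is the difference between multiplying the i-th part of the separability
    idempotent by u on the left and on the right; it vanishes by centrality. The relation makes one
    loop at each vertex redundant. *)
Lemma gauge_rel i : \sum_(p < d i) iS (eL C d i p.+1) * gE * iS (eR C d i p.+1) = 0.
Proof.
transitivity (iD (\sum_(p < d i) dderl (eL C d i p.+1) (dderr (gauge C d) (eR C d i p.+1)))).
  rewrite (lin_sum (@iD_linear C k d)); apply: eq_bigr => p _.
  by rewrite iD_l iD_r mulrA.
rewrite (_ : (\sum_(p < d i) _) = 0) ?(lin_0 (@iD_linear C k d)) //.
apply: dderP_ext => u; rewrite dder_sumE.
rewrite (eq_bigr (fun p : 'I_(d i) =>
  \sum_(r < d i) (u i r p *: tens (eR C d i r.+1) (eL C d i p.+1)) -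
  \sum_(r < d i) (u i p r *: tens (eR C d i p.+1) (eL C d i r.+1)))).
  by rewrite sumrB; apply/eqP; rewrite subr_eq0; apply/eqP; exact: exchange_big.
move=> p _; rewrite gauge_sandwich seR eLs (lin_sum (tens_linl _)) (lin_sum (tens_linr _)).
by congr (_ - _); apply: eq_bigr => r _; rewrite ?(lin_scale (tens_linl _)) ?(lin_scale (tens_linr _)).
Qed.

Definition letter : Type := option S.
Definition lval (l : letter) : D := if l is Some s then iS s else gE.
Definition wval (w : seq letter) : D := \prod_(l <- w) lval l.
Definition wdeg (w : seq letter) : nat := count (fun l : letter => ~~ isSome l) w.

Lemma wval_nil : wval [::] = 1. Proof. exact: big_nil. Qed.
Lemma wval_cons l w : wval (l :: w) = lval l * wval w. Proof. exact: big_cons. Qed.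
Lemma wval_cat u v : wval (u ++ v) = wval u * wval v. Proof. exact: big_cat. Qed.
Lemma wdeg_cat u v : wdeg (u ++ v) = (wdeg u + wdeg v)%N. Proof. exact: count_cat. Qed.

Definition wspan (n : nat) : D -> Prop :=
  span (fun x => exists2 w, wdeg w = n & x = wval w).

Lemma wspan_word w : wspan (wdeg w) (wval w).
Proof. by apply: spanG; exists w. Qed.

Lemma wspanM m n x y : wspan m x -> wspan n y -> wspan (m + n) (x * y).
Proof.
move=> hx hy; move: x hx; apply: span_map; first exact: dd_mulr_linear.
move=> _ [u <- ->]; move: y hy; apply: span_map; first exact: dd_mull_linear.
by move=> _ [v <- ->]; apply: spanG; exists (u ++ v); rewrite ?wdeg_cat ?wval_cat.
Qed.

Lemma wspan_iS (s : S) : wspan 0 (iS s).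
Proof. by apply: spanG; exists [:: Some s]; rewrite // wval_cons wval_nil mulr1. Qed.
Lemma wspan_1 : wspan 0 1.
Proof. by rewrite -wval_nil; exact: (wspan_word [::]). Qed.
Lemma wspan_gE : wspan 1 gE.
Proof. by apply: spanG; exists [:: None]; rewrite // wval_cons wval_nil mulr1. Qed.
Lemma wspan_iD f : wspan 1 (iD f).
Proof.
rewrite iD_inner; have [r ->] := tens_sum (primitive f).
rewrite (lin_sum (tlift_linear sandwich_bilin)); apply: span_sum => p _.
rewrite tlift_tens; last exact: sandwich_bilin.
exact: (wspanM (wspanM (wspan_iS p.2) wspan_gE) (wspan_iS p.1)).
Qed.

(** By [iD_inner] a double derivation is a sum of words with exactly one E; conversely E is itself a
    double derivation. *)
Lemma homog_wspan n (x : D) : dd_homog n x <-> wspan n x.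
Proof.
split; apply: span_map => // _ [w <- ->].
  elim: w => [|l w IH]; first by rewrite big_nil; exact: wspan_1.
  rewrite big_cons /=; apply: wspanM => //.
  by case: l => [s|f] /=; [exact: wspan_iS | exact: wspan_iD].
apply: spanG.
exists [seq (if l is Some s then inl s else inr (gauge C d)) : dsletter C d | l <- w].
  by rewrite count_map; apply: eq_count; case.
by rewrite big_map; apply: eq_bigr; case.
Qed.

Lemma homogM m n (x y : D) : dd_homog m x -> dd_homog n y -> dd_homog (m + n) (x * y).
Proof. by move=> /homog_wspan hx /homog_wspan hy; apply/homog_wspan; exact: wspanM. Qed.
Lemma homog_word w : dd_homog (wdeg w) (wval w).
Proof. exact/homog_wspan/wspan_word. Qed.
Lemma homog_iS (s : S) : dd_homog 0 (iS s). Proof. exact/homog_wspan/wspan_iS. Qed.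
Lemma homog_gE : dd_homog 1 gE. Proof. exact/homog_wspan/wspan_gE. Qed.
Lemma homog_1 : dd_homog 0 (1 : D). Proof. exact/homog_wspan/wspan_1. Qed.

Lemma homog_span (x : D) : span (fun y => exists n, dd_homog n y) x.
Proof.
apply: span_map (dd_words x) => // _ [w ->]; apply: spanG.
by exists (count (@is_der C k d) w); apply: spanG; exists w.
Qed.

Lemma homog_word_ext (U : lmodType C) n (f g : D -> U) :
  linear f -> linear g -> (forall w, wdeg w = n -> f (wval w) = g (wval w)) ->
  forall x, dd_homog n x -> f x = g x.
Proof.
move=> fL gL fg x /homog_wspan; apply: span_lin_ext => // _ [w wn ->].
exact: fg.
Qed.

Lemma homog_ext (U : lmodType C) (f g : D -> U) :
  linear f -> linear g -> (forall n x, dd_homog n x -> f x = g x) -> f =1 g.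
Proof.
move=> fL gL fg x; apply: (span_lin_ext fL gL _ (homog_span x)).
by move=> y [n /fg].
Qed.

Lemma word_ext (U : lmodType C) (f g : D -> U) :
  linear f -> linear g -> (forall w, f (wval w) = g (wval w)) -> f =1 g.
Proof.
by move=> fL gL fg; apply: homog_ext => // n; apply: homog_word_ext => // w _; exact: fg.
Qed.

End Words.

Section TensorHelpers.
Variables (C : fieldType).

Lemma tlift_linear_param (Z V W U : lmodType C) (b : Z -> V -> W -> U) :
  (forall z, bilin (b z)) -> (forall v w, linear (fun z => b z v w)) ->
  forall x, linear (fun z => tlift (b z) x).
Proof.
move=> bB bL x c z z'; have [r ->] := tens_sum x.
rewrite !(lin_sum (tlift_linear (bB _))) scaler_sumr -big_split /=.
by apply: eq_bigr => p _; rewrite !tlift_tens ?bL.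
Qed.

Lemma tens_scalel (V W : lmodType C) (c : C) (v : V) (w : W) :
  tens (c *: v) w = c *: tens v w.
Proof. exact: (lin_scale (tens_linl w)). Qed.
Lemma tens_subl (V W : lmodType C) (v v' : V) (w : W) :
  tens (v - v') w = tens v w - tens v' w.
Proof. exact: (lin_sub (tens_linl w)). Qed.
Lemma tens_suml (V W : lmodType C) I (r : seq I) (P : pred I) (F : I -> V) (w : W) :
  tens (\sum_(i <- r | P i) F i) w = \sum_(i <- r | P i) tens (F i) w.
Proof. exact: (lin_sum (tens_linl w)). Qed.
Lemma tens_0l (V W : lmodType C) (w : W) : tens (0 : V) w = 0.
Proof. exact: (lin_0 (tens_linl w)). Qed.
Lemma tens_0r (V W : lmodType C) (v : V) : tens v (0 : W) = 0.
Proof. exact: (lin_0 (tens_linr v)). Qed.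

End TensorHelpers.

(** * The double Schouten bracket on words *)

Section GaugeBracket.
Variables (C : fieldType) (k : nat) (d : 'I_k -> nat).
Local Notation S := (ssalg C d).
Local Notation D := (DD C d).
Local Notation Der := (dder C d).
Local Notation G := (gauge C d).
Local Notation S3 := (S \ox S \ox S)%type.

Lemma tau23_tens (x y z : S) : tau23 (tens (tens x y) z) = tens (tens x z) y.
Proof.
have b1 (z' : S) : bilin (fun x y : S => tens (tens x z') y).
  by split=> [w|v] c a a'; rewrite ?tens_linl ?tens_linr.
rewrite /tau23 tlift_tens ?tlift_tens //.
split=> [w|v]; first exact: tlift_linear.
by apply: tlift_linear_param => // v1 w1 c a a'; rewrite tens_linr tens_linl.
Qed.
Lemma tau23_linear : linear (@tau23 C k d).
Proof.
have b1 (z' : S) : bilin (fun x y : S => tens (tens x z') y).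
  by split=> [w|v] c a a'; rewrite ?tens_linl ?tens_linr.
apply: tlift_linear; split=> [w|v]; first exact: tlift_linear.
by apply: tlift_linear_param => // v1 w1 c a a'; rewrite tens_linr tens_linl.
Qed.
Lemma tau12_bilin :
  bilin (fun (xy : S \ox S) (z : S) => tlift (fun x y : S => tens (tens y x) z) xy).
Proof.
have b1 (z' : S) : bilin (fun x y : S => tens (tens y x) z').
  by split=> [w|v] c a a'; rewrite ?(tens_linr w) ?tens_linl.
split=> [w|v]; first exact: tlift_linear.
by apply: tlift_linear_param => // v1 w1; exact: tens_linr.
Qed.
Lemma tau12_tens (x y z : S) : tau12 (tens (tens x y) z) = tens (tens y x) z.
Proof.
rewrite /tau12 tlift_tens ?tlift_tens //; last exact: tau12_bilin.
by split=> [w|v] c a a'; rewrite ?(tens_linr w) ?(tens_linr v) ?tens_linl.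
Qed.
Lemma tau12_linear : linear (@tau12 C k d).
Proof. exact: (tlift_linear tau12_bilin). Qed.

Lemma assoc_bilin (x : S) : bilin (fun y' y'' : S => tens (tens x y') y'').
Proof. by split=> [w|v] c a a'; rewrite ?tens_linr ?tens_linl. Qed.

Section Fixed.
Variable f : S -> S \ox S.
Hypothesis fL : linear f.
Lemma tens_l_bilin : bilin (fun x y : S => tens (f x) y).
Proof. by split=> [w|v] c a a'; rewrite ?fL ?tens_linr ?tens_linl. Qed.
Lemma tens_r_bilin : bilin (fun x y : S =>
  tlift (fun y' y'' : S => tens (tens x y') y'') (f y)).
Proof.
split=> [w|v]; last exact: (lin_comp (tlift_linear (assoc_bilin v)) fL).
apply: tlift_linear_param => [z|v w' c a a']; first exact: assoc_bilin.
by rewrite !tens_linl.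
Qed.
Lemma tens_l_linear : linear (tens_l f).
Proof. exact: (tlift_linear tens_l_bilin). Qed.
Lemma tens_r_linear : linear (tens_r f).
Proof. exact: (tlift_linear tens_r_bilin). Qed.
Lemma tens_l_tens x y : tens_l f (tens x y) = tens (f x) y.
Proof. exact: (tlift_tens tens_l_bilin). Qed.
Lemma tens_r_tens x y : tens_r f (tens x y) =
  tlift (fun y' y'' : S => tens (tens x y') y'') (f y).
Proof. exact: (tlift_tens tens_r_bilin). Qed.
End Fixed.

Lemma gauge_linear : linear (G : S -> S \ox S).
Proof. by have /asboolP[] := dderP G. Qed.
Lemma gaugeE (s : S) : G s = tens s (1 : S) - tens (1 : S) s. Proof. by []. Qed.
Lemma gauge1 : G 1 = 0. Proof. by rewrite gaugeE subrr. Qed.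

Lemma gauge_assoc (x s : S) :
  tlift (fun y' y'' : S => tens (tens x y') y'') (G s)
  = tens (tens x s) (1 : S) - tens (tens x (1 : S)) s.
Proof.
rewrite gaugeE (lin_sub (tlift_linear (assoc_bilin x))).
by rewrite !tlift_tens //; exact: assoc_bilin.
Qed.

(** The two terms with s in the middle factor cancel, and E kills 1. *)
Lemma gauge_gauge (s : S) :
  tens_l G (G s) - tens_r G (G s)
  = tens (tens s (1 : S)) (1 : S) - tens (tens (1 : S) (1 : S)) s.
Proof.
rewrite gaugeE.
rewrite (lin_sub (tens_l_linear gauge_linear)) (lin_sub (tens_r_linear gauge_linear)).
rewrite !(tens_l_tens gauge_linear) !(tens_r_tens gauge_linear) gauge1 tens_0l subr0.
rewrite (lin_0 (tlift_linear (assoc_bilin s))) sub0r opprK.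
by rewrite gauge_assoc gaugeE tens_subl addrA subrK.
Qed.

Lemma eval_l_bilin (s : S) : bilin (fun (E : Der) (t : S) => tens (E s) t).
Proof. by split=> [w c a a'|v c a a']; rewrite ?(tens_linr _ c) // -(tens_linl w c). Qed.
Lemma eval_r_bilin (s : S) : bilin (fun (t : S) (E : Der) =>
  tlift (fun y' y'' : S => tens (tens t y') y'') (E s)).
Proof.
split=> [w|v]; last by move=> c a a'; rewrite -(tlift_linear (assoc_bilin v)).
apply: tlift_linear_param => [z|v w' c a a']; first exact: assoc_bilin.
by rewrite !tens_linl.
Qed.

Lemma eval_l_linear s : linear ((@eval_l C k d)^~ s).
Proof. exact: (tlift_linear (eval_l_bilin s)). Qed.
Lemma eval_r_linear s : linear ((@eval_r C k d)^~ s).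
Proof. exact: (tlift_linear (eval_r_bilin s)). Qed.
Lemma eval_l_tens (E : Der) (t s : S) : eval_l (tens E t) s = tens (E s) t.
Proof. exact: (tlift_tens (eval_l_bilin s)). Qed.
Lemma eval_r_tens (E : Der) (t s : S) : eval_r (tens t E) s =
  tlift (fun y' y'' : S => tens (tens t y') y'') (E s).
Proof. exact: (tlift_tens (eval_r_bilin s)). Qed.

Let sw := fun z : S \ox S => tlift (fun x y : S => iS y * gE C d * iS x) z.
Let swL : linear sw. Proof. exact: (tlift_linear (sandwich_bilin C d)). Qed.

(** The values at the units e_(1 p) yield the primitive of the derivation factor, and by [iD_inner]
    the primitive determines its image in [DD]. *)
Lemma eval_l_inj (L L' : Der \ox S) : (forall s, eval_l L s = eval_l L' s) ->
  tmap (@iD C k d) (@iS C k d) L = tmap (@iD C k d) (@iS C k d) L'.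
Proof.
pose op a : S3 -> S3 := tmap (outl a) (fun x : S => x).
have opL a : linear (op a) := tmap_linear (outl_linear a) (@lin_id _ _).
pose th : S3 -> D \ox D := tmap sw (@iS C k d).
have thL : linear th := tmap_linear swL (@iS_linear C k d).
have key (M : Der \ox S) : tmap (@iD C k d) (@iS C k d) M =
    th (\sum_(i < k) \sum_(p < d i) op (eR C d i p.+1) (eval_l M (eL C d i p.+1))).
  move: M; apply: tlin_ext.
  - exact: (tmap_linear (@iD_linear C k d) (@iS_linear C k d)).
  - apply: (lin_comp thL); apply: lin_sumf => i; apply: lin_sumf => p.
    apply: (lin_comp (opL _)); exact: eval_l_linear.
  move=> f t; rewrite (tmap_tens (@iD_linear C k d) (@iS_linear C k d)) iD_inner -/(sw _).
  rewrite -(tmap_tens swL (@iS_linear C k d)) -/th; congr (th _).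
  rewrite /primitive tens_suml; apply: eq_bigr => i _.
  rewrite tens_suml; apply: eq_bigr => p _.
  rewrite eval_l_tens.
  by rewrite /op (tmap_tens (outl_linear _) (@lin_id _ _)).
move=> LL'; rewrite !key; congr (th _).
by apply: eq_bigr => i _; apply: eq_bigr => p _; rewrite LL'.
Qed.

(** As for [eval_l_inj], with the factor in S placed first: [op] multiplies the middle tensor
    factor, and [th] turns the last two factors into a word in E. *)
Lemma eval_r_inj (L L' : S \ox Der) : (forall s, eval_r L s = eval_r L' s) ->
  tmap (@iS C k d) (@iD C k d) L = tmap (@iS C k d) (@iD C k d) L'.
Proof.
pose op1 a : S \ox S -> S \ox S := tmap (fun x : S => x) (fun x : S => (a * x : S)).
have op1L a : linear (op1 a) := tmap_linear (@lin_id _ _) (@ss_mull_linear _ _ _ a).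
pose op a : S3 -> S3 := tmap (op1 a) (fun x : S => x).
have opL a : linear (op a) := tmap_linear (op1L a) (@lin_id _ _).
have b1 (y : S) : bilin (fun t x : S => tens (iS t) (iS y * gE C d * iS x)).
  split=> [x|t].
    exact: (lin_comp (tens_linl _) (@iS_linear C k d)).
  exact: (lin_comp (tens_linr _) (proj1 (sandwich_bilin C d) y)).
have b2 : bilin (fun (tx : S \ox S) (y : S) =>
    tlift (fun t x : S => tens (iS t) (iS y * gE C d * iS x)) tx).
  split=> [y|tx]; first exact: (tlift_linear (b1 y)).
  apply: tlift_linear_param => // t x.
  exact: (lin_comp (tens_linr _) (proj2 (sandwich_bilin C d) x)).
pose th : S3 -> D \ox D := tlift (fun (tx : S \ox S) (y : S) =>
    tlift (fun t x : S => tens (iS t) (iS y * gE C d * iS x)) tx).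
have thL : linear th := tlift_linear b2.
have key (M : S \ox Der) : tmap (@iS C k d) (@iD C k d) M =
    th (\sum_(i < k) \sum_(p < d i) op (eR C d i p.+1) (eval_r M (eL C d i p.+1))).
  move: M; apply: tlin_ext.
  - exact: (tmap_linear (@iS_linear C k d) (@iD_linear C k d)).
  - apply: (lin_comp thL); apply: lin_sumf => i; apply: lin_sumf => p.
    apply: (lin_comp (opL _)); exact: eval_r_linear.
  move=> t f; rewrite (tmap_tens (@iS_linear C k d) (@iD_linear C k d)) iD_inner.
  pose as_ z := tlift (fun y' y'' : S => tens (tens t y') y'') z.
  have asL : linear as_ := tlift_linear (assoc_bilin t).
  have th_as z : th (as_ z) = tens (iS t) (sw z).
    move: z; apply: tlin_ext.
    - exact: (lin_comp thL asL).
    - exact: (lin_comp (tens_linr _) swL).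
    move=> x y; rewrite /as_ tlift_tens; last exact: assoc_bilin.
    rewrite /th tlift_tens // tlift_tens // /sw tlift_tens //; exact: sandwich_bilin.
  rewrite -/(sw _) -th_as; congr (th _).
  rewrite /primitive (lin_sum asL); apply: eq_bigr => i _.
  rewrite (lin_sum asL); apply: eq_bigr => p _.
  rewrite eval_r_tens.
  rewrite -/(as_ _); move: (f _); apply: tlin_ext.
  - exact: (lin_comp asL (outl_linear _)).
  - exact: (lin_comp (opL _) asL).
  move=> x y; rewrite outl_tens /as_ !tlift_tens; try exact: assoc_bilin.
  rewrite /op (tmap_tens (op1L _) (@lin_id _ _)).
  by rewrite /op1 (tmap_tens (@lin_id _ _) (ss_mull_linear _)).
move=> LL'; rewrite !key; congr (th _).
by apply: eq_bigr => i _; apply: eq_bigr => p _; rewrite LL'.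
Qed.

(** By [gauge_gauge], the halves L and R of the bracket have the same values as E (x) 1 and - 1 (x)
    E. *)
Lemma double_schouten_gauge (br : D -> D -> D \ox D) : double_schouten br ->
  br (gE C d) (gE C d) = tens (gE C d) (1 : D) - tens (1 : D) (gE C d).
Proof.
case=> _ [_ _ /(_ G G)[L [R [LP RP brLR]]]] _ _; rewrite /gE brLR.
have iSL := @iS_linear C k d; have iDL := @iD_linear C k d.
have -> : tmap (@iD C k d) (@iS C k d) L = tmap (@iD C k d) (@iS C k d) (tens G (1 : S)).
  apply: eval_l_inj => s; rewrite LP gauge_gauge (lin_sub tau23_linear) !tau23_tens.
  rewrite eval_l_tens.
  by rewrite gaugeE tens_subl.
have -> : tmap (@iS C k d) (@iD C k d) R = tmap (@iS C k d) (@iD C k d) (- tens (1 : S) G).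
  apply: eval_r_inj => s; rewrite RP -opprB gauge_gauge (lin_opp tau12_linear).
  rewrite (lin_sub tau12_linear) !tau12_tens.
  rewrite (lin_opp (eval_r_linear s)) eval_r_tens.
  by rewrite gauge_assoc.
rewrite (lin_opp (tmap_linear iSL iDL)) (tmap_tens iDL iSL) (tmap_tens iSL iDL).
by rewrite iS1.
Qed.
End GaugeBracket.

Section DDTensors.
Variables (C : fieldType) (k : nat) (d : 'I_k -> nat).
Local Notation D := (DD C d).

Lemma dd_tmul_bilin : bilin (fun x y : D => (x * y : D)).
Proof. by split=> [y|x]; [exact: dd_mulr_linear | exact: dd_mull_linear]. Qed.
Lemma dd_tmul_linear : linear (@dd_tmul C k d).
Proof. exact: (tlift_linear dd_tmul_bilin). Qed.
Lemma dd_tmul_tens (x y : D) : dd_tmul (tens x y) = x * y.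
Proof. exact: (tlift_tens dd_tmul_bilin). Qed.

Lemma dd_outl_linear (b : D) : linear (dd_outl b).
Proof. exact: (tmap_linear (dd_mull_linear b) (@lin_id _ _)). Qed.
Lemma dd_outr_linear (b : D) : linear (dd_outr b).
Proof. exact: (tmap_linear (@lin_id _ _) (dd_mulr_linear b)). Qed.
Lemma dd_outl_tens (b x y : D) : dd_outl b (tens x y) = tens (b * x) y.
Proof. exact: (tmap_tens (dd_mull_linear b) (@lin_id _ _)). Qed.
Lemma dd_outr_tens (b x y : D) : dd_outr b (tens x y) = tens x (y * b).
Proof. exact: (tmap_tens (@lin_id _ _) (dd_mulr_linear b)). Qed.

Lemma dd_outl1 z : dd_outl (1 : D) z = z.
Proof.
move: z; apply: tlin_ext => // [|x y]; first exact: dd_outl_linear.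
by rewrite dd_outl_tens mul1r.
Qed.
Lemma dd_outr1 z : dd_outr (1 : D) z = z.
Proof.
move: z; apply: tlin_ext => // [|x y]; first exact: dd_outr_linear.
by rewrite dd_outr_tens mulr1.
Qed.

Lemma dd_tmul_outl (b : D) (z : D \ox D) : dd_tmul (dd_outl b z) = b * dd_tmul z.
Proof.
move: z; apply: tlin_ext.
- exact: (lin_comp dd_tmul_linear (dd_outl_linear b)).
- exact: (lin_comp (dd_mull_linear b) dd_tmul_linear).
by move=> x y; rewrite dd_outl_tens !dd_tmul_tens mulrA.
Qed.
Lemma dd_tmul_outr (b : D) (z : D \ox D) : dd_tmul (dd_outr b z) = dd_tmul z * b.
Proof.
move: z; apply: tlin_ext.
- exact: (lin_comp dd_tmul_linear (dd_outr_linear b)).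
- exact: (lin_comp (dd_mulr_linear b) dd_tmul_linear).
by move=> x y; rewrite dd_outr_tens !dd_tmul_tens mulrA.
Qed.

Definition homog2 (j : nat) : D \ox D -> Prop := span (fun z => exists m n x y,
  [/\ dd_homog m x, dd_homog n y, (m + n)%N = j & z = tens x y]).

(* homog and homog2 shifted: degree 0 stands for degree -1, which is null. *)
Definition homogS (j : nat) (x : D) : Prop := if j is i.+1 then dd_homog i x else x = 0.
Definition homog2S (j : nat) (z : D \ox D) : Prop :=
  if j is i.+1 then homog2 i z else z = 0.

Lemma homog2_tens m n (x y : D) : dd_homog m x -> dd_homog n y -> homog2 (m + n) (tens x y).
Proof. by move=> hx hy; apply: spanG; exists m, n, x, y. Qed.

Lemma homogS_lin j c x y : homogS j x -> homogS j y -> homogS j (c *: x + y).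
Proof. by case: j => [->->|j] /=; rewrite ?scaler0 ?addr0 //; exact: span_lin. Qed.
Lemma homog2S_lin j c x y : homog2S j x -> homog2S j y -> homog2S j (c *: x + y).
Proof. by case: j => [->->|j] /=; rewrite ?scaler0 ?addr0 //; exact: span_lin. Qed.
Lemma homogS_0 j : homogS j 0.
Proof. by case: j => //= j; exact: span0. Qed.
Lemma homog2S_0 j : homog2S j 0.
Proof. by case: j => //= j; exact: span0. Qed.
Lemma homog2S_D j x y : homog2S j x -> homog2S j y -> homog2S j (x + y).
Proof. by rewrite -{2}[x]scale1r; exact: homog2S_lin. Qed.
Lemma homog2S_Z j c x : homog2S j x -> homog2S j (c *: x).
Proof. by move=> h; rewrite -[_ *: _]addr0; apply: homog2S_lin => //; exact: homog2S_0. Qed.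

Lemma homog2S_outl j n (b : D) z : dd_homog n b -> homog2S j z -> homog2S (j + n) (dd_outl b z).
Proof.
move=> hb; case: j => [->|j]; first by rewrite (lin_0 (dd_outl_linear b)); exact: homog2S_0.
rewrite addSn /=; apply: span_map; first exact: dd_outl_linear.
move=> _ [p [q [x [y [hx hy <- ->]]]]]; rewrite dd_outl_tens addnC addnA.
by apply: homog2_tens => //; exact: homogM.
Qed.
Lemma homog2S_outr j n (b : D) z : dd_homog n b -> homog2S j z -> homog2S (j + n) (dd_outr b z).
Proof.
move=> hb; case: j => [->|j]; first by rewrite (lin_0 (dd_outr_linear b)); exact: homog2S_0.
rewrite addSn /=; apply: span_map; first exact: dd_outr_linear.
move=> _ [p [q [x [y [hx hy <- ->]]]]]; rewrite dd_outr_tens -addnA.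
by apply: homog2_tens => //; exact: homogM.
Qed.
Lemma homogS_tmul j z : homog2S j z -> homogS j (dd_tmul z).
Proof.
case: j => [->|j] /=; first exact: (lin_0 dd_tmul_linear).
apply: span_map; first exact: dd_tmul_linear.
by move=> _ [p [q [x [y [hx hy <- ->]]]]]; rewrite dd_tmul_tens; exact: homogM.
Qed.

End DDTensors.

(** * Words cut at a letter E *)

Section Cuts.
Variables (C : fieldType) (k : nat) (d : 'I_k -> nat).
Local Notation letter := (letter C d).

(** The pairs (x, y) with w = x E y, one for each letter E of w. Sums over them expand the Leibniz
    rule of a derivation that kills S, and also define cyclic derivatives. *)
Fixpoint cuts (w : seq letter) : seq (seq letter * seq letter) :=
  if w is l :: w' then
    let r := [seq (l :: p.1, p.2) | p <- cuts w'] in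
    if l is None then ([::], w') :: r else r
  else [::].

Lemma cuts_deg w p : p \in cuts w -> wdeg w = (wdeg p.1 + wdeg p.2).+1.
Proof.
elim: w p => //= l w IH p.
have h : p \in [seq (l :: p.1, p.2) | p <- cuts w] ->
    (~~ isSome l + wdeg w)%N = (wdeg p.1 + wdeg p.2).+1.
  by case/mapP=> q /IH -> ->; rewrite /= -addnA addnS.
by case: l h => [s|] h //; rewrite inE => /orP[/eqP->|/h].
Qed.

Lemma big_cuts_cons (U : nmodType) (F : seq letter -> seq letter -> U) l w :
  \sum_(p <- cuts (l :: w)) F p.1 p.2
  = (if l is None then F [::] w else 0) + \sum_(p <- cuts w) F (l :: p.1) p.2.
Proof. by case: l => [s|] /=; rewrite ?big_cons big_map ?add0r. Qed.

Lemma big_cuts_cat (U : nmodType) (F : seq letter -> seq letter -> U) u v :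
  \sum_(p <- cuts (u ++ v)) F p.1 p.2
  = \sum_(p <- cuts u) F p.1 (p.2 ++ v) + \sum_(p <- cuts v) F (u ++ p.1) p.2.
Proof.
elim: u F => [|l u IH] F; first by rewrite big_nil add0r.
by rewrite cat_cons big_cuts_cons (big_cuts_cons (fun x y => F x (y ++ v))) (IH (fun x y => F (l :: x) y)) addrA.
Qed.

(* Both sides sum over the ways of writing w as x None y None z. *)
Lemma big_cuts_cuts (U : nmodType)
    (F : seq letter -> seq letter -> seq letter -> U) w :
  \sum_(p <- cuts w) \sum_(q <- cuts p.2) F p.1 q.1 q.2
  = \sum_(p <- cuts w) \sum_(q <- cuts p.1) F q.1 q.2 p.2.
Proof.
elim: w F => [|l w IH] F; first by rewrite !big_nil.
rewrite (big_cuts_cons (fun x y => \sum_(q <- cuts y) F x q.1 q.2)).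
rewrite (big_cuts_cons (fun x y => \sum_(q <- cuts x) F q.1 q.2 y)) big_nil.
rewrite (IH (fun x => F (l :: x))).
under [X in _ = _ + X]eq_bigr => p _ do
  rewrite (big_cuts_cons (fun x y => F x y p.2)).
by rewrite big_split addrA; case: l => [s|] //=; rewrite ?big1_eq ?addr0 ?add0r.
Qed.
End Cuts.

Section DoubleBracket.
Variables (C : fieldType) (k : nat) (d : 'I_k -> nat).
Local Notation S := (ssalg C d).
Local Notation D := (DD C d).
Local Notation E := (gE C d).
Variables (br : D -> D -> D \ox D) (brP : double_schouten br).
Variables (sg : D \ox D -> D \ox D) (sgP : is_gswap sg).
Hypothesis brA : forall m n (a b : D), dd_homog m a -> dd_homog n b ->
  br a b = - ((-1) ^+ (m.+1 * n.+1) *: sg (br b a)).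

Let tmL : linear (@dd_tmul C k d). Proof. exact: dd_tmul_linear. Qed.
Let brB : bilin br. Proof. by case: brP. Qed.
Let brL a : linear (br a). Proof. exact: brB.2. Qed.
Let brR b : linear (br^~ b). Proof. exact: brB.1. Qed.
Let sgL : linear sg. Proof. by case: sgP. Qed.

Lemma brM m n (a b c : D) : dd_homog m a -> dd_homog n b ->
  br a (b * c) = (-1) ^+ (m.+1 * n) *: dd_outl b (br a c) + dd_outr c (br a b).
Proof. by case: brP => _ _ h _; exact: h. Qed.

Lemma sg_tens m n (x y : D) : dd_homog m x -> dd_homog n y ->
  sg (tens x y) = (-1) ^+ (m * n) *: tens y x.
Proof. by case: sgP => _; exact. Qed.

Lemma brSS (s t : S) : br (iS s) (iS t) = 0.
Proof. by case: brP => _ [] + _ _ _ _; exact. Qed.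
Lemma brES (s : S) : br E (iS s) = tens (iS s) (1 : D) - tens (1 : D) (iS s).
Proof.
have [_ [_ h _] _ _] := brP; rewrite /gE h gaugeE.
have iSL := @iS_linear C k d.
by rewrite (lin_sub (tmap_linear iSL iSL)) !(tmap_tens iSL iSL) iS1.
Qed.
Lemma brEE : br E E = tens E (1 : D) - tens (1 : D) E.
Proof. exact: double_schouten_gauge. Qed.

Lemma br1 m (a : D) : dd_homog m a -> br a 1 = 0.
Proof.
move=> ha; have := brM 1 ha (homog_1 C d); rewrite mulr1 muln0 scale1r.
rewrite dd_outl1 dd_outr1.
by move/eqP; rewrite -subr_eq subrr eq_sym => /eqP.
Qed.

(** Both sides are derivations in x for the outer structure, without signs because E has shifted
    degree 0, and they agree on generators. *)
Lemma br_gE (x : D) : br E x = tens x (1 : D) - tens (1 : D) x.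
Proof.
move: x; apply: word_ext; first exact: brL.
  exact: (lin_subf (tens_linl _) (tens_linr _)).
elim=> [|l w IH]; first by rewrite wval_nil (br1 (homog_gE C d)) subrr.
rewrite wval_cons; have [n hl] : exists n, dd_homog n (lval l).
  by case: l => [s|]; [exists 0%N; exact: homog_iS | exists 1%N; exact: homog_gE].
have brl : br E (lval l) = tens (lval l) (1 : D) - tens (1 : D) (lval l).
  by case: l {hl} => [s|]; [exact: brES | exact: brEE].
rewrite (brM _ (homog_gE C d) hl) IH brl mulSn mul1n addnn -muln2 exprM sqrr_sign scale1r.
rewrite (lin_sub (dd_outl_linear _)) (lin_sub (dd_outr_linear _)).
by rewrite !dd_outl_tens !dd_outr_tens mulr1 mul1r addrA subrK.
Qed.

Lemma brSE (t : S) : br (iS t) E = tens (iS t) (1 : D) - tens (1 : D) (iS t).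
Proof.
rewrite (brA (homog_iS t) (homog_gE C d)) br_gE (lin_sub sgL).
rewrite (sg_tens (homog_iS t) (homog_1 C d)) (sg_tens (homog_1 C d) (homog_iS t)).
by rewrite !muln0 !expr0 !scale1r mul1n sqrrN expr1n scale1r opprB.
Qed.

(** The contribution to {{t, x E y}} of the displayed E, which comes from {{t, E}} = t (x) 1 - 1 (x)
    t. *)
Definition sandwich (t : S) (x y : D) : D \ox D :=
  tens (x * iS t) y - tens x (iS t * y).

Lemma sandwich_outl t b x y : dd_outl b (sandwich t x y) = sandwich t (b * x) y.
Proof. by rewrite /sandwich (lin_sub (dd_outl_linear _)) !dd_outl_tens mulrA. Qed.
Lemma sandwich_outr t b x y : dd_outr b (sandwich t x y) = sandwich t x (y * b).
Proof. by rewrite /sandwich (lin_sub (dd_outr_linear _)) !dd_outr_tens mulrA. Qed.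

Lemma brS_word (t : S) w : br (iS t) (wval w) =
  \sum_(p <- cuts w) (-1) ^+ wdeg p.1 *: sandwich t (wval p.1) (wval p.2).
Proof.
elim: w => [|l w IH]; first by rewrite wval_nil (br1 (homog_iS t)) big_nil.
rewrite (big_cuts_cons (fun x y => (-1) ^+ wdeg x *: sandwich t (wval x) (wval y))).
have step n : dd_homog n (lval l) -> n = ~~ isSome l ->
    br (iS t) (wval (l :: w)) = dd_outr (wval w) (br (iS t) (lval l)) +
    \sum_(p <- cuts w) (-1) ^+ wdeg (l :: p.1) *: sandwich t (wval (l :: p.1)) (wval p.2).
  move=> hl nE; rewrite wval_cons (brM _ (homog_iS t) hl) addrC mul1n IH; congr (_ + _).
  rewrite (lin_sum (dd_outl_linear _)) scaler_sumr; apply: eq_bigr => p _.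
  rewrite (lin_scale (dd_outl_linear _)) scalerA -exprD sandwich_outl wval_cons.
  by rewrite /wdeg /= -nE.
case: l step => [s|] step.
  by rewrite (step 0%N) ?brSS ?(lin_0 (dd_outr_linear _)) //; exact: homog_iS.
rewrite (step 1%N) //; last exact: homog_gE.
rewrite brSE expr0 scale1r (lin_sub (dd_outr_linear _)) !dd_outr_tens.
by rewrite /sandwich wval_nil !mul1r.
Qed.

Lemma sg_homog2S j z : homog2S j z -> homog2S j (sg z).
Proof.
case: j => [->|j] /=; first exact: (lin_0 sgL).
apply: span_map => // _ [p [q [x [y [hx hy <- ->]]]]].
by rewrite (sg_tens hx hy); apply: spanZ; rewrite addnC; exact: homog2_tens.
Qed.

(** The double bracket has degree -1, and [homog2S] at m + n means degree m + n - 1. The explicit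
    values {{letter, word}} are turned around by antisymmetry, and the Leibniz rule then reaches
    pairs of words. *)
Lemma br_homog2S m n a b : dd_homog m a -> dd_homog n b -> homog2S (m + n) (br a b).
Proof.
have brEw n' x : dd_homog n' x -> homog2S n'.+1 (br E x).
  move=> hx /=; rewrite br_gE; apply: spanB.
    by rewrite -(addn0 n'); apply: homog2_tens => //; exact: homog_1.
  by rewrite -(add0n n'); apply: homog2_tens => //; exact: homog_1.
have brSw t w : homog2S (wdeg w) (br (iS t) (wval w)).
  rewrite brS_word big_seq; elim/big_ind: _ => [|x y|p /cuts_deg ->].
  - exact: homog2S_0.
  - exact: homog2S_D.
  rewrite /=; apply: spanZ; apply: spanB.
    apply: homog2_tens; last exact: homog_word.
    by rewrite -[wdeg p.1]addn0; apply: homogM; [exact: homog_word | exact: homog_iS].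
  apply: homog2_tens; first exact: homog_word.
  by rewrite -[wdeg p.2]add0n; apply: homogM; [exact: homog_iS | exact: homog_word].
have brw w : forall l, homog2S (wdeg w + ~~ isSome l) (br (wval w) (lval l)).
  move=> [s|] /=.
    rewrite (brA (homog_word w) (homog_iS s)) -scaleNr addn0.
    by apply: homog2S_Z; exact/sg_homog2S/brSw.
  rewrite (brA (homog_word w) (homog_gE C d)) -scaleNr addn1.
  by apply: homog2S_Z; apply/sg_homog2S/brEw/homog_word.
have ww u v : homog2S (wdeg u + wdeg v) (br (wval u) (wval v)).
  elim: v => [|l v IH]; first by rewrite wval_nil (br1 (homog_word u)); exact: homog2S_0.
  rewrite wval_cons.
  have hl : dd_homog (~~ isSome l) (lval l).
    by case: l => [s|]; [exact: homog_iS | exact: homog_gE].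
  rewrite (brM _ (homog_word u) hl); apply: homog2S_D.
    apply: homog2S_Z; rewrite /wdeg /= -/(wdeg v) addnCA addnC.
    exact: homog2S_outl.
  by rewrite /wdeg /= -/(wdeg v) addnA; apply: homog2S_outr; [exact: homog_word | exact: brw].
move=> /homog_wspan ha /homog_wspan hb; elim: ha => [|_ [u <- ->]|x y _ hx _ hy|c x _ hx].
- by rewrite (lin_0 (brR b)); exact: homog2S_0.
- elim: hb => [|_ [v <- ->]|x y _ hx _ hy|c x _ hx].
  + by rewrite (lin_0 (brL _)); exact: homog2S_0.
  + exact: ww.
  + by rewrite (lin_add (brL _)); exact: homog2S_D.
  + by rewrite (lin_scale (brL _)); exact: homog2S_Z.
- by rewrite (lin_add (brR b)); exact: homog2S_D.
- by rewrite (lin_scale (brR b)); exact: homog2S_Z.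
Qed.

Definition single_bracket (a b : D) : D := dd_tmul (br a b).

Local Notation lb := single_bracket.

Lemma lb_linl b : linear (lb^~ b). Proof. by move=> c x y; rewrite /single_bracket (brR b c x y) tmL. Qed.
Lemma lb_linr a : linear (lb a). Proof. by move=> c x y; rewrite /single_bracket (brL a c x y) tmL. Qed.

Lemma lb_homogS m n a b : dd_homog m a -> dd_homog n b -> homogS (m + n) (lb a b).
Proof. by move=> ha hb; exact/homogS_tmul/br_homog2S. Qed.

Lemma lbM m n (a b c : D) : dd_homog m a -> dd_homog n b ->
  lb a (b * c) = (-1) ^+ (m.+1 * n) *: (b * lb a c) + lb a b * c.
Proof.
move=> ha hb; rewrite /single_bracket (brM c ha hb) (lin_add tmL).
by rewrite (lin_scale tmL) dd_tmul_outl dd_tmul_outr.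
Qed.

Lemma br_E (x : D) : br x E = tens x (1 : D) - tens (1 : D) x.
Proof.
move: x; apply: homog_ext; first exact: brR.
  exact: (lin_subf (tens_linl _) (tens_linr _)).
move=> n x hx; rewrite (brA hx (homog_gE C d)) br_gE (lin_sub sgL).
rewrite (sg_tens hx (homog_1 C d)) (sg_tens (homog_1 C d) hx).
by rewrite muln0 mul0n !expr0 !scale1r mulnC exprM sqrrN expr1n expr1n scale1r opprB.
Qed.

Lemma lbE (x : D) : lb x E = 0.
Proof.
by rewrite /single_bracket br_E (lin_sub tmL) !dd_tmul_tens mulr1 mul1r subrr.
Qed.

Lemma lbS (t : S) x : lb (iS t) x = 0.
Proof.
move: x; apply: word_ext; [exact: lb_linr | exact: lin_cst0 |] => w.
rewrite /single_bracket brS_word (lin_sum tmL) big1 // => p _.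
rewrite (lin_scale tmL) (lin_sub tmL) !dd_tmul_tens.
by rewrite mulrA subrr scaler0.
Qed.

(* The cyclic derivative with respect to E, up to sign. *)
Definition cder (w : seq (letter C d)) : D :=
  \sum_(p <- cuts w) (-1) ^+ (wdeg p.1 * (wdeg w).+1) *: (wval p.2 * wval p.1).

(** By antisymmetry this is {{t, w}}, swapped and multiplied. A cut (x, y) contributes x t (x) y - x
    (x) t y, which becomes y x t - t y x up to sign. *)
Lemma lb_word_iS w (t : S) :
  lb (wval w) (iS t) = (-1) ^+ wdeg w *: (cder w * iS t - iS t * cder w).
Proof.
rewrite /single_bracket (brA (homog_word w) (homog_iS t)) brS_word (lin_opp tmL).
rewrite (lin_scale tmL) (lin_sum sgL) (lin_sum tmL).
rewrite -scaleNr muln1 exprS mulN1r opprK /cder mulr_suml mulr_sumr -sumrB.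
congr (_ *: _); rewrite !big_seq; apply: eq_bigr => p pw; have wp := cuts_deg pw.
have h0 : dd_homog (wdeg p.1) (wval p.1 * iS t).
  by rewrite -(addn0 (wdeg p.1)); apply: homogM; [exact: homog_word | exact: homog_iS].
have h1 : dd_homog (wdeg p.2) (iS t * wval p.2).
  by rewrite -(add0n (wdeg p.2)); apply: homogM; [exact: homog_iS | exact: homog_word].
rewrite (lin_scale sgL) (lin_sub sgL) (sg_tens h0 (homog_word _)) (sg_tens (homog_word _) h1).
rewrite -scalerBr scalerA -exprD (lin_scale tmL) (lin_sub tmL).
rewrite !dd_tmul_tens -dd_scaleAl -dd_scaleAr -scalerBr !mulrA; congr (_ *: _).
by apply: sgn_eq; rewrite wp !oddD !oddM /= !negbK oddD; case: (odd _); case: (odd _).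
Qed.

End DoubleBracket.

Lemma lin_oppD (C : fieldType) (V : lmodType C) (f : V -> V) (x y x' y' : V) :
  linear f -> f x' = - y -> f y' = - x -> x + y = - f (x' + y').
Proof. by move=> fL ex ey; rewrite (lin_add fL) ex ey opprD !opprK addrC. Qed.

Lemma scalerBB_AC (C : fieldType) (V : lmodType C) (l : C) (a b c e : V) :
  l *: a - l *: b - (l *: c - l *: e) = l *: (a - c - (b - e)).
Proof. by rewrite -!scalerBr !opprB addrACA [in RHS]addrACA [- b - c]addrC. Qed.

(** * The Jacobi identity *)

Section Parity.
Variables (C : fieldType) (k : nat) (d : 'I_k -> nat).
Local Notation D := (DD C d).
Local Notation X := (dsletter C d).

Let nder (w : seq X) := count (@is_der C k d) w.
Definition fpar (x : dsfree C d) : dsfree C d :=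
  mext (fun w : fword X => (-1) ^+ nder w *: fbase C (w : seq X)) x.

Lemma fpar_linear : linear fpar. Proof. exact: mext_linear. Qed.
Lemma fpar_base (w : seq X) : fpar (fbase C w) = (-1) ^+ nder w *: fbase C w.
Proof. exact: mextU. Qed.
Lemma fparM x y : fpar (x * y) = fpar x * fpar y.
Proof.
move: x; apply: falg_ext.
- exact: (lin_comp fpar_linear (falg_mulr_linear y)).
- exact: (lin_comp (falg_mulr_linear (fpar y)) fpar_linear).
move=> u; move: y; apply: falg_ext.
- exact: (lin_comp fpar_linear (falg_mull_linear (fbase C u))).
- exact: (lin_comp (falg_mull_linear (fpar (fbase C u))) fpar_linear).
move=> v; rewrite fbaseM !fpar_base /nder count_cat exprD -falg_scaleAl -falg_scaleAr.
by rewrite fbaseM scalerA.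
Qed.
Lemma fpar_fS s : fpar (fS s) = fS s.
Proof. by rewrite [LHS](fpar_base [:: inl s]) scale1r. Qed.
Lemma fpar_fD f : fpar (fD f) = - fD f.
Proof. by rewrite [LHS](fpar_base [:: inr f]) scaleN1r. Qed.

(** The defining relations are homogeneous: even if they involve [fS] only, odd if they involve
    [fD]. *)
Lemma fpar_ideal x : ds_ideal x -> dd_proj (fpar x) = 0 :> D.
Proof.
case=> a r b rr; rewrite !fparM; suff -> : dd_proj (fpar a * fpar r * fpar b) =
  dd_proj (fpar a) * dd_proj (fpar r) * dd_proj (fpar b).
  suff -> : dd_proj (fpar r) = 0 :> D by rewrite mulr0 mul0r.
  have r0 := ds_rel0 rr; have fL := fpar_linear.
  have fp1 : fpar 1 = 1 by rewrite -fbase0 fpar_base scale1r.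
  suff [->|->] : fpar r = r \/ fpar r = - r => //.
    by rewrite -[RHS]oppr0 -r0 (lin_opp (@dd_proj_linear C k d)).
  case: rr {r0} => [c s t||s t|c f g|s f|f t].
  - left; move: (fpar_fS (c *: s + t)) (fpar_fS s) (fpar_fS t).
    move: (fS (c *: s + t)) (fS s) (fS t) => x1 x2 x3 ex ey ez.
    by rewrite (lin_sub fL) (lin_add fL) (lin_scale fL) ex ey ez.
  - left; move: (fpar_fS 1); move: (fS 1) => x1 ex.
    by rewrite (lin_sub fL) ex fp1.
  - left; move: (fpar_fS (s * t)) (fpar_fS s) (fpar_fS t).
    move: (fS (s * t)) (fS s) (fS t) => x1 x2 x3 ex ey ez.
    by rewrite (lin_sub fL) fparM ex ey ez.
  - right; move: (fpar_fD (c *: f + g)) (fpar_fD f) (fpar_fD g).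
    move: (fD (c *: f + g)) (fD f) (fD g) => x1 x2 x3 ex ey ez.
    by rewrite (lin_sub fL) (lin_add fL) (lin_scale fL) ex ey ez scalerN -!opprD.
  - right; move: (fpar_fD (dderl s f)) (fpar_fS s) (fpar_fD f).
    move: (fD (dderl s f)) (fS s) (fD f) => x1 x2 x3 ex ey ez.
    by rewrite (lin_sub fL) fparM ex ey ez mulrN -opprD.
  - right; move: (fpar_fD (dderr f t)) (fpar_fS t) (fpar_fD f).
    move: (fD (dderr f t)) (fS t) (fD f) => x1 x2 x3 ex ey ez.
    by rewrite (lin_sub fL) fparM ex ey ez mulNr -opprD.
by rewrite !dd_mulP.
Qed.

(** The automorphism (-1)^n in degree n. It makes Leibniz signs linear in the argument, so that
    derivations extend to tensors of inhomogeneous elements. *)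
Definition par : D -> D := qlift (fun x => dd_proj (fpar x)).
Lemma par_linear : linear par.
Proof.
apply: qlift_linear fpar_ideal.
exact: (lin_comp (@dd_proj_linear C k d) fpar_linear).
Qed.
Lemma par_proj x : par (dd_proj x) = dd_proj (fpar x).
Proof.
apply: qliftE fpar_ideal x.
exact: (lin_comp (@dd_proj_linear C k d) fpar_linear).
Qed.
Lemma parM x y : par (x * y) = par x * par y.
Proof.
elim/dd_ind: x => x; elim/dd_ind: y => y.
by rewrite -dd_mulP !par_proj fparM dd_mulP.
Qed.
Lemma par_homog n x : dd_homog n x -> par x = (-1) ^+ n *: x.
Proof.
apply: span_lin_ext; [exact: par_linear | exact: (lin_scalef _ (@lin_id _ _)) |].
move=> _ [w <- ->]; rewrite -dd_proj_word par_proj fpar_base.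
exact: (lin_scale (@dd_proj_linear C k d)).
Qed.

(** The Koszul sign for moving an operator of degree m past x. *)
Definition twist (m : nat) (x : D) : D := if odd m then par x else x.
Lemma twist_linear m : linear (twist m).
Proof. by rewrite /twist; case: odd => //; exact: par_linear. Qed.
Lemma twistM m x y : twist m (x * y) = twist m x * twist m y.
Proof. by rewrite /twist; case: odd => //; exact: parM. Qed.
Lemma twist_homog m n x : dd_homog n x -> twist m x = (-1) ^+ (m * n) *: x.
Proof.
move=> hx; rewrite /twist -signr_odd oddM; case: (odd m) => /=; last by rewrite scale1r.
by rewrite signr_odd (par_homog hx).
Qed.
Lemma twist_1 m : twist m 1 = 1.
Proof. by rewrite (twist_homog m (homog_1 C d)) muln0 scale1r. Qed.
Lemma twist_iS m s : twist m (iS s) = iS s.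
Proof. by rewrite (twist_homog m (homog_iS s)) muln0 scale1r. Qed.
End Parity.

Section Jacobi.
Variables (C : fieldType) (k : nat) (d : 'I_k -> nat).
Local Notation S := (ssalg C d).
Local Notation D := (DD C d).
Local Notation E := (gE C d).
Variables (br : D -> D -> D \ox D) (brP : double_schouten br).
Variables (sg : D \ox D -> D \ox D) (sgP : is_gswap sg).
Hypothesis brA : forall m n (a b : D), dd_homog m a -> dd_homog n b ->
  br a b = - ((-1) ^+ (m.+1 * n.+1) *: sg (br b a)).
Local Notation lb := (single_bracket br).

Let tmL : linear (@dd_tmul C k d). Proof. exact: dd_tmul_linear. Qed.
Let brB : bilin br. Proof. by case: brP. Qed.
Let brL a : linear (br a). Proof. exact: brB.2. Qed.
Let brR b : linear (br^~ b). Proof. exact: brB.1. Qed.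
Let sgL : linear sg. Proof. by case: sgP. Qed.
Let lbL a : linear (lb a). Proof. exact: lb_linr. Qed.
Let lbR b : linear (lb^~ b). Proof. exact: lb_linl. Qed.

(** In this lemma and the next ones one argument has degree j - 1, as the values of the single
    bracket do. For j = 0 that argument is 0; in exponents j.+1 has the parity of j - 1. *)
Lemma br_AS j n a b : homogS j a -> dd_homog n b ->
  br a b = - ((-1) ^+ (j * n.+1) *: sg (br b a)).
Proof.
case: j => [->|j] /=; last exact: brA.
by rewrite (lin_0 (brR b)) (lin_0 (brL b)) (lin_0 sgL) scaler0 oppr0.
Qed.
Lemma br_SA j n a b : homogS j a -> dd_homog n b ->
  br b a = - ((-1) ^+ (n.+1 * j) *: sg (br a b)).
Proof.
case: j => [-> _|j ha hb]; last exact: brA.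
by rewrite (lin_0 (brR b)) (lin_0 (brL b)) (lin_0 sgL) scaler0 oppr0.
Qed.
Lemma br_MS j n a b c : homogS j a -> dd_homog n b ->
  br a (b * c) = (-1) ^+ (j * n) *: dd_outl b (br a c) + dd_outr c (br a b).
Proof.
case: j => [->|j] /=; last exact: brM.
rewrite !(lin_0 (brR _)) (lin_0 (dd_outl_linear b)) (lin_0 (dd_outr_linear c)).
by rewrite scaler0 addr0.
Qed.
Lemma br_SM m j a b c : dd_homog m a -> homogS j b ->
  br a (b * c) = (-1) ^+ (m.+1 * j.+1) *: dd_outl b (br a c) + dd_outr c (br a b).
Proof.
case: j => [ha ->|j ha hb].
  have o0 z : dd_outl (0 : D) z = 0.
    move: z; apply: tlin_ext; [exact: dd_outl_linear | exact: lin_cst0 |].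
    by move=> x y; rewrite dd_outl_tens mul0r tens_0l.
  by rewrite mul0r (lin_0 (brL a)) (lin_0 (dd_outr_linear c)) o0 scaler0 addr0.
have -> : (-1) ^+ (m.+1 * j.+2) = (-1) ^+ (m.+1 * j) :> C.
  by apply: sgn_eq; rewrite !oddM /= negbK.
exact: brM.
Qed.
Lemma sg_tensS j n x y : homogS j x -> dd_homog n y ->
  sg (tens x y) = (-1) ^+ (j.+1 * n) *: tens y x.
Proof.
case: j => [-> _|j hx hy]; first by rewrite tens_0l tens_0r (lin_0 sgL) scaler0.
rewrite (sg_tens sgP hx hy); apply: sgn_scale.
by rewrite !oddM /= negbK.
Qed.
Lemma sg_tensS' j n x y : homogS j x -> dd_homog n y ->
  sg (tens y x) = (-1) ^+ (j.+1 * n) *: tens x y.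
Proof.
case: j => [-> _|j hx hy]; first by rewrite tens_0l tens_0r (lin_0 sgL) scaler0.
rewrite (sg_tens sgP hy hx); apply: sgn_scale.
by rewrite !oddM /= negbK andbC.
Qed.

(** The contribution of an ordered pair of letters E of w to {{t, {w, s}}}: x and y are the two arcs
    left when both are removed from the cyclic word w. *)
Definition sandwich2 (t s : S) (x y : D) : D \ox D :=
  dd_outr (iS s) (sandwich t x y) - dd_outl (iS s) (sandwich t x y).

Lemma sg_tens4 m n (x1 x2 x3 x4 y1 y2 y3 y4 : D) :
  [/\ dd_homog m x1, dd_homog m x2, dd_homog m x3 & dd_homog m x4] ->
  [/\ dd_homog n y1, dd_homog n y2, dd_homog n y3 & dd_homog n y4] ->
  sg (tens x1 y1 - tens x2 y2 - (tens x3 y3 - tens x4 y4)) =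
  (-1) ^+ (m * n) *: (tens y1 x1 - tens y3 x3 - (tens y2 x2 - tens y4 x4)).
Proof.
case=> hx1 hx2 hx3 hx4 [hy1 hy2 hy3 hy4]; rewrite !(lin_sub sgL).
rewrite (sg_tens sgP hx1 hy1) (sg_tens sgP hx2 hy2).
rewrite (sg_tens sgP hx3 hy3) (sg_tens sgP hx4 hy4).
exact: scalerBB_AC.
Qed.

Lemma sg_sandwich2 t s m n (x y : D) : dd_homog m x -> dd_homog n y ->
  sg (sandwich2 s t x y) = (-1) ^+ (m * n) *: sandwich2 t s y x.
Proof.
move=> hx hy.
have rS u (z : D) p : dd_homog p z -> dd_homog p (z * iS u).
  by move=> hz; rewrite -(addn0 p); apply: homogM => //; exact: homog_iS.
have lS u (z : D) p : dd_homog p z -> dd_homog p (iS u * z).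
  by move=> hz; rewrite -(add0n p); apply: homogM => //; exact: homog_iS.
rewrite /sandwich2 !sandwich_outr !sandwich_outl /sandwich -!mulrA.
by apply: sg_tens4; split; do ?[exact: hx | exact: hy | apply: rS | apply: lS].
Qed.

(** By [lb_word_iS] the inner bracket is a commutator with s, and {{t, s}} = 0; hence s only
    multiplies {{t, cder w}} from outside. *)
Lemma br_cder (t s : S) w : br (iS t) (lb (wval w) (iS s)) = (-1) ^+ wdeg w *:
  \sum_(p <- cuts w) (-1) ^+ (wdeg p.1 * (wdeg w).+1) *:
    \sum_(q <- cuts (p.2 ++ p.1)) (-1) ^+ wdeg q.1 *: sandwich2 t s (wval q.1) (wval q.2).
Proof.
rewrite (lb_word_iS brP sgP brA) (lin_scale (brL _)); congr (_ *: _).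
rewrite /cder mulr_suml mulr_sumr -sumrB (lin_sum (brL _)); apply: eq_bigr => p _.
rewrite -dd_scaleAl -dd_scaleAr -scalerBr (lin_scale (brL _)) (lin_sub (brL _)).
congr (_ *: _); rewrite -wval_cat.
rewrite (brM brP _ (homog_iS t) (homog_word _)) (brSS brP) (lin_0 (dd_outl_linear _)).
rewrite scaler0 add0r (brM brP _ (homog_iS t) (homog_iS s)) (brSS brP).
rewrite (lin_0 (dd_outr_linear _)) addr0 scale1r (brS_word brP sgP brA).
rewrite (lin_sum (dd_outl_linear _)) (lin_sum (dd_outr_linear _)) -sumrB.
apply: eq_bigr => q _.
by rewrite (lin_scale (dd_outl_linear _)) (lin_scale (dd_outr_linear _)) -scalerBr.
Qed.

(* The second cyclic derivative of a word is invariant under the exchange of *)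
(* its two factors; this is what the Jacobi identity rests on.               *)
Lemma br_cder_sym (t s : S) w :
  br (iS t) (lb (wval w) (iS s)) = - sg (br (iS s) (lb (wval w) (iS t))).
Proof.
rewrite !br_cder (lin_scale sgL) -scalerN; congr (_ *: _).
(* For w = x E y E z, [F] is the term in which the first E is removed first, with arcs y and z x;
   [H] is the term in which the second E is removed first. *)
pose F (t s : S) (x y z : seq (letter C d)) :=
  (-1) ^+ (wdeg x * (wdeg x + wdeg y + wdeg z).+1 + wdeg y) *:
    sandwich2 t s (wval y) (wval (z ++ x)).
pose H (t s : S) (x y z : seq (letter C d)) :=
  (-1) ^+ ((wdeg x + wdeg y).+1 * (wdeg x + wdeg y + wdeg z).+1 + wdeg z + wdeg x) *:
    sandwich2 t s (wval (z ++ x)) (wval y).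
have sgH t' s' x y z : sg (H t' s' x y z) = - F s' t' x y z.
  rewrite /H /F (lin_scale sgL) (sg_sandwich2 _ _ (homog_word _) (homog_word _)).
  apply: sgn_scaleN.
  rewrite wdeg_cat !(oddD, oddM, oddS) /=.
  by case: (odd (wdeg x)); case: (odd (wdeg y)); case: (odd (wdeg z)).
have sgF t' s' x y z : sg (F t' s' x y z) = - H s' t' x y z.
  rewrite /H /F (lin_scale sgL) (sg_sandwich2 _ _ (homog_word _) (homog_word _)).
  apply: sgn_scaleN.
  rewrite wdeg_cat !(oddD, oddM, oddS) /=.
  by case: (odd (wdeg x)); case: (odd (wdeg y)); case: (odd (wdeg z)).
have split t' s' : \sum_(p <- cuts w) (-1) ^+ (wdeg p.1 * (wdeg w).+1) *:
    \sum_(q <- cuts (p.2 ++ p.1)) (-1) ^+ wdeg q.1 *: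
      sandwich2 t' s' (wval q.1) (wval q.2)
  = \sum_(p <- cuts w) \sum_(q <- cuts p.2) F t' s' p.1 q.1 q.2
  + \sum_(p <- cuts w) \sum_(q <- cuts p.1) H t' s' q.1 q.2 p.2.
  rewrite -big_split big_seq [RHS]big_seq; apply: eq_bigr => p pw /=.
  rewrite (big_cuts_cat (fun x y => (-1) ^+ wdeg x *: sandwich2 t' s' (wval x) (wval y))).
  have e1 : (-1) ^+ (wdeg p.1 * (wdeg w).+1) *: \sum_(q <- cuts p.2)
      (-1) ^+ wdeg q.1 *: sandwich2 t' s' (wval q.1) (wval (q.2 ++ p.1))
      = \sum_(q <- cuts p.2) F t' s' p.1 q.1 q.2.
    rewrite scaler_sumr [LHS]big_seq [RHS]big_seq; apply: eq_bigr => q pq.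
    rewrite scalerA -exprD; apply: sgn_scale.
    rewrite (cuts_deg pw) (cuts_deg pq) !(oddD, oddM, oddS) /=.
    by case: (odd (wdeg p.1)); case: (odd (wdeg q.1)); case: (odd (wdeg q.2)).
  have e2 : (-1) ^+ (wdeg p.1 * (wdeg w).+1) *: \sum_(q <- cuts p.1)
      (-1) ^+ wdeg (p.2 ++ q.1) *: sandwich2 t' s' (wval (p.2 ++ q.1)) (wval q.2)
      = \sum_(q <- cuts p.1) H t' s' q.1 q.2 p.2.
    rewrite scaler_sumr [LHS]big_seq [RHS]big_seq; apply: eq_bigr => q pq.
    rewrite scalerA -exprD; apply: sgn_scale.
    rewrite wdeg_cat (cuts_deg pw) (cuts_deg pq) !(oddD, oddM, oddS) /=.
    by case: (odd (wdeg p.2)); case: (odd (wdeg q.1)); case: (odd (wdeg q.2)).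
  by rewrite scalerDr; exact: (congr2 +%R e1 e2).
(* The swap exchanges the two families, whose double sums are matched by [big_cuts_cuts]. *)
have sgFs : sg (\sum_(p <- cuts w) \sum_(q <- cuts p.2) F s t p.1 q.1 q.2)
    = - \sum_(p <- cuts w) \sum_(q <- cuts p.1) H t s q.1 q.2 p.2.
  rewrite (lin_sum sgL) -(big_cuts_cuts (H t s)) -sumrN; apply: eq_bigr => p _.
  by rewrite (lin_sum sgL) -sumrN; apply: eq_bigr => q _; exact: sgF.
have sgHs : sg (\sum_(p <- cuts w) \sum_(q <- cuts p.1) H s t q.1 q.2 p.2)
    = - \sum_(p <- cuts w) \sum_(q <- cuts p.2) F t s p.1 q.1 q.2.
  rewrite (lin_sum sgL) (big_cuts_cuts (F t s)) -sumrN; apply: eq_bigr => p _.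
  by rewrite (lin_sum sgL) -sumrN; apply: eq_bigr => q _; exact: sgH.
apply: (etrans (split t s)); apply: (etrans _ (congr1 (fun z => - sg z) (esym (split s t)))).
exact: (lin_oppD sgL sgFs sgHs).
Qed.
End Jacobi.

Lemma sgn_mulK (C : fieldType) n : (-1) ^+ n * (-1) ^+ n = 1 :> C.
Proof. by rewrite -expr2 sqrr_sign. Qed.

Lemma sgn_swap (C : fieldType) (V : lmodType C) (u v : V) a b b' c f :
  odd a = odd (c + f) -> odd (b + b') = odd c ->
  (-1) ^+ a *: v + (-1) ^+ b *: ((-1) ^+ b' *: u) = (-1) ^+ c *: (u + (-1) ^+ f *: v).
Proof.
move=> h1 h2; rewrite scalerDr !scalerA -!exprD addrC.
by rewrite (sgn_scale v h1) (sgn_scale u h2).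
Qed.

Section AbstractSums.
Variables (C : fieldType) (V : lmodType C) (e : C).
Hypothesis ee : e * e = 1.
Implicit Types P Q R T U : V.

(** The signs in the inductive steps of [lb2_br_word], with e in place of (-1)^m: this identity
    serves a letter in S, the next one the letter E. *)
Lemma sum_stepS P Q R T :
  P + (Q + (- e) *: R) = Q + e *: T + (- e) *: (R + ((- e) *: P + T)).
Proof.
rewrite !scalerDr !scalerA mulrNN ee scale1r !scaleNr.
by rewrite [RHS]addrACA [e *: T + _]addrCA subrr addr0 addrC.
Qed.

Lemma sum_stepE P Q R U :
  - ((- e) *: (P + (- e) *: Q)) + R + U
  = e *: P + R + (- e) *: ((- e) *: (- Q + U)).
Proof.
rewrite !scalerDr !scalerA mulrNN ee !scale1r !scaleNr opprD opprK.
by rewrite -!addrA; congr (_ + _); rewrite addrCA.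
Qed.
End AbstractSums.

Section Jacobi.
Variables (C : fieldType) (k : nat) (d : 'I_k -> nat).
Local Notation S := (ssalg C d).
Local Notation D := (DD C d).
Local Notation E := (gE C d).
Variables (br : D -> D -> D \ox D) (brP : double_schouten br).
Variables (sg : D \ox D -> D \ox D) (sgP : is_gswap sg).
Hypothesis brA : forall m n (a b : D), dd_homog m a -> dd_homog n b ->
  br a b = - ((-1) ^+ (m.+1 * n.+1) *: sg (br b a)).
Local Notation lb := (single_bracket br).

Let tmL : linear (@dd_tmul C k d). Proof. exact: dd_tmul_linear. Qed.
Let brB : bilin br. Proof. by case: brP. Qed.
Let brL a : linear (br a). Proof. exact: brB.2. Qed.
Let brR b : linear (br^~ b). Proof. exact: brB.1. Qed.
Let sgL : linear sg. Proof. by case: sgP. Qed.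
Let lbL a : linear (lb a). Proof. exact: lb_linr. Qed.
Let lbR b : linear (lb^~ b). Proof. exact: lb_linl. Qed.

Lemma br_sym (t s : S) a :
  br (iS t) (lb a (iS s)) = - sg (br (iS s) (lb a (iS t))).
Proof.
move: a; apply: word_ext.
- exact: (lin_comp (brL _) (lbR _)).
- exact: (lin_oppf (lin_comp sgL (lin_comp (brL _) (lbR _)))).
exact: br_cder_sym.
Qed.

Lemma lb_iS_homogS m a t : dd_homog m a -> homogS m (lb a (iS t)).
Proof. by move=> ha; rewrite -(addn0 m); apply: (lb_homogS brP sgP brA) => //; exact: homog_iS. Qed.

(** The symmetry of the second cyclic derivative lets {a, -} pass from one argument to the other. *)
Lemma br_lb_iS m a t s : dd_homog m a ->
  br (lb a (iS t)) (iS s) = (-1) ^+ m *: br (iS t) (lb a (iS s)).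
Proof.
move=> ha; rewrite br_sym (br_AS brP sgP brA (lb_iS_homogS t ha) (homog_iS s)).
by rewrite muln1 scalerN.
Qed.

Lemma br_1 x : br x 1 = 0.
Proof.
move: x; apply: homog_ext; [exact: brR | exact: lin_cst0 |].
by move=> n x; exact: br1.
Qed.
Lemma lb_1 x : lb x 1 = 0.
Proof. by rewrite /single_bracket br_1 (lin_0 tmL). Qed.

Lemma lbMt m (a b c : D) : dd_homog m a ->
  lb a (b * c) = twist m.+1 b * lb a c + lb a b * c.
Proof.
move=> ha; move: b; apply: homog_ext.
- exact: (lin_comp (lbL a) (dd_mulr_linear c)).
- apply: lin_addf; first exact: (lin_comp (dd_mulr_linear _) (twist_linear _)).
  exact: (lin_comp (dd_mulr_linear c) (lbL a)).
by move=> n b hb; rewrite (twist_homog _ hb) -dd_scaleAl; exact: lbM.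
Qed.

Lemma lb_MS j n a b c : homogS j a -> dd_homog n b ->
  lb a (b * c) = (-1) ^+ (j * n) *: (b * lb a c) + lb a b * c.
Proof.
move=> ha hb; rewrite /single_bracket (br_MS brP _ ha hb) (lin_add tmL) (lin_scale tmL).
by rewrite dd_tmul_outl dd_tmul_outr.
Qed.

Lemma lb_SM m j a b c : dd_homog m a -> homogS j b ->
  lb a (b * c) = (-1) ^+ (m.+1 * j.+1) *: (b * lb a c) + lb a b * c.
Proof.
move=> ha hb; rewrite /single_bracket (br_SM brP _ ha hb) (lin_add tmL) (lin_scale tmL).
by rewrite dd_tmul_outl dd_tmul_outr.
Qed.

(* The extension of lb a to D (x) D as a derivation of degree m - 1, where m *)
(* is the degree of a.                                                       *)
Definition lb2 (m : nat) (a : D) : D \ox D -> D \ox D :=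
  tlift (fun x y : D => tens (lb a x) y + tens (twist m.+1 x) (lb a y)).

Lemma lb2_bilin m a :
  bilin (fun x y : D => tens (lb a x) y + tens (twist m.+1 x) (lb a y)).
Proof.
split=> [y|x]; apply: lin_addf.
- exact: (lin_comp (tens_linl y) (lbL a)).
- exact: (lin_comp (tens_linl (lb a y)) (twist_linear m.+1)).
- exact: tens_linr.
- exact: (lin_comp (tens_linr _) (lbL a)).
Qed.
Lemma lb2_linear m a : linear (lb2 m a).
Proof. exact: (tlift_linear (lb2_bilin m a)). Qed.
Lemma lb2_tens m a x y :
  lb2 m a (tens x y) = tens (lb a x) y + tens (twist m.+1 x) (lb a y).
Proof. exact: (tlift_tens (lb2_bilin m a)). Qed.

Lemma lb2_outl m a b z : dd_homog m a ->
  lb2 m a (dd_outl b z) = dd_outl (lb a b) z + dd_outl (twist m.+1 b) (lb2 m a z).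
Proof.
move=> ha; move: z; apply: tlin_ext.
- exact: (lin_comp (lb2_linear m a) (dd_outl_linear b)).
- apply: lin_addf; first exact: dd_outl_linear.
  exact: (lin_comp (dd_outl_linear _) (lb2_linear m a)).
move=> x y; rewrite !dd_outl_tens !lb2_tens (lin_add (dd_outl_linear _)) !dd_outl_tens.
by rewrite (lbMt _ _ ha) twistM (lin_add (tens_linl y)) [RHS]addrCA addrA.
Qed.

Lemma lb2_outr m a b z : dd_homog m a ->
  lb2 m a (dd_outr b z) = dd_outr b (lb2 m a z)
    + dd_outr (lb a b) (tmap (twist m.+1) (twist m.+1) z).
Proof.
move=> ha; have tL := @twist_linear C k d m.+1; move: z; apply: tlin_ext.
- exact: (lin_comp (lb2_linear m a) (dd_outr_linear b)).
- apply: lin_addf; first exact: (lin_comp (dd_outr_linear _) (lb2_linear m a)).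
  exact: (lin_comp (dd_outr_linear _) (tmap_linear tL tL)).
move=> x y; rewrite (tmap_tens tL tL) !dd_outr_tens !lb2_tens (lin_add (dd_outr_linear _)).
rewrite !dd_outr_tens (lbMt _ _ ha) (lin_add (tens_linr (twist m.+1 x))).
by rewrite -addrA; congr (_ + _); rewrite addrC.
Qed.

Lemma lb2_tmul m a z : dd_homog m a -> lb a (dd_tmul z) = dd_tmul (lb2 m a z).
Proof.
move=> ha; move: z; apply: tlin_ext.
- exact: (lin_comp (lbL a) tmL).
- exact: (lin_comp tmL (lb2_linear m a)).
move=> x y; rewrite lb2_tens (lin_add tmL) !dd_tmul_tens (lbMt _ _ ha).
by rewrite addrC.
Qed.

(** The Koszul signs of the swap and of the extended derivation are compatible. *)
Lemma sg_lb2 m a z : dd_homog m a -> sg (lb2 m a z) = lb2 m a (sg z).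
Proof.
move=> ha; move: z; apply: tlin_ext.
- exact: (lin_comp sgL (lb2_linear m a)).
- exact: (lin_comp (lb2_linear m a) sgL).
move=> x y; move: x; apply: homog_ext.
- exact: (lin_comp sgL (lin_comp (lb2_linear m a) (tens_linl y))).
- exact: (lin_comp (lb2_linear m a) (lin_comp sgL (tens_linl y))).
move=> p x hx; move: y; apply: homog_ext.
- exact: (lin_comp sgL (lin_comp (lb2_linear m a) (tens_linr x))).
- exact: (lin_comp (lb2_linear m a) (lin_comp sgL (tens_linr x))).
move=> q y hy; have hax := lb_homogS brP sgP brA ha hx.
have hay := lb_homogS brP sgP brA ha hy.
rewrite lb2_tens (lin_add sgL) (sg_tensS sgP hax hy).
rewrite (twist_homog _ hx) (lin_scale (tens_linl _)) (lin_scale sgL) (sg_tensS' sgP hay hx).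
rewrite (sg_tens sgP hx hy) (lin_scale (lb2_linear m a)) lb2_tens (twist_homog _ hy).
rewrite (lin_scale (tens_linl _)); move: (tens (lb a y) x) (tens y (lb a x)) => u v.
by apply: sgn_swap; rewrite !(oddD, oddM, oddS) /=; case: (odd m); case: (odd p);
  case: (odd q).
Qed.

Lemma twist_brE m (t : S) :
  tmap (twist m) (twist m) (br (iS t) E) = br (iS t) E.
Proof.
have tL := @twist_linear C k d m.
by rewrite (brSE brP sgP brA) (lin_sub (tmap_linear tL tL)) !(tmap_tens tL tL) twist_1 twist_iS.
Qed.

Lemma lb2_brE m a (t : S) : dd_homog m a ->
  lb2 m a (br (iS t) E) = br (lb a (iS t)) E.
Proof.
move=> ha; rewrite (brSE brP sgP brA) (br_E brP sgP brA) (lin_sub (lb2_linear m a)).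
by rewrite !lb2_tens lb_1 tens_0r tens_0l twist_1 addr0 add0r.
Qed.

Lemma dd_outl_scale (l : C) (b : D) z : dd_outl (l *: b) z = l *: dd_outl b z.
Proof.
move: z; apply: tlin_ext; [exact: dd_outl_linear | exact: (lin_scalef _ (dd_outl_linear b)) |].
by move=> x y; rewrite !dd_outl_tens -dd_scaleAl tens_scalel.
Qed.
Lemma dd_outl_0 (z : D \ox D) : dd_outl 0 z = 0.
Proof.
move: z; apply: tlin_ext; [exact: dd_outl_linear | exact: lin_cst0 |].
by move=> x y; rewrite dd_outl_tens mul0r tens_0l.
Qed.

(** Induction on w. For a first letter in S the cross terms match by [br_lb_iS]; for E one has {a,
    E} = 0 and the explicit values {{x, E}}. *)
Lemma lb2_br_word m a t w : dd_homog m a ->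
  lb2 m a (br (iS t) (wval w)) =
  br (lb a (iS t)) (wval w) + (-1) ^+ m.+1 *: br (iS t) (lb a (wval w)).
Proof.
move=> ha; have hat := lb_iS_homogS t ha; have ht := homog_iS t; have hE := homog_gE C d.
rewrite exprS mulN1r; have ee := sgn_mulK C m.
(* The sign becomes an opaque scalar of square 1, as in [sum_stepS] and [sum_stepE]. *)
have [e eE] : exists e : C, (-1) ^+ m = e by exists ((-1) ^+ m).
rewrite eE in ee *.
elim: w => [|l w IH].
  by rewrite wval_nil !br_1 lb_1 (lin_0 (lb2_linear m a)) (lin_0 (brL _)) scaler0 addr0.
rewrite wval_cons; move: (wval w) IH => c IH.
have addE (V : zmodType) (x x' y y' : V) : x = x' -> y = y' -> x + y = x' + y'.
  by move=> -> ->.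
case: l => [s|] /=.
  have hs := homog_iS s; have has := lb_iS_homogS s ha.
  have e1 c' : br (iS t) (iS s * c') = dd_outl (iS s) (br (iS t) c').
    rewrite (brM brP c' ht hs) (brSS brP) (lin_0 (dd_outr_linear c')) scale1r addr0; reflexivity.
  have e2 : br (lb a (iS t)) (iS s * c) =
      dd_outl (iS s) (br (lb a (iS t)) c) + e *: dd_outr c (br (iS t) (lb a (iS s))).
    rewrite (br_MS brP c hat hs) muln0 scale1r (br_lb_iS _ _ ha) eE.
    have s1 := lin_scale (dd_outr_linear c) e (br (iS t) (lb a (iS s))).
    rewrite s1; reflexivity.
  have e3 : br (iS t) (lb a (iS s) * c) =
      (- e) *: dd_outl (lb a (iS s)) (br (iS t) c) + dd_outr c (br (iS t) (lb a (iS s))).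
    have h := br_SM brP c ht has; rewrite mul1n exprS mulN1r eE in h; exact: h.
  have e4 : br (iS t) (lb a (iS s * c)) = dd_outl (iS s) (br (iS t) (lb a c)) +
      ((- e) *: dd_outl (lb a (iS s)) (br (iS t) c) + dd_outr c (br (iS t) (lb a (iS s)))).
    rewrite (lbMt _ _ ha) twist_iS; apply: etrans (lin_add (brL _) _ _) _.
    exact: addE (e1 _) e3.
  have e5 : lb2 m a (dd_outl (iS s) (br (iS t) c)) = dd_outl (lb a (iS s)) (br (iS t) c) +
      (dd_outl (iS s) (br (lb a (iS t)) c) + (- e) *: dd_outl (iS s) (br (iS t) (lb a c))).
    rewrite (lb2_outl _ _ ha) IH twist_iS.
    exact: addE erefl (lin_addZ (dd_outl_linear _) _ _ _).
  rewrite e1 e2 e4 e5; exact: sum_stepS.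
have e1 c' : br (iS t) (E * c') = - dd_outl E (br (iS t) c') + dd_outr c' (br (iS t) E).
  rewrite (brM brP c' ht hE) mul1n expr1 scaleN1r; reflexivity.
have e2 : br (lb a (iS t)) (E * c) =
    e *: dd_outl E (br (lb a (iS t)) c) + dd_outr c (br (lb a (iS t)) E).
  have h := br_MS brP c hat hE; rewrite muln1 eE in h; exact: h.
have tE : twist m.+1 E = (- e) *: E.
  rewrite (twist_homog _ hE) muln1 exprS mulN1r eE; reflexivity.
have e3 : br (iS t) (lb a (E * c)) = (- e) *:
    (- dd_outl E (br (iS t) (lb a c)) + dd_outr (lb a c) (br (iS t) E)).
  rewrite (lbMt _ _ ha) (lbE brP sgP brA) mul0r addr0 tE -dd_scaleAl.
  apply: etrans (lin_scale (brL _) _ _) _; exact: (congr1 _ (e1 _)).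
have e4 : lb2 m a (dd_outl E (br (iS t) c)) = (- e) *:
    (dd_outl E (br (lb a (iS t)) c) + (- e) *: dd_outl E (br (iS t) (lb a c))).
  rewrite (lb2_outl _ _ ha) IH (lbE brP sgP brA) dd_outl_0 add0r tE dd_outl_scale.
  exact: (congr1 _ (lin_addZ (dd_outl_linear _) _ _ _)).
have e5 : lb2 m a (dd_outr c (br (iS t) E)) =
    dd_outr c (br (lb a (iS t)) E) + dd_outr (lb a c) (br (iS t) E).
  rewrite (lb2_outr _ _ ha) twist_brE (lb2_brE _ ha); reflexivity.
rewrite e2 e3; apply: etrans (congr1 (lb2 m a) (e1 c)) _.
apply: etrans (lin_add (lb2_linear m a) _ _) _.
apply: etrans (addE _ _ _ _ _ (etrans (lin_opp (lb2_linear m a) _) (congr1 -%R e4)) e5) _.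
rewrite addrA; exact: sum_stepE.
Qed.
End Jacobi.

Section JacobiDD.
Variables (C : fieldType) (k : nat) (d : 'I_k -> nat).
Local Notation S := (ssalg C d).
Local Notation D := (DD C d).
Local Notation E := (gE C d).
Variables (br : D -> D -> D \ox D) (brP : double_schouten br).
Variables (sg : D \ox D -> D \ox D) (sgP : is_gswap sg).
Hypothesis brA : forall m n (a b : D), dd_homog m a -> dd_homog n b ->
  br a b = - ((-1) ^+ (m.+1 * n.+1) *: sg (br b a)).
Local Notation lb := (single_bracket br).

Let tmL : linear (@dd_tmul C k d). Proof. exact: dd_tmul_linear. Qed.
Let brB : bilin br. Proof. by case: brP. Qed.
Let brL a : linear (br a). Proof. exact: brB.2. Qed.
Let brR b : linear (br^~ b). Proof. exact: brB.1. Qed.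
Let sgL : linear sg. Proof. by case: sgP. Qed.
Let lbL a : linear (lb a). Proof. exact: lb_linr. Qed.
Let lbR b : linear (lb^~ b). Proof. exact: lb_linl. Qed.

Definition tmul_sg (z : D \ox D) : D := dd_tmul (sg z).
Let tsL : linear tmul_sg. Proof. exact: (lin_comp tmL sgL). Qed.

Lemma lb_tmul_sg m n a b : dd_homog m a -> dd_homog n b ->
  lb a b = - ((-1) ^+ (m.+1 * n.+1) *: tmul_sg (br b a)).
Proof.
move=> ha hb; apply: etrans (congr1 (@dd_tmul C k d) (brA ha hb)) _.
apply: etrans (lin_opp tmL _) _; exact: (congr1 _ (lin_scale tmL _ _)).
Qed.
Lemma lb_tmul_sgAS j n a b : homogS j a -> dd_homog n b ->
  lb a b = - ((-1) ^+ (j * n.+1) *: tmul_sg (br b a)).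
Proof.
move=> ha hb; apply: etrans (congr1 (@dd_tmul C k d) (br_AS brP sgP brA ha hb)) _.
apply: etrans (lin_opp tmL _) _; exact: (congr1 _ (lin_scale tmL _ _)).
Qed.
Lemma lb_tmul_sgSA j n a b : homogS j a -> dd_homog n b ->
  lb b a = - ((-1) ^+ (n.+1 * j) *: tmul_sg (br a b)).
Proof.
move=> ha hb; apply: etrans (congr1 (@dd_tmul C k d) (br_SA brP sgP brA ha hb)) _.
apply: etrans (lin_opp tmL _) _; exact: (congr1 _ (lin_scale tmL _ _)).
Qed.

Lemma lb_tmul_sg_lb2 m a z : dd_homog m a -> lb a (tmul_sg z) = tmul_sg (lb2 br m a z).
Proof.
move=> ha; rewrite /tmul_sg (lb2_tmul brP _ ha); congr dd_tmul; symmetry.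
exact: (sg_lb2 brP sgP brA _ ha).
Qed.

Lemma lb2_br m a t b : dd_homog m a ->
  lb2 br m a (br (iS t) b) =
  br (lb a (iS t)) b + (-1) ^+ m.+1 *: br (iS t) (lb a b).
Proof.
move=> ha; move: b; apply: word_ext.
- exact: (lin_comp (lb2_linear brP m a) (brL _)).
- apply: lin_addf; first exact: brL.
  exact: (lin_scalef _ (lin_comp (brL _) (lbL a))).
by move=> w; exact: (lb2_br_word brP sgP brA t w ha).
Qed.

Lemma jacobi_signs (V : lmodType C) m n (u v x y : V) :
  u = - ((-1) ^+ ((m + n) * 1) *: x) -> v = - ((-1) ^+ (n.+1 * m) *: y) ->
  - ((-1) ^+ (n.+1 * 1) *: (y + (-1) ^+ m.+1 *: x)) = u + (-1) ^+ (m.+1 * n.+1) *: v.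
Proof.
move=> -> ->; rewrite scalerDr opprD addrC !scalerN !scalerA -!exprD.
congr (- _ - _); apply: sgn_scale; rewrite !(oddD, oddM, oddS) /=;
  by case: (odd m); case: (odd n).
Qed.

(** Write {b, t} as {{t, b}}, swapped and multiplied; both operations commute with {a, -}. Then
    [lb2_br] gives two terms, which antisymmetry turns into those of the Jacobi identity. *)
Lemma lb_lb_iS m n a b t : dd_homog m a -> dd_homog n b ->
  lb a (lb b (iS t)) =
  lb (lb a b) (iS t) + (-1) ^+ (m.+1 * n.+1) *: lb b (lb a (iS t)).
Proof.
move=> ha hb; have ht := homog_iS t; have hab := lb_homogS brP sgP brA ha hb.
have hat := lb_iS_homogS brP sgP brA t ha.
have e1 : lb a (lb b (iS t)) = - ((-1) ^+ (n.+1 * 1) *: (tmul_sg (br (lb a (iS t)) b)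
    + (-1) ^+ m.+1 *: tmul_sg (br (iS t) (lb a b)))).
  rewrite (lb_tmul_sg hb ht) (lin_opp (lbL a)); congr (- _).
  apply: etrans (lin_scale (lbL a) _ _) _; congr (_ *: _).
  apply: etrans (lb_tmul_sg_lb2 _ ha) _.
  apply: etrans (congr1 _ (lb2_br _ _ ha)) _; exact: (lin_addZ tsL).
apply: etrans e1 _; apply: jacobi_signs.
  exact: (lb_tmul_sgAS hab ht).
exact: (lb_tmul_sgSA hat hb).
Qed.

Lemma jacobi_sum (V : lmodType C) a b e f g h (K1 B1 A2 A3 K4 B4 : V) :
  odd (a + b) = odd g -> odd (e + b) = odd f -> odd (e + h) = odd a ->
  (-1) ^+ a *: ((-1) ^+ b *: (K1 + (-1) ^+ e *: B1) + A2)
    + ((-1) ^+ f *: A3 + (K4 + (-1) ^+ e *: B4))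
  = ((-1) ^+ g *: K1 + K4)
    + (-1) ^+ e *: ((-1) ^+ b *: ((-1) ^+ a *: B1 + A3) + ((-1) ^+ h *: A2 + B4)).
Proof.
move=> hg hf ha.
rewrite -(sgn_eq C hg) -(sgn_eq C hf) !exprD; have := sgn_eq C ha; rewrite exprD.
move: ((-1) ^+ a) ((-1) ^+ b) ((-1) ^+ e) ((-1) ^+ h) => xa xb xe xh <-.
rewrite !scalerDr !scalerA.
have -> : xe * xb * (xe * xh) = xe * xh * xb * xe by rewrite mulrC [xe * xb]mulrC mulrA.
move: (_ *: K1) (_ *: B1) (_ *: A2) (_ *: A3) (_ *: B4) => k1 b1 a2 a3 b4.
by rewrite [RHS](AC (2*(2*2)) ((1*3*5)*(4*(2*6)))).
Qed.

(** By the Leibniz rule in c, induction on words reduces this to single letters: [lb_lb_iS] for S,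
    and E is killed by every {x, -}. The mixed products of brackets occur equally on both sides
    ([jacobi_sum]). *)
Lemma lb_jacobi m n a b c : dd_homog m a -> dd_homog n b ->
  lb a (lb b c) = lb (lb a b) c + (-1) ^+ (m.+1 * n.+1) *: lb b (lb a c).
Proof.
move=> ha hb; have hab := lb_homogS brP sgP brA ha hb.
have gen l : lb a (lb b (lval l)) =
    lb (lb a b) (lval l) + (-1) ^+ (m.+1 * n.+1) *: lb b (lb a (lval l)).
  case: l => [s|] /=; first exact: lb_lb_iS.
  by rewrite !(lbE brP sgP brA) (lin_0 (lbL a)) (lin_0 (lbL b)) scaler0 addr0.
move: c; apply: word_ext.
- exact: (lin_comp (lbL a) (lbL b)).
- apply: lin_addf; first exact: lbL.
  exact: (lin_scalef _ (lin_comp (lbL b) (lbL a))).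
elim=> [|l w IH].
  by rewrite wval_nil !(lb_1 brP) (lin_0 (lbL a)) (lin_0 (lbL b)) scaler0 addr0.
have [p hx] : exists p, dd_homog p (lval l).
  by case: l {gen} => [s|]; [exists 0%N; exact: homog_iS | exists 1%N; exact: homog_gE].
rewrite wval_cons; move: (wval w) (lval l) {gen}(gen l) hx IH => c x gen hx IH.
have hax := lb_homogS brP sgP brA ha hx; have hbx := lb_homogS brP sgP brA hb hx.
have lbab (a' b' : D) m' n' : dd_homog m' a' -> dd_homog n' b' ->
    homogS (n' + p) (lb b' x) -> lb a' (lb b' (x * c)) =
    (-1) ^+ (n'.+1 * p) *: ((-1) ^+ (m'.+1 * p) *: (x * lb a' (lb b' c)) + lb a' x * lb b' c)
    + ((-1) ^+ (m'.+1 * (n' + p).+1) *: (lb b' x * lb a' c) + lb a' (lb b' x) * c).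
  move=> ha' hb' hbx'; apply: etrans (congr1 (lb a') (lbM brP c hb' hx)) _.
  apply: etrans (lin_add (lbL a') _ _) _.
  have -> := lb_SM brP c ha' hbx'; congr (_ + _).
  apply: etrans (lin_scale (lbL a') _ _) _; congr (_ *: _).
  exact: (lbM brP _ ha' hx).
apply: etrans (lbab _ _ _ _ ha hb hbx) _.
apply: etrans _ (esym (congr2 (fun u v => u + _ *: v)
  (lb_MS brP c hab hx) (lbab _ _ _ _ hb ha hax))).
rewrite IH gen mulrDr mulrDl -dd_scaleAl -dd_scaleAr; apply: jacobi_sum;
  rewrite !(oddD, oddM, oddS) /=; by case: (odd m); case: (odd n); case: (odd p).
Qed.
End JacobiDD.

Lemma signz_abs (C : fieldType) (z : int) : (-1) ^ z = (-1) ^+ `|z|%N :> C.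
Proof. by case: z => n //; rewrite NegzE /= -exprnN invr_sign. Qed.

Lemma odd_absz_shift (z : int) m : z + 1 = m%:Z -> odd `|z|%N = odd m.+1.
Proof.
move/(congr1 (fun x => x - 1)); rewrite addrK => ->.
by case: m => [|m] //; rewrite -{1}addn1 PoszD addrK /= negbK.
Qed.

Lemma signz_shift (C : fieldType) (y : int) m :
  y + 1 = m%:Z -> (-1) ^ y = (-1) ^+ m.+1 :> C.
Proof. by move=> ym; rewrite signz_abs; apply: sgn_eq; exact: odd_absz_shift. Qed.

Lemma signz_shiftM (C : fieldType) (y z : int) m n :
  y + 1 = m%:Z -> z + 1 = n%:Z -> (-1) ^ (y * z) = (-1) ^+ (m.+1 * n.+1) :> C.
Proof.
move=> ym zn; rewrite signz_abs; apply: sgn_eq.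
by rewrite abszM !oddM (odd_absz_shift ym) (odd_absz_shift zn).
Qed.

(** * The induced bracket *)

Section Cyclic.
Variables (C : fieldType) (A : lmodType C).
Variables (mul : A -> A -> A) (hom : nat -> A -> Prop).
Local Notation cyc := (cyc mul hom).
Local Notation proj := (cyc_proj mul hom).

Lemma cyc_proj_linear : linear (proj : A -> cyc).
Proof. exact: qproj_linear. Qed.
Lemma cyc_comm m n a b : hom m a -> hom n b ->
  proj (mul a b) = (-1) ^+ (m * n) *: proj (mul b a) :> cyc.
Proof.
move=> ha hb; apply/eqP; rewrite -subr_eq0 -(lin_scale cyc_proj_linear).
rewrite -(lin_sub cyc_proj_linear); apply/eqP; apply: qproj_0; apply: spanG.
exact: SuperComm.
Qed.
Lemma cyc_ind (P : cyc -> Prop) : (forall a, P (proj a)) -> forall x, P x.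
Proof. by move=> h x; rewrite -(qreprK x); exact: h. Qed.

Hypothesis hom0 : forall n, hom n 0.

Lemma cyc_shift0 z : cyc_shift z (0 : cyc).
Proof.
rewrite /cyc_shift; case: (z + 1) => // n; exists 0 => //.
by rewrite (lin_0 cyc_proj_linear).
Qed.
Lemma cyc_shiftI z n a : z + 1 = n%:Z -> hom n a -> cyc_shift z (proj a : cyc).
Proof. by rewrite /cyc_shift => -> ha; exists a. Qed.
Lemma cyc_shiftP z (x : cyc) : cyc_shift z x ->
  x = 0 \/ exists n a, [/\ z + 1 = n%:Z, hom n a & x = proj a].
Proof.
rewrite /cyc_shift; case: (z + 1) => n; last by left.
by case=> a ha ->; right; exists n, a.
Qed.
End Cyclic.

Section InducedBracket.
Variables (C : fieldType) (k : nat) (d : 'I_k -> nat).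
Local Notation S := (ssalg C d).
Local Notation D := (DD C d).
Variables (br : D -> D -> D \ox D) (brP : double_schouten br).
Variables (sg : D \ox D -> D \ox D) (sgP : is_gswap sg).
Hypothesis brA : forall m n (a b : D), dd_homog m a -> dd_homog n b ->
  br a b = - ((-1) ^+ (m.+1 * n.+1) *: sg (br b a)).
Local Notation lb := (single_bracket br).
Local Notation proj := (@DDcyc_proj C k d).
Local Notation scomm := (@supercomm C (DD C d) (@GRing.mul (DD C d)) (@dd_homog C k d)).

Let tmL : linear (@dd_tmul C k d). Proof. exact: dd_tmul_linear. Qed.
Let sgL : linear sg. Proof. by case: sgP. Qed.
Let lbL a : linear (lb a). Proof. exact: lb_linr. Qed.
Let lbR b : linear (lb^~ b). Proof. exact: lb_linl. Qed.

Lemma DDcyc_proj_linear : linear proj. Proof. exact: cyc_proj_linear. Qed.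
Let prL : linear proj. Proof. exact: DDcyc_proj_linear. Qed.

Lemma DDcyc_comm m n a b : dd_homog m a -> dd_homog n b ->
  proj (a * b) = (-1) ^+ (m * n) *: proj (b * a).
Proof. exact: cyc_comm. Qed.

Lemma DDcyc_commS j n x b : homogS j x -> dd_homog n b ->
  proj (x * b) = (-1) ^+ (j.+1 * n) *: proj (b * x).
Proof.
case: j => [-> _|j /= hx hb].
  by rewrite mul0r mulr0 (lin_0 prL) scaler0.
by rewrite (DDcyc_comm hx hb); apply: sgn_scale; rewrite !oddM /= negbK.
Qed.

(** The sign of the swap is that of a supercommutator; antisymmetry of the double bracket thus
    passes to the quotient. *)
Lemma DDcyc_sg z : proj (dd_tmul (sg z)) = proj (dd_tmul z).
Proof.
move: z; apply: tlin_ext.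
- exact: (lin_comp prL (lin_comp tmL sgL)).
- exact: (lin_comp prL tmL).
move=> x y; move: x; apply: homog_ext.
- exact: (lin_comp prL (lin_comp tmL (lin_comp sgL (tens_linl y)))).
- exact: (lin_comp prL (lin_comp tmL (tens_linl y))).
move=> m x hx; move: y; apply: homog_ext.
- exact: (lin_comp prL (lin_comp tmL (lin_comp sgL (tens_linr x)))).
- exact: (lin_comp prL (lin_comp tmL (tens_linr x))).
move=> n y hy; rewrite (sg_tens sgP hx hy) (lin_scale tmL) !dd_tmul_tens (lin_scale prL).
by rewrite (DDcyc_comm hx hy).
Qed.

Lemma proj_lb_anti m n a b : dd_homog m a -> dd_homog n b ->
  proj (lb a b) = - ((-1) ^+ (m.+1 * n.+1) *: proj (lb b a)).
Proof.
move=> ha hb; rewrite (lb_tmul_sg brA ha hb) (lin_opp prL) (lin_scale prL).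
by congr (- (_ *: _)); exact: DDcyc_sg.
Qed.

Lemma proj_lbM m p q a x y : dd_homog m a -> dd_homog p x -> dd_homog q y ->
  proj (lb a (x * y)) = (-1) ^+ (m.+1 * p) *: proj (x * lb a y)
    + (-1) ^+ ((m + p).+1 * q) *: proj (y * lb a x).
Proof.
move=> ha hx hy; have hax := lb_homogS brP sgP brA ha hx.
apply: etrans (congr1 proj (lbM brP y ha hx)) _.
apply: etrans (lin_add prL _ _) _.
exact: (congr2 +%R (lin_scale prL _ _) (DDcyc_commS hax hy)).
Qed.

Lemma comm_sum (V : lmodType C) m p q (u v : V) :
  ((-1) ^+ (m.+1 * p) *: u + (-1) ^+ ((m + p).+1 * q) *: v)
  - (-1) ^+ (p * q) *: ((-1) ^+ (m.+1 * q) *: v + (-1) ^+ ((m + q).+1 * p) *: u) = 0.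
Proof.
rewrite scalerDr !scalerA -!exprD.
rewrite (@sgn_scale _ _ ((m + p).+1 * q) (p * q + m.+1 * q) v); last first.
  by rewrite !(oddD, oddM, oddS) /=; case: (odd m); case: (odd p); case: (odd q).
rewrite (@sgn_scale _ _ (p * q + (m + q).+1 * p) (m.+1 * p) u); last first.
  by rewrite !(oddD, oddM, oddS) /=; case: (odd m); case: (odd p); case: (odd q).
by rewrite [X in X - _]addrC subrr.
Qed.

(** By [proj_lbM], {a, x y} modulo supercommutators is symmetric in x and y up to the Koszul
    sign. *)
Lemma proj_lb_comm a b : scomm b -> proj (lb a b) = 0.
Proof.
case=> p q x y hx hy; move: a; apply: homog_ext.
- exact: (lin_comp prL (lbR _)).
- exact: lin_cst0.
move=> m a ha; apply: etrans (congr1 proj (lin_sub (lbL a) _ _)) _.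
apply: etrans (lin_sub prL _ _) _.
apply: etrans (congr2 (fun u v => u - v) (proj_lbM ha hx hy)
  (etrans (congr1 proj (lin_scale (lbL a) _ _)) (etrans (lin_scale prL _ _)
    (congr1 _ (proj_lbM ha hy hx))))) _.
exact: comm_sum.
Qed.

(** A generating supercommutator is homogeneous, so antisymmetry reduces this to the other
    argument. *)
Lemma proj_lb_comm_l a b : scomm a -> proj (lb a b) = 0.
Proof.
move=> ha; move: b; apply: homog_ext.
- exact: (lin_comp prL (lbL _)).
- exact: lin_cst0.
move=> n b hb; have [m hm] : exists m, dd_homog m a.
  case: ha => p q x y hx hy; exists (p + q)%N; apply: spanB; first exact: homogM.
  by apply: spanZ; rewrite addnC; exact: homogM.
by rewrite (proj_lb_anti hm hb) (proj_lb_comm _ ha) scaler0 oppr0.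
Qed.

Definition cyc_bracket (x y : DDcyc C d) : DDcyc C d := proj (lb (qrepr x) (qrepr y)).

Lemma cyc_bracketE a b : cyc_bracket (proj a) (proj b) = proj (lb a b).
Proof.
rewrite /cyc_bracket.
transitivity (proj (lb (qrepr (proj a)) b)).
  exact: (qliftE (lin_comp prL (lbL _)) (proj_lb_comm _)).
exact: (qliftE (lin_comp prL (lbR b)) (fun a' => @proj_lb_comm_l a' b)).
Qed.

Lemma cyc_bracket_bilin : bilin cyc_bracket.
Proof.
split=> [y|x] c u v.
  rewrite -(qreprK u) -(qreprK v) -(qreprK y) -[qproj _]/proj -prL !cyc_bracketE.
  by rewrite -prL -(lbR _).
rewrite -(qreprK u) -(qreprK v) -(qreprK x) -[qproj _]/proj -prL !cyc_bracketE.
by rewrite -prL -(lbL _).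
Qed.
End InducedBracket.

Section GradedBracket.
Variables (C : fieldType) (k : nat) (d : 'I_k -> nat).
Local Notation D := (DD C d).
Variables (br : D -> D -> D \ox D) (brP : double_schouten br).
Variables (sg : D \ox D -> D \ox D) (sgP : is_gswap sg).
Hypothesis brA : forall m n (a b : D), dd_homog m a -> dd_homog n b ->
  br a b = - ((-1) ^+ (m.+1 * n.+1) *: sg (br b a)).
Local Notation lb := (single_bracket br).
Local Notation proj := (@DDcyc_proj C k d).
Local Notation cb := (cyc_bracket br).
Local Notation deg := (@DDcyc_deg C k d).

Let prL : linear proj. Proof. exact: DDcyc_proj_linear. Qed.
Let cbB : bilin cb. Proof. exact: cyc_bracket_bilin sgP brA. Qed.
Let cb0l y : cb 0 y = 0. Proof. exact: (lin_0 (cbB.1 y)). Qed.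
Let cb0r x : cb x 0 = 0. Proof. exact: (lin_0 (cbB.2 x)). Qed.

Lemma DDcyc_deg0 z : deg z 0.
Proof. by apply: cyc_shift0 => n; exact: span0. Qed.

Lemma DDcyc_degP z x : deg z x ->
  x = 0 \/ exists n a, [/\ z + 1 = n%:Z, dd_homog n a & x = proj a].
Proof. exact: cyc_shiftP. Qed.

(** With y = m - 1 and z = n - 1, [homogS (m + n)] means degree m + n - 1, hence shifted degree y +
    z. *)
Lemma DDcyc_degS (y z : int) m n a : y + 1 = m%:Z -> z + 1 = n%:Z ->
  homogS (m + n) a -> deg (y + z) (proj a).
Proof.
move=> ym zn; have yz : y + z + 2 = (m + n)%:Z by rewrite PoszD -ym -zn addrACA.
have -> : y + z = (m + n)%:Z - 2 by rewrite -yz addrK.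
case: (m + n)%N => [|j] ha.
  by rewrite (ha : a = 0) (lin_0 prL); exact: DDcyc_deg0.
apply: (@cyc_shiftI _ _ _ _ _ j) => //.
by rewrite -addn1 PoszD -!addrA [X in _ + X](_ : _ = 0) ?addr0.
Qed.

Lemma cb_deg y z a b : deg y a -> deg z b -> deg (y + z) (cb a b).
Proof.
move=> /DDcyc_degP[->|[m [a' [ym ha ->]]]]; first by rewrite cb0l => _; exact: DDcyc_deg0.
move=> /DDcyc_degP[->|[n [b' [zn hb ->]]]]; first by rewrite cb0r; exact: DDcyc_deg0.
rewrite (cyc_bracketE brP sgP brA); apply: (DDcyc_degS ym zn).
exact: (lb_homogS brP sgP brA).
Qed.

Lemma cb_anti y z a b : deg y a -> deg z b -> cb a b = - ((-1) ^ (y * z) *: cb b a).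
Proof.
move=> /DDcyc_degP[->|[m [a' [ym ha ->]]]]; first by rewrite cb0l cb0r scaler0 oppr0.
move=> /DDcyc_degP[->|[n [b' [zn hb ->]]]]; first by rewrite cb0l cb0r scaler0 oppr0.
rewrite (cyc_bracketE brP sgP brA b' a') (cyc_bracketE brP sgP brA a' b') (signz_shiftM C ym zn).
exact: (proj_lb_anti sgP brA ha hb).
Qed.

Lemma cb_jacobi y z a b c : deg y a -> deg z b ->
  cb a (cb b c) = cb (cb a b) c + (-1) ^ (y * z) *: cb b (cb a c).
Proof.
move=> /DDcyc_degP[->|[m [a' [ym ha ->]]]].
  by move=> _; rewrite !(cb0l, cb0r) scaler0 addr0.
move=> /DDcyc_degP[->|[n [b' [zn hb ->]]]].
  by rewrite !(cb0l, cb0r) scaler0 addr0.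
elim/cyc_ind: c => c; have cbE := cyc_bracketE brP sgP brA.
rewrite (signz_shiftM C ym zn).
apply: etrans (etrans (congr1 _ (cbE b' c)) (cbE a' _)) _.
apply: etrans _ (esym (congr2 (fun u v => u + _ *: v)
  (etrans (congr1 (cb^~ (proj c)) (cbE a' b')) (cbE _ c))
  (etrans (congr1 _ (cbE a' c)) (cbE b' _)))).
apply: etrans (congr1 proj (lb_jacobi brP sgP brA c ha hb)) _.
exact: (lin_addZ prL).
Qed.
End GradedBracket.

(** * The Morita equivalence with the path algebra *)

Section PathAlgebraFacts.
Variables (C : fieldType) (k : nat) (d : 'I_k -> nat).
Local Notation P := (pathalg C d).
Local Notation pah := (@pa_homog C k d).

Lemma pa_mull_linear (x : P) : linear (fun y : P => (x * y : P)).
Proof. exact: pa_mul_linearr. Qed.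
Lemma pa_mulr_linear (x : P) : linear (fun y : P => (y * x : P)).
Proof. exact: pa_mul_linearl. Qed.
Lemma pa_scaleAl (c : C) (x y : P) : (c *: x) * y = c *: (x * y).
Proof. exact: (lin_scale (pa_mulr_linear y)). Qed.
Lemma pa_scaleAr (c : C) (x y : P) : x * (c *: y) = c *: (x * y).
Proof. exact: (lin_scale (pa_mull_linear x)). Qed.
Lemma pbaseM (p q : qpath d) : pbase C p * pbase C q = obase C (qcat p q) :> P.
Proof. exact: pa_mulU. Qed.

Lemma vertM i j : vert C d i * vert C d j = (i == j)%:R *: vert C d j.
Proof.
rewrite /vert pbaseM qcat1p /=; case: eqP => _; first by rewrite scale1r.
by rewrite scale0r.
Qed.
Lemma vert_arr i a : vert C d i * arr C a = (i == tail a)%:R *: arr C a.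
Proof.
rewrite /vert /arr pbaseM qcat1p /=; case: eqP => _; first by rewrite scale1r.
by rewrite scale0r.
Qed.
Lemma arr_vert i a : arr C a * vert C d i = (head a == i)%:R *: arr C a.
Proof.
rewrite /vert /arr pbaseM qcatp1 /=; case: eqP => _; first by rewrite scale1r.
by rewrite scale0r.
Qed.

Lemma pa_homogM m n (x y : P) : pah m x -> pah n y -> pah (m + n) (x * y).
Proof.
move=> hx hy; move: x hx; apply: span_map; first exact: pa_mulr_linear.
move=> _ [p <- ->]; move: y hy; apply: span_map; first exact: pa_mull_linear.
move=> _ [q <- ->]; rewrite pbaseM; case pq: (qcat p q) => [r|]; last exact: span0.
have /qcatP[_ _ _ ra] := pq.
by apply: spanG; exists r; rewrite ?ra ?size_cat.
Qed.
Lemma pa_homog_vert i : pah 0 (vert C d i).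
Proof. by apply: spanG; exists (qvertex d i). Qed.
Lemma pa_homog_arr a : pah 1 (arr C a).
Proof. by apply: spanG; eexists; last by []. Qed.
Lemma pa_homog_arr_at i j p q : pah 1 (arr_at C d i j p q).
Proof. by rewrite /arr_at; case: insubP => *; [exact: pa_homog_arr | exact: span0]. Qed.
Lemma pa_homog_conn i j p q : pah 1 (conn C d i j p q).
Proof.
rewrite /conn; case: ifP => _; last exact: pa_homog_arr_at.
by apply: spanN; apply: span_sum => r _; exact: pa_homog_arr_at.
Qed.

Lemma arr_at_vert i j p q l : arr_at C d i j p q * vert C d l = (i == l)%:R *: arr_at C d i j p q.
Proof.
rewrite /arr_at; case: insubP => [a _ aE|_]; last by rewrite mul0r scaler0.
by rewrite arr_vert /head aE.
Qed.
Lemma vert_arr_at i j p q l : vert C d l * arr_at C d i j p q = (l == j)%:R *: arr_at C d i j p q.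
Proof.
rewrite /arr_at; case: insubP => [a _ aE|_]; last by rewrite mulr0 scaler0.
by rewrite vert_arr /tail aE.
Qed.
Lemma conn_vert i j p q : conn C d j i p q * vert C d i = conn C d j i p q.
Proof.
rewrite /conn; case: ifP => _; last by rewrite arr_at_vert eqxx scale1r.
rewrite mulNr mulr_suml; congr (- _); apply: eq_bigr => r _.
by rewrite arr_at_vert eqxx scale1r.
Qed.
Lemma vert_conn i j p q : vert C d j * conn C d j i p q = conn C d j i p q.
Proof.
rewrite /conn; case: ifP => [/and3P[/eqP-> _ _]|_]; last by rewrite vert_arr_at eqxx scale1r.
rewrite mulrN mulr_sumr; congr (- _); apply: eq_bigr => r _.
by rewrite vert_arr_at eqxx scale1r.
Qed.

Lemma arr_atE (a : arrow d) : arr_at C d (head a) (tail a) (prim a) (sec a) = arr C a.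
Proof.
rewrite /arr_at; have -> : (head a, tail a, prim a, sec a) = val a.
  by rewrite /head /tail /prim /sec /val /=; case: a => -[[[i j] p] q] /=.
by rewrite valK.
Qed.
Lemma arrowP (a : arrow d) : [/\ (0 < prim a <= d (head a))%N,
  (0 < sec a <= d (tail a))%N & ~~ [&& head a == tail a, prim a == 1%N & sec a == 1%N]].
Proof. by case: a => -[[[i j] p] q] h; have /and3P[h1 h2 h3] := h; split. Qed.
Lemma connE (a : arrow d) : conn C d (tail a) (head a) (prim a) (sec a) = arr C a.
Proof. by have [_ _ /negbTE h] := arrowP a; rewrite /conn h arr_atE. Qed.

(** The convention for bi-colour (1, 1) is what makes this sum vanish; it is the counterpart of
    [gauge_rel]. *)
Lemma sum_conn i : (0 < d i)%N -> \sum_(p < d i) conn C d i i p.+1 p.+1 = 0.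
Proof.
move=> di; rewrite -(big_mkord xpredT (fun p => conn C d i i p.+1 p.+1)) big_ltn //.
rewrite {1}/conn !eqxx /= -[(d i).+1]addn1 -[X in \sum_(X <= _ < _) arr_at _ _ _ _ _ _]addn1.
rewrite big_addn addnK; apply/eqP; rewrite addrC subr_eq0; apply/eqP.
rewrite big_nat_cond [RHS]big_nat_cond; apply: eq_bigr => r /andP[/andP[r1 _] _].
by rewrite /conn eqSS (gtn_eqF r1) !andbF addn1.
Qed.
End PathAlgebraFacts.

Section MatrixProduct.
Variables (R : pzRingType) (T : finType).
Implicit Types M N Q : T -> T -> R.

Lemma matrix_mulA M N Q a b :
  \sum_g M a g * (\sum_e N g e * Q e b) = \sum_e (\sum_g M a g * N g e) * Q e b.
Proof.
under eq_bigr do rewrite mulr_sumr.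
rewrite exchange_big; apply: eq_bigr => g _; rewrite mulr_suml.
by apply: eq_bigr => e _; rewrite mulrA.
Qed.
Lemma matrix_mul_eq M M' N N' a b : M =2 M' -> N =2 N' ->
  \sum_g M a g * N g b = \sum_g M' a g * N' g b.
Proof. by move=> h h'; apply: eq_bigr => g _; rewrite h h'. Qed.
Lemma matrix_delta_mul (v : T -> R) M a b (D : T -> T -> R) :
  (forall g, D a g = if g == a then v a else 0) -> \sum_g D a g * M g b = v a * M a b.
Proof.
move=> h; rewrite (bigD1 a) //= big1 => [|g /negbTE ne].
  by rewrite h eqxx addr0.
by rewrite h ne mul0r.
Qed.
Lemma matrix_mul_delta (v : T -> R) M a b (D : T -> T -> R) :
  (forall g, D g b = if g == b then v b else 0) -> \sum_g M a g * D g b = M a b * v b.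
Proof.
move=> h; rewrite (bigD1 b) //= big1 => [|g /negbTE ne].
  by rewrite h eqxx addr0.
by rewrite h ne mulr0.
Qed.
Lemma matrix_cornerl v M N a b : (forall g, v * M a g = M a g) ->
  v * (\sum_g M a g * N g b) = \sum_g M a g * N g b.
Proof. by move=> h; rewrite mulr_sumr; apply: eq_bigr => g _; rewrite mulrA h. Qed.
Lemma matrix_cornerr v M N a b : (forall g, N g b * v = N g b) ->
  (\sum_g M a g * N g b) * v = \sum_g M a g * N g b.
Proof. by move=> h; rewrite mulr_suml; apply: eq_bigr => g _; rewrite -mulrA h. Qed.
End MatrixProduct.

(** * [DD] as matrices over the path algebra *)

Section Representation.
Variables (C : fieldType) (k : nat) (d : 'I_k -> nat).
Hypothesis d_gt0 : forall i, (0 < d i)%N.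
Local Notation P := (pathalg C d).
Local Notation S := (ssalg C d).
Local Notation D := (DD C d).
Local Notation Der := (dder C d).
Local Notation pah := (@pa_homog C k d).

(* Coloured vertices; a matrix indexed by them has entries (i, p + 1), for i *)
(* a vertex and p : 'I_(d i).                                                *)
Definition cvertex : finType := {i : 'I_k & 'I_(d i)}.
Implicit Types (al be ga de : cvertex) (M N : cvertex -> cvertex -> P).

Definition eLc al : S := eL C d (tag al) (tagged al).+1.
Definition eRc al : S := eR C d (tag al) (tagged al).+1.

Definition cmul M N al be : P := \sum_ga M al ga * N ga be.
(** A unit for the [cornered] matrices: its diagonal entries are vertex idempotents. *)
Definition cone al be : P := (al == be)%:R *: vert C d (tag al).
(** The matrix that represents E, as [rho_gE] confirms. *)
Definition gen_mx al be : P := conn C d (tag al) (tag be) (tagged be).+1 (tagged al).+1.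
Definition rS (s : S) al be : P := scoef s (tagged al) (tagged be) *: vert C d (tag al).
(** The matrix of the word y E x, to which x (x) y in a primitive corresponds by [iD_inner]. *)
Definition rsand al be (x y : S) : P := cmul (cmul (rS y) gen_mx) (rS x) al be.
Definition rD (f : Der) al be : P := tlift (rsand al be) (primitive f).

Lemma cmulA M N Q : cmul M (cmul N Q) =2 cmul (cmul M N) Q.
Proof. by move=> al be; exact: matrix_mulA. Qed.
Lemma eq_cmul M M' N N' : M =2 M' -> N =2 N' -> cmul M N =2 cmul M' N'.
Proof. by move=> h h' al be; exact: matrix_mul_eq. Qed.

Let rrefl2 M : M =2 M. Proof. by []. Qed.

Lemma sum_cvertex (V : nmodType) (F : forall i, 'I_(d i) -> V) :
  \sum_(i < k) \sum_(p < d i) F i p = \sum_(al : cvertex) F (tag al) (tagged al).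
Proof. exact: (@sig_big_dep _ _ _ _ _ xpredT (fun _ _ => true) F). Qed.

Lemma cone_if al be : cone al be = if be == al then vert C d (tag al) else 0.
Proof. by rewrite /cone eq_sym; case: eqP; rewrite ?scale1r ?scale0r. Qed.
Lemma cmul1 M al be : cmul cone M al be = vert C d (tag al) * M al be.
Proof. by apply: (matrix_delta_mul (v := fun al => vert C d (tag al))) => ga; exact: cone_if. Qed.
Lemma cmulr1 M al be : cmul M cone al be = M al be * vert C d (tag be).
Proof.
apply: (matrix_mul_delta (v := fun al => vert C d (tag al))) => ga.
by rewrite cone_if eq_sym; case: eqP => // ->.
Qed.

Definition cornered M : Prop := forall al be,
  vert C d (tag al) * M al be = M al be /\ M al be * vert C d (tag be) = M al be.

Lemma cornered_mul M N : cornered M -> cornered N -> cornered (cmul M N).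
Proof.
move=> hM hN al be; split.
  by apply: matrix_cornerl => ga; exact: (hM _ _).1.
by apply: matrix_cornerr => ga; exact: (hN _ _).2.
Qed.
Lemma cornered_gen : cornered gen_mx.
Proof. by move=> al be; rewrite vert_conn conn_vert. Qed.
Lemma scoef_neq (s : S) al be : tag al != tag be -> scoef s (tagged al) (tagged be) = 0.
Proof. by move=> /negbTE ne; rewrite /scoef big1 // => r _; rewrite ne mulr0. Qed.
Lemma vert_corner c i j : (i != j -> c = 0) ->
  vert C d i * (c *: vert C d i) = c *: vert C d i /\
  (c *: vert C d i) * vert C d j = c *: vert C d i.
Proof.
move=> h; split; first by rewrite pa_scaleAr vertM eqxx scale1r.
rewrite pa_scaleAl vertM; have [<-|/h->] := eqVneq i j; first by rewrite scale1r.
by rewrite !scale0r.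
Qed.
Lemma cornered_rS s : cornered (rS s).
Proof.
by move=> al be; apply: vert_corner => ne; exact: scoef_neq.
Qed.
Lemma cornered_one : cornered cone.
Proof.
move=> al be; apply: vert_corner => ne.
by case: eqP => // ab; rewrite ab eqxx in ne.
Qed.

Lemma rS_linear al be : linear (fun s => rS s al be).
Proof.
by move=> c s t; rewrite /rS (scoef_linear _ _ c s t) scalerDl -scalerA.
Qed.
Lemma rS_mul s t : rS (s * t) =2 cmul (rS s) (rS t).
Proof.
move=> al be; rewrite /rS /cmul (scoefM d_gt0).
rewrite (sum_cvertex (fun l (r : 'I_(d l)) => scoef s (tagged al) r * scoef t r (tagged be))).
rewrite scaler_suml; apply: eq_bigr => ga _; rewrite pa_scaleAl pa_scaleAr !scalerA vertM.
have [e|ne] := eqVneq (tag al) (tag ga).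
  have -> : vert C d (tag al) = vert C d (tag ga) by rewrite e.
  by rewrite scale1r.
rewrite (scoef_neq s ne) mul0r; apply: etrans (scale0r _) _.
by symmetry; apply: scale0r.
Qed.
Lemma cvertex_eq al be :
  (al == be) = (tag al == tag be) && (tagged al == tagged be :> nat).
Proof.
apply/eqP/andP => [->|[]]; first by rewrite !eqxx.
case: al be => [i p] [j q] /= /eqP ij.
by case: _ / ij q => q /eqP pq; congr (Tagged _ _); exact: val_inj.
Qed.
Lemma rS_1 : rS 1 =2 cone.
Proof. by move=> al be; rewrite /rS (scoef1 C d_gt0) /cone cvertex_eq. Qed.

Lemma cmul_linl N al be (V : lmodType C) (M : V -> cvertex -> cvertex -> P) :
  (forall ga, linear (fun v => M v al ga)) -> linear (fun v => cmul (M v) N al be).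
Proof.
move=> h; apply: lin_sumf => ga; exact: (lin_comp (pa_mulr_linear _) (h ga)).
Qed.
Lemma cmul_linr M al be (V : lmodType C) (N : V -> cvertex -> cvertex -> P) :
  (forall ga, linear (fun v => N v ga be)) -> linear (fun v => cmul M (N v) al be).
Proof.
move=> h; apply: lin_sumf => ga; exact: (lin_comp (pa_mull_linear _) (h ga)).
Qed.

Lemma rsand_bilin al be : bilin (rsand al be).
Proof.
split=> [y|x]; first by apply: cmul_linr => ga; exact: rS_linear.
by apply: cmul_linl => ga; apply: cmul_linl => de; exact: rS_linear.
Qed.

Lemma rD_linear al be : linear (fun f : Der => rD f al be).
Proof.
exact: (lin_comp (tlift_linear (rsand_bilin al be)) (@primitive_linear C k d)).
Qed.
Lemma rsand_tens al be x y : tlift (rsand al be) (tens x y) = rsand al be x y.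
Proof. exact: (tlift_tens (rsand_bilin al be)). Qed.
Lemma cornered_rD f : cornered (rD f).
Proof.
have h al be x y : vert C d (tag al) * rsand al be x y = rsand al be x y /\
    rsand al be x y * vert C d (tag be) = rsand al be x y.
  apply: cornered_mul (cornered_rS x) al be.
  exact: cornered_mul (cornered_rS y) cornered_gen.
move=> al be; rewrite /rD; split; move: (primitive f); apply: tlin_ext.
- exact: (lin_comp (pa_mull_linear _) (tlift_linear (rsand_bilin al be))).
- exact: (tlift_linear (rsand_bilin al be)).
- by move=> x y; rewrite rsand_tens (h _ _ _ _).1.
- exact: (lin_comp (pa_mulr_linear _) (tlift_linear (rsand_bilin al be))).
- exact: (tlift_linear (rsand_bilin al be)).
- by move=> x y; rewrite rsand_tens (h _ _ _ _).2.
Qed.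

Lemma primitive_l (s : S) (f : Der) : primitive (dderl s f) = innl s (primitive f).
Proof.
rewrite /primitive (lin_sum (innl_linear s)); apply: eq_bigr => i _.
rewrite (lin_sum (innl_linear s)); apply: eq_bigr => p _.
by rewrite innl_outl.
Qed.
Lemma primitive_r (s : S) (f : Der) : primitive (dderr f s) = innr s (primitive f).
Proof.
rewrite /primitive (lin_sum (innr_linear s)); apply: eq_bigr => i _.
rewrite (lin_sum (innr_linear s)); apply: eq_bigr => p _.
by rewrite innr_outl.
Qed.

Lemma rD_l (s : S) (f : Der) : rD (dderl s f) =2 cmul (rS s) (rD f).
Proof.
move=> al be; rewrite /rD primitive_l; move: (primitive f); apply: tlin_ext.
- exact: (lin_comp (tlift_linear (rsand_bilin al be)) (innl_linear s)).
- by apply: cmul_linr => ga; exact: (tlift_linear (rsand_bilin ga be)).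
move=> x y; apply: etrans (congr1 (tlift (rsand al be)) (innl_tens s x y)) _.
apply: etrans (rsand_tens _ _ _ _) _.
apply: etrans (eq_cmul (eq_cmul (rS_mul s y) (rrefl2 gen_mx)) (rrefl2 (rS x)) al be) _.
apply: etrans (eq_cmul (fun a b => esym (cmulA (rS s) (rS y) gen_mx a b)) (rrefl2 (rS x)) al be) _.
apply: etrans (esym (cmulA (rS s) (cmul (rS y) gen_mx) (rS x) al be)) _.
exact: (eq_cmul (rrefl2 (rS s)) (fun a b => esym (rsand_tens a b x y)) al be).
Qed.
Lemma rD_r (s : S) (f : Der) : rD (dderr f s) =2 cmul (rD f) (rS s).
Proof.
move=> al be; rewrite /rD primitive_r; move: (primitive f); apply: tlin_ext.
- exact: (lin_comp (tlift_linear (rsand_bilin al be)) (innr_linear s)).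
- by apply: cmul_linl => ga; exact: (tlift_linear (rsand_bilin al ga)).
move=> x y; apply: etrans (congr1 (tlift (rsand al be)) (innr_tens s x y)) _.
apply: etrans (rsand_tens _ _ _ _) _.
apply: etrans (eq_cmul (rrefl2 (cmul (rS y) gen_mx)) (rS_mul x s) al be) _.
apply: etrans (cmulA (cmul (rS y) gen_mx) (rS x) (rS s) al be) _.
exact: (eq_cmul (fun a b => esym (rsand_tens a b x y)) (rrefl2 (rS s)) al be).
Qed.

Definition rletter (l : dsletter C d) : cvertex -> cvertex -> P :=
  match l with inl s => rS s | inr f => rD f end.
Definition rword (w : seq (dsletter C d)) : cvertex -> cvertex -> P :=
  foldr (fun l => cmul (rletter l)) cone w.

Lemma cornered_rletter l : cornered (rletter l).
Proof. by case: l => [s|f]; [exact: cornered_rS | exact: cornered_rD]. Qed.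
Lemma cornered_rword w : cornered (rword w).
Proof.
elim: w => [|l w IH]; first exact: cornered_one.
exact: cornered_mul (cornered_rletter l) IH.
Qed.
Lemma rword_cat u v : rword (u ++ v) =2 cmul (rword u) (rword v).
Proof.
elim: u => [|l u IH] al be; first by rewrite cmul1 (cornered_rword _ _ _).1.
by rewrite -[RHS]cmulA; apply: eq_cmul.
Qed.
Lemma rword1 l : rword [:: l] =2 rletter l.
Proof. by move=> al be; rewrite [LHS]cmulr1 (cornered_rletter _ _ _).2. Qed.

Definition rfree (al be : cvertex) (x : dsfree C d) : P :=
  mext (fun w : fword (dsletter C d) => rword w al be) x.
Lemma rfree_linear al be : linear (rfree al be). Proof. exact: mext_linear. Qed.
Lemma rfree_word al be w : rfree al be (fbase C w) = rword w al be.
Proof. exact: mextU. Qed.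
Lemma rfree_fS s al be : rfree al be (fS s) = rS s al be.
Proof. exact: (etrans (rfree_word _ _ [:: inl s]) (rword1 (inl s) al be)). Qed.
Lemma rfree_fD f al be : rfree al be (fD f) = rD f al be.
Proof. exact: (etrans (rfree_word _ _ [:: inr f]) (rword1 (inr f) al be)). Qed.
Lemma rfree_1 al be : rfree al be 1 = cone al be.
Proof. exact: (rfree_word al be [::]). Qed.

Lemma rfreeM x y al be : rfree al be (x * y) = \sum_ga rfree al ga x * rfree ga be y.
Proof.
move: x; apply: falg_ext.
- exact: (lin_comp (rfree_linear al be) (falg_mulr_linear y)).
- apply: lin_sumf => ga; exact: (lin_comp (pa_mulr_linear _) (rfree_linear al ga)).
move=> u; move: y; apply: falg_ext.
- exact: (lin_comp (rfree_linear al be) (falg_mull_linear (fbase C u))).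
- apply: lin_sumf => ga; exact: (lin_comp (pa_mull_linear _) (rfree_linear ga be)).
move=> v; rewrite fbaseM rfree_word; apply: etrans (rword_cat u v al be) _.
by apply: eq_bigr => ga _; symmetry; exact: (congr2 *%R (rfree_word _ _ _) (rfree_word _ _ _)).
Qed.

(** [rS] is an algebra morphism with unit [cone], and [rD] is a bimodule morphism because
    [primitive] is one. *)
Lemma rfree_rel al be r : ds_rel r -> rfree al be r = 0.
Proof.
have fL := rfree_linear al be.
case=> [c s t||s t|c f g|s f|f t]; apply: etrans (lin_sub fL _ _) _;
  apply/eqP; rewrite subr_eq0; apply/eqP.
- apply: etrans (rfree_fS _ _ _) _; apply: etrans _ (esym (fL c _ _)).
  apply: etrans (rS_linear al be c s t) _.
  exact: (congr2 (fun u v => c *: u + v) (esym (rfree_fS s al be)) (esym (rfree_fS t al be))).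
- exact: (etrans (rfree_fS _ _ _) (etrans (rS_1 al be) (esym (rfree_1 _ _)))).
- apply: etrans (rfree_fS _ _ _) _; apply: etrans (rS_mul s t al be) _.
  apply: etrans _ (esym (rfreeM _ _ _ _)).
  by apply: eq_bigr => ga _; symmetry; exact: (congr2 *%R (rfree_fS _ _ _) (rfree_fS _ _ _)).
- apply: etrans (rfree_fD _ _ _) _; apply: etrans _ (esym (fL c _ _)).
  apply: etrans (rD_linear al be c f g) _.
  exact: (congr2 (fun u v => c *: u + v) (esym (rfree_fD f al be)) (esym (rfree_fD g al be))).
- apply: etrans (rfree_fD _ _ _) _; apply: etrans (rD_l s f al be) _.
  apply: etrans _ (esym (rfreeM _ _ _ _)).
  by apply: eq_bigr => ga _; symmetry; exact: (congr2 *%R (rfree_fS _ _ _) (rfree_fD _ _ _)).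
- apply: etrans (rfree_fD _ _ _) _; apply: etrans (rD_r t f al be) _.
  apply: etrans _ (esym (rfreeM _ _ _ _)).
  by apply: eq_bigr => ga _; symmetry; exact: (congr2 *%R (rfree_fD _ _ _) (rfree_fS _ _ _)).
Qed.

Lemma rfree_ideal al be x : ds_ideal x -> rfree al be x = 0.
Proof.
case=> a r b rr; rewrite rfreeM big1 // => ga _.
rewrite (_ : rfree al ga _ = 0) ?mul0r // rfreeM big1 // => de _.
by rewrite (rfree_rel _ _ rr) mulr0.
Qed.

Definition rho (al be : cvertex) : D -> P := qlift (rfree al be).
Lemma rho_linear al be : linear (rho al be).
Proof. exact: (qlift_linear (rfree_linear al be) (@rfree_ideal al be)). Qed.
Lemma rho_proj al be x : rho al be (dd_proj x) = rfree al be x.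
Proof. exact: (qliftE (rfree_linear al be) (@rfree_ideal al be)). Qed.
Lemma rhoM x y al be : rho al be (x * y) = \sum_ga rho al ga x * rho ga be y.
Proof.
elim/dd_ind: x => x; elim/dd_ind: y => y.
apply: etrans (congr1 (rho al be) (esym (dd_mulP x y))) _.
apply: etrans (rho_proj _ _ _) _; apply: etrans (rfreeM _ _ _ _) _.
by apply: eq_bigr => ga _; symmetry; exact: (congr2 *%R (rho_proj _ _ _) (rho_proj _ _ _)).
Qed.
Lemma rho_1 al be : rho al be 1 = cone al be.
Proof. by rewrite -dd_proj1 rho_proj rfree_1. Qed.
Lemma rho_iS s al be : rho al be (iS s) = rS s al be.
Proof. by rewrite unlock rho_proj rfree_fS. Qed.
Lemma rho_iD f al be : rho al be (iD f) = rD f al be.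
Proof. by rewrite unlock rho_proj rfree_fD. Qed.

End Representation.

Lemma sum_sandwich (R : pzRingType) (T : finType) (F : T -> R) (x y : R) :
  \sum_t x * F t * y = x * (\sum_t F t) * y.
Proof. by rewrite mulr_sumr mulr_suml. Qed.
Lemma mulr_regroup (R : pzRingType) (a l r r' w b : R) :
  a * l * r * (r' * w * b) = a * l * (r * r') * (w * b).
Proof. by rewrite !mulrA. Qed.
Lemma mulr_regroup4 (R : pzRingType) (a l w b : R) : a * l * (w * b) = a * (l * w) * b.
Proof. by rewrite !mulrA. Qed.

Section RhoGenerators.
Variables (C : fieldType) (k : nat) (d : 'I_k -> nat).
Hypothesis d_gt0 : forall i, (0 < d i)%N.
Local Notation P := (pathalg C d).
Local Notation S := (ssalg C d).
Local Notation D := (DD C d).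
Local Notation E := (gE C d).
Local Notation pah := (@pa_homog C k d).
Local Notation cvertex := (cvertex d).
Implicit Types (al be ga de : cvertex) (M N : cvertex -> cvertex -> P).

Definition cv0 (i : 'I_k) : cvertex := Tagged (fun i => 'I_(d i)) (Ordinal (d_gt0 i)).

Lemma scoef_eL de al be :
  scoef (eLc C de) (tagged al) (tagged be) = ((al == cv0 (tag de)) && (be == de))%:R.
Proof.
move: al be de => [i p] [l c] [j q]; rewrite !cvertex_eq /eLc /scoef /=.
under eq_bigr do rewrite eLE.
have [il|il] := eqVneq i l; last first.
  rewrite big1 => [|r _]; last by rewrite mulr0.
  have [ij|] := eqVneq i j; last by rewrite ?andbF.
  have lj : (l == j) = false by rewrite -ij eq_sym (negbTE il).
  by rewrite lj ?andbF.
case: _ / il c => c; rewrite (bigD1 c) //= big1 => [|r rc]; last first.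
  by move: rc; rewrite -(inj_eq val_inj) /= => /negbTE ->; rewrite mulr0.
by rewrite eqxx mulr1 addr0 eqSS; case: (i == j) => //=; case: (_ == _).
Qed.

Lemma scoef_eR de al be :
  scoef (eRc C de) (tagged al) (tagged be) = ((al == de) && (be == cv0 (tag de)))%:R.
Proof.
move: al be de => [i p] [l c] [j q]; rewrite !cvertex_eq /eRc /scoef /=.
under eq_bigr do rewrite eRE.
have [il|il] := eqVneq i l; last first.
  rewrite big1 => [|r _]; last by rewrite mulr0.
  have [ij|] := eqVneq i j; last by rewrite ?andbF.
  have lj : (l == j) = false by rewrite -ij eq_sym (negbTE il).
  by rewrite lj ?andbF.
case: _ / il c => c; rewrite (bigD1 c) //= big1 => [|r rc]; last first.
  by move: rc; rewrite -(inj_eq val_inj) /= => /negbTE ->; rewrite mulr0.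
rewrite eqxx mulr1 addr0 eqSS; case: (i == j) => //=.
by rewrite andbC.
Qed.

Lemma sum_if (F : cvertex -> P) ga : \sum_x (if x == ga then F x else 0) = F ga.
Proof. by rewrite -big_mkcond big_pred1_eq. Qed.

Lemma cmul_eL ga M al be : cornered M ->
  cmul (rS (eLc C ga)) M al be = if al == cv0 (tag ga) then M ga be else 0.
Proof.
move=> hM; apply: etrans (sum_if (fun x => if al == cv0 (tag ga) then M x be else 0) ga).
apply: eq_bigr => x _; rewrite /rS scoef_eL.
have [alE|ne] := eqVneq al (cv0 (tag ga)); last by rewrite scale0r mul0r if_same.
have [xE|ne] := eqVneq x ga; last by rewrite scale0r mul0r.
by rewrite scale1r alE xE (hM ga be).1.
Qed.

Lemma cmul_eR de M al be : cornered M ->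
  cmul M (rS (eRc C de)) al be = if be == cv0 (tag de) then M al de else 0.
Proof.
move=> hM; apply: etrans (sum_if (fun x => if be == cv0 (tag de) then M al x else 0) de).
apply: eq_bigr => x _; rewrite /rS scoef_eR.
have [xE|ne] := eqVneq x de; last by rewrite scale0r mulr0.
have [bE|ne] := eqVneq be (cv0 (tag de)); last by rewrite scale0r mulr0.
by rewrite scale1r xE (hM al de).2.
Qed.

Lemma cmul_eLR ga de M al be : cornered M ->
  cmul (cmul (rS (eLc C ga)) M) (rS (eRc C de)) al be =
  if (al == cv0 (tag ga)) && (be == cv0 (tag de)) then M ga de else 0.
Proof.
move=> hM; apply: etrans (cmul_eR _ _ _ (cornered_mul (cornered_rS _) hM)) _.
rewrite (cmul_eL ga al de hM) andbC if_and; reflexivity.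
Qed.

Lemma primitive_gauge : primitive (gauge C d) =
  tens (1 : S) (1 : S) - \sum_ga tens (eRc C ga) (eLc C ga).
Proof.
rewrite -(sum_cvertex (fun i (p : 'I_(d i)) => tens (eR C d i p.+1) (eL C d i p.+1))).
have {1}-> : (1 : S) = \sum_(i < k) \sum_(p < d i) eR C d i p.+1 * eL C d i p.+1.
  by rewrite sum_eRL.
rewrite tens_suml -sumrB; apply: eq_bigr => i _; rewrite tens_suml -sumrB.
apply: eq_bigr => p _; rewrite gaugeE (lin_sub (outl_linear _)) !outl_tens.
by rewrite mulr1.
Qed.

(** The primitive of E is 1 (x) 1 minus the separability idempotent. The second part contributes
    sums of diagonal entries of [gen_mx], which vanish by [sum_conn]. *)
Lemma rho_gE al be : rho al be E = gen_mx C al be.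
Proof.
have tL := tlift_linear (rsand_bilin C al be).
rewrite rho_iD // /rD primitive_gauge.
apply: etrans (lin_sub tL _ _) _.
have e1 : tlift (rsand al be) (tens (1 : S) (1 : S)) = gen_mx C al be.
  apply: etrans (rsand_tens _ _ _ _) _.
  apply: etrans (eq_cmul (eq_cmul (rS_1 C d_gt0) (fun a b => erefl (gen_mx C a b)))
    (rS_1 C d_gt0) al be) _.
  rewrite cmulr1 cmul1 (cornered_gen C al be).1; exact: (cornered_gen C al be).2.
have e2 : tlift (rsand al be) (\sum_ga tens (eRc C ga) (eLc C ga)) = 0.
  rewrite (lin_sum tL).
  transitivity (\sum_(ga : cvertex)
    if (al == cv0 (tag ga)) && (be == cv0 (tag ga)) then gen_mx C ga ga else 0).
    apply: eq_bigr => ga _; apply: etrans (rsand_tens _ _ _ _) _.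
    exact: (cmul_eLR _ _ _ _ (@cornered_gen C k d)).
  apply: etrans (esym (sum_cvertex (fun i (p : 'I_(d i)) =>
    if (al == cv0 i) && (be == cv0 i) then conn C d i i p.+1 p.+1 else 0))) _.
  apply: big1 => i _; case: (_ && _); last by rewrite big1.
  exact: sum_conn.
rewrite e1 e2 subr0; reflexivity.
Qed.

Lemma rho_homog n x al be : dd_homog n x -> pah n (rho al be x).
Proof.
move=> /homog_wspan; apply: span_map; first exact: rho_linear.
move=> _ [w <- ->]; elim: w al be => [|l w IH] al be.
  rewrite wval_nil rho_1 //; apply: spanZ; exact: pa_homog_vert.
rewrite wval_cons rhoM //; apply: span_sum => ga _; apply: pa_homogM (IH _ _).
case: l => [s|] /=; last by rewrite rho_gE; exact: pa_homog_conn.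
by rewrite rho_iS //; apply: spanZ; exact: pa_homog_vert.
Qed.

(** The element of the corner e DD e that represents the arrow j -> i with colours (p, q), with e
    the sum of the [ev i]. *)
Definition yconn (j i : 'I_k) (p q : nat) : D :=
  iS (eL C d j q) * E * iS (eR C d i p).
Definition yarr (a : arrow d) : D := yconn (tail a) (head a) (prim a) (sec a).
Definition ev (i : 'I_k) : D := iS (eL C d i 1).
Definition ypath (p : qpath d) : D := ev (qsource p) * \prod_(a <- qarrows p) yarr a.

Let iSL : linear (@iS C k d). Proof. exact: iS_linear. Qed.

Lemma ev_ev i j : ev i * ev j = (i == j)%:R *: ev j.
Proof. by rewrite /ev -iSM e11_e11 // (lin_scale iSL). Qed.
Lemma ev_yconn l j i p q : (0 < q <= d j)%N ->
  ev l * yconn j i p q = (l == j)%:R *: yconn j i p q.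
Proof.
by move=> hq; rewrite /ev /yconn !mulrA -iSM e11_eL // (lin_scale iSL) -!dd_scaleAl.
Qed.
Lemma yconn_ev l j i p q : (0 < p <= d i)%N ->
  yconn j i p q * ev l = (l == i)%:R *: yconn j i p q.
Proof.
by move=> hq; rewrite /ev /yconn -!mulrA -iSM eR_e11 // (lin_scale iSL) -!dd_scaleAr.
Qed.
Lemma ev_yarr l a : ev l * yarr a = (l == tail a)%:R *: yarr a.
Proof. by have [h1 h2 _] := arrowP a; exact: ev_yconn. Qed.
Lemma yarr_ev l a : yarr a * ev l = (l == head a)%:R *: yarr a.
Proof. by have [h1 h2 _] := arrowP a; exact: yconn_ev. Qed.

Lemma ypath_ev p l : ypath p * ev l = (l == qtarget p)%:R *: ypath p.
Proof.
rewrite /ypath /qtarget; elim/last_ind: (qarrows p) => [|s a _].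
  rewrite big_nil mulr1 ev_ev /= eq_sym; move: (qsource p) => i.
  have [->|_] := eqVneq l i; first by [].
  by apply: etrans (scale0r _) (esym (scale0r _)).
rewrite -cats1 big_cat big_seq1 /= map_cat last_cat /=.
move: (ev _) (\prod_(b <- s) _) => x y; rewrite -[LHS]mulrA -[_ * ev l]mulrA yarr_ev.
by rewrite -!dd_scaleAr.
Qed.

Lemma ypath_cat p q : ypath p * ypath q =
  if qcat p q is Some r then ypath r else 0.
Proof.
rewrite {2}/ypath mulrA ypath_ev eq_sym -dd_scaleAl.
case: (qtarget p =P qsource q) => [pq|npq]; last by rewrite qcat_none // scale0r.
have [r rE] := qcat_def pq; rewrite rE scale1r; have /qcatP[_ rs _ ra] := rE.
by rewrite /ypath rs ra big_cat mulrA.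
Qed.

(** Multiplicative by [psiM], but [psi 1] is the idempotent e, the sum of the [ev i], rather than
    1. *)
Definition psi (x : P) : D := mext ypath x.
Lemma psi_linear : linear psi. Proof. exact: mext_linear. Qed.
Lemma psi_pbase p : psi (pbase C p) = ypath p.
Proof. by rewrite /psi unlock mextU. Qed.
Lemma psi_obase o : psi (obase C o) = if o is Some r then ypath r else 0.
Proof. by case: o => [r|]; [exact: psi_pbase | exact: (lin_0 psi_linear)]. Qed.

Lemma psiM x y : psi (x * y) = psi x * psi y.
Proof.
move: x; apply: pa_ext.
- exact: (lin_comp psi_linear (pa_mulr_linear y)).
- exact: (lin_comp (dd_mulr_linear (psi y)) psi_linear).
move=> p; move: y; apply: pa_ext.
- exact: (lin_comp psi_linear (pa_mull_linear (pbase C p))).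
- exact: (lin_comp (dd_mull_linear (psi (pbase C p))) psi_linear).
move=> q; apply: etrans (congr1 psi (pbaseM C p q)) _.
apply: etrans (psi_obase _) _; apply: etrans (esym (ypath_cat p q)) _.
exact: (congr2 *%R (esym (psi_pbase p)) (esym (psi_pbase q))).
Qed.

Lemma psi_vert i : psi (vert C d i) = ev i.
Proof. by rewrite /vert psi_pbase /ypath big_nil mulr1. Qed.
Lemma psi_arr a : psi (arr C a) = yarr a.
Proof.
by rewrite /arr psi_pbase /ypath /qsource /qarrows /= big_seq1 ev_yarr eqxx scale1r.
Qed.

Lemma psi_arr_at i j p q : (0 < p <= d i)%N -> (0 < q <= d j)%N ->
  ~~ [&& i == j, p == 1%N & q == 1%N] -> psi (arr_at C d i j p q) = yconn j i p q.
Proof.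
move=> hp hq hn; rewrite /arr_at; case: insubP => [a _ aE|]; last by rewrite /= hp hq hn.
by rewrite psi_arr /yarr /tail /head /prim /sec; rewrite /= in aE; rewrite aE.
Qed.

(** For a loop of bi-colour (1, 1), [gauge_rel] writes e_(1 1) E e_(1 1) as minus the sum of the
    other diagonal terms, as [conn] prescribes. *)
Lemma psi_conn i j p q : (0 < p <= d i)%N -> (0 < q <= d j)%N ->
  psi (conn C d j i p q) = yconn j i p q.
Proof.
move=> hp hq; rewrite /conn; case: ifP => [|/negbT hn]; last exact: psi_arr_at.
case/and3P=> /eqP <- /eqP -> /eqP ->; rewrite (lin_opp psi_linear) (lin_sum psi_linear).
apply/eqP; rewrite eq_sym -addr_eq0; apply/eqP.
apply: etrans _ (gauge_rel C d i); symmetry.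
rewrite -(big_mkord xpredT (fun r => yconn i i r.+1 r.+1)) big_ltn; last exact: d_gt0.
apply: (congr1 (+%R _)); symmetry; rewrite (big_addn 1 (d i).+1 1) subn1 /=.
rewrite big_nat [RHS]big_nat; apply: eq_bigr => r /andP[r1 rd]; rewrite addn1.
have hr : (0 < r.+1 <= d i)%N by [].
by apply: psi_arr_at; rewrite // eqSS (gtn_eqF r1) !andbF.
Qed.

Lemma psi_homog n x : pah n x -> dd_homog n (psi x).
Proof.
apply: span_map; first exact: psi_linear.
move=> _ [p <- ->]; rewrite psi_pbase /ypath -[size _]add0n; apply: homogM.
  exact: homog_iS.
elim: (qarrows p) => [|a s IH]; first by rewrite big_nil; exact: homog_1.
rewrite big_cons /= -add1n; apply: homogM => //.
rewrite -[1%N]addn0; apply: homogM; last exact: homog_iS.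
rewrite -[1%N]add0n; apply: homogM; [exact: homog_iS | exact: homog_gE].
Qed.

Lemma sum_eRLc : \sum_(ga : cvertex) iS (eRc C ga) * iS (eLc C ga) = 1 :> D.
Proof.
rewrite -iS1 -(sum_eRL C d) (sum_cvertex (fun i (p : 'I_(d i)) => eR C d i p.+1 * eL C d i p.+1)).
by rewrite (lin_sum iSL); apply: eq_bigr => ga _; rewrite -iSM.
Qed.

Lemma psi_gen_mx al be : psi (gen_mx C al be) = iS (eLc C al) * E * iS (eRc C be).
Proof. by apply: psi_conn; exact: ltn_ord. Qed.
Lemma psi_rS s al be : psi (rS s al be) = iS (eLc C al) * iS s * iS (eRc C be).
Proof.
rewrite /rS (lin_scale psi_linear) psi_vert /ev -(lin_scale iSL) -!iSM.
congr iS; symmetry; exact: eLsR.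
Qed.

(** Induction on words: the sum over intermediate coloured vertices inserts the resolution of 1
    between two letters. *)
Lemma psi_rho x al be : psi (rho al be x) = iS (eLc C al) * x * iS (eRc C be).
Proof.
move: x; apply: word_ext.
- exact: (lin_comp psi_linear (@rho_linear C k d d_gt0 al be)).
- exact: (lin_comp (dd_mulr_linear _) (dd_mull_linear _)).
move=> w; elim: w al be => [|l w IH] al be.
  rewrite wval_nil rho_1 // -(rS_1 C d_gt0) psi_rS iS1; reflexivity.
rewrite wval_cons rhoM // (lin_sum psi_linear).
have e ga : psi (rho al ga (lval l)) = iS (eLc C al) * lval l * iS (eRc C ga).
  case: l => [s|] /=; first by rewrite rho_iS // psi_rS.
  by rewrite rho_gE psi_gen_mx.
transitivity (iS (eLc C al) * lval l * (\sum_(ga : cvertex) iS (eRc C ga) * iS (eLc C ga))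
   * (wval w * iS (eRc C be))).
  apply: etrans _ (sum_sandwich _ _ _); apply: eq_bigr => ga _.
  apply: etrans (psiM _ _) _; apply: etrans (congr2 *%R (e ga) (IH ga be)) _.
  exact: mulr_regroup.
rewrite sum_eRLc mulr1; exact: mulr_regroup4.
Qed.
End RhoGenerators.

(** * The isomorphism of the cyclic quotients *)

Section CyclicIso.
Variables (C : fieldType) (k : nat) (d : 'I_k -> nat).
Hypothesis d_gt0 : forall i, (0 < d i)%N.
Local Notation P := (pathalg C d).
Local Notation D := (DD C d).
Local Notation pah := (@pa_homog C k d).
Local Notation cvertex := (cvertex d).
Local Notation prD := (@DDcyc_proj C k d).
Local Notation prP := (@CQcyc_proj C k d).
Local Notation cv0 := (cv0 d_gt0).
Implicit Types (al be ga : cvertex).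

Lemma CQcyc_proj_linear : linear prP. Proof. exact: cyc_proj_linear. Qed.
Let prPL : linear prP. Proof. exact: CQcyc_proj_linear. Qed.
Let prDL : linear prD. Proof. exact: DDcyc_proj_linear. Qed.
Lemma CQcyc_comm m n a b : pah m a -> pah n b ->
  prP (a * b) = (-1) ^+ (m * n) *: prP (b * a).
Proof. exact: cyc_comm. Qed.

Definition trho (x : D) : P := \sum_(al : cvertex) rho al al x.
Lemma trho_linear : linear trho.
Proof. by apply: lin_sumf => al; exact: rho_linear. Qed.

Lemma trho_comm m n x y : dd_homog m x -> dd_homog n y ->
  prP (trho (x * y)) = (-1) ^+ (m * n) *: prP (trho (y * x)).
Proof.
move=> hx hy.
have e u v : prP (trho (u * v)) = \sum_al \sum_ga prP (rho al ga u * rho ga al v).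
  rewrite /trho (lin_sum prPL); apply: eq_bigr => al _.
  by apply: etrans (congr1 prP (rhoM d_gt0 u v al al)) _; exact: (lin_sum prPL).
apply: etrans (e x y) _; apply: etrans _ (esym (congr1 _ (e y x))).
apply: etrans (exchange_big _ _ _ _ _ _) _ => /=.
rewrite scaler_sumr; apply: eq_bigr => ga _; rewrite scaler_sumr; apply: eq_bigr => al _.
by apply: CQcyc_comm; apply: rho_homog.
Qed.

Lemma phi_comm (x : D) : supercomm (@GRing.mul D) (@dd_homog C k d) x -> prP (trho x) = 0.
Proof.
case=> m n a b ha hb; have L := lin_comp prPL trho_linear.
apply: etrans (lin_sub L _ _) _; apply/eqP; rewrite subr_eq0; apply/eqP.
apply: etrans (trho_comm ha hb) _; symmetry; exact: (lin_scale L).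
Qed.

Definition cyc_phi : DDcyc C d -> CQcyc C d := qlift (fun x => prP (trho x)).
Lemma cyc_phi_linear : linear cyc_phi.
Proof. exact: (qlift_linear (lin_comp prPL trho_linear) phi_comm). Qed.
Lemma cyc_phiE x : cyc_phi (prD x) = prP (trho x).
Proof. exact: (qliftE (lin_comp prPL trho_linear) phi_comm). Qed.

Lemma psi_comm (x : P) : supercomm (@GRing.mul P) pah x -> prD (psi x) = 0.
Proof.
case=> m n a b ha hb; have L := lin_comp prDL (@psi_linear C k d).
apply: etrans (lin_sub L _ _) _; apply/eqP; rewrite subr_eq0; apply/eqP.
apply: etrans (congr1 prD (psiM d_gt0 a b)) _.
apply: etrans (DDcyc_comm (psi_homog ha) (psi_homog hb)) _.
apply: etrans (congr1 _ (congr1 prD (esym (psiM d_gt0 b a)))) _.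
symmetry; exact: (lin_scale L).
Qed.

Definition cyc_psi : CQcyc C d -> DDcyc C d := qlift (fun x => prD (psi x)).
Lemma cyc_psi_linear : linear cyc_psi.
Proof. exact: (qlift_linear (lin_comp prDL (@psi_linear C k d)) psi_comm). Qed.
Lemma cyc_psiE x : cyc_psi (prP x) = prD (psi x).
Proof. exact: (qliftE (lin_comp prDL (@psi_linear C k d)) psi_comm). Qed.

Lemma DDcyc_comm0 s x : prD (iS s * x) = prD (x * iS s).
Proof.
move: x; apply: homog_ext.
- exact: (lin_comp prDL (dd_mull_linear _)).
- exact: (lin_comp prDL (dd_mulr_linear _)).
by move=> n x hx; rewrite (DDcyc_comm (homog_iS s) hx) mul0n scale1r.
Qed.

(** By [psi_rho] the trace yields the sum of e_(1 c) x e_(c 1) over coloured vertices c. Rotated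
    cyclically, this is x times the resolution of 1. *)
Lemma cyc_phiK : cancel cyc_phi cyc_psi.
Proof.
elim/cyc_ind => x; rewrite cyc_phiE cyc_psiE /trho (lin_sum (@psi_linear C k d)).
rewrite (lin_sum prDL).
transitivity (prD (x * \sum_(ga : cvertex) iS (eRc C ga) * iS (eLc C ga))).
  rewrite mulr_sumr (lin_sum prDL); apply: eq_bigr => ga _.
  apply: etrans (congr1 prD (psi_rho d_gt0 x ga ga)) _.
  apply: etrans (congr1 prD (esym (mulrA _ _ _))) _; apply: etrans (DDcyc_comm0 _ _) _.
  exact: (congr1 prD (esym (mulrA _ _ _))).
rewrite sum_eRLc mulr1; reflexivity.
Qed.

Lemma eL_cv0 i : eL C d i 1 = eLc C (cv0 i). Proof. by []. Qed.

Lemma rho_ev i al be :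
  rho al be (ev C d i) = if (al == cv0 i) && (be == cv0 i) then vert C d i else 0.
Proof.
rewrite /ev rho_iS // eL_cv0 /rS (scoef_eL C d_gt0).
by case: andP => [[/eqP-> _]|_]; rewrite ?scale1r ?scale0r.
Qed.

Lemma rho_yarr a al be : rho al be (yarr C a) =
  if (al == cv0 (tail a)) && (be == cv0 (head a)) then arr C a else 0.
Proof.
have [/colour_ord[p pE] /colour_ord[q qE] _] := arrowP a.
pose ga : cvertex := Tagged (fun i => 'I_(d i)) q.
pose de : cvertex := Tagged (fun i => 'I_(d i)) p.
have -> : yarr C a = iS (eLc C ga) * gE C d * iS (eRc C de).
  by rewrite /yarr /yconn pE qE.
rewrite rhoM //.
transitivity (cmul (cmul (rS (eLc C ga)) (@gen_mx C k d)) (rS (eRc C de)) al be).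
  apply: eq_bigr => b _; apply: congr2 (rho_iS d_gt0 _ _ _).
  apply: etrans (rhoM d_gt0 _ _ _ _) _; apply: eq_bigr => c _.
  exact: (congr2 *%R (rho_iS d_gt0 _ _ _) (rho_gE C d_gt0 _ _)).
apply: etrans (cmul_eLR d_gt0 _ _ _ _ (@cornered_gen C k d)) _.
have -> : gen_mx C ga de = arr C a by rewrite -connE /gen_mx /= pE qE.
by [].
Qed.

Lemma pbase_prod (i : 'I_k) (s : seq (arrow d)) (h : composable i s) :
  pbase C (@QPath k d (i, s) h) = vert C d i * \prod_(a <- s) arr C a.
Proof.
elim/last_ind: s h => [|s a IH] h.
  by rewrite big_nil mulr1 /vert; congr (pbase C _); exact: val_inj.
have [hs ta] : composable i s /\ tail a = last i (map (@head k d) s).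
  by move: (h); rewrite /= -cats1 composable_cat => /andP[hs /andP[/eqP ta _]].
rewrite -[in RHS]cats1 big_cat big_seq1 /= mulrA -(IH hs) /arr pbaseM.
set q := qcat _ _; suff -> : q = Some (@QPath k d (i, rcons s a) h) by [].
by apply/qcatP; split; rewrite /qtarget /qsource /qarrows //= -?cats1 ?map_cat ?last_cat.
Qed.

(** The matrix of the image of a path under [psi] has the path itself as its only possible nonzero
    entry, at colour 1 of its two ends. *)
Lemma rho_path (i : 'I_k) (s : seq (arrow d)) al be : composable i s ->
  rho al be (ev C d i * \prod_(a <- s) yarr C a) =
  if (al == cv0 i) && (be == cv0 (last i (map (@head k d) s)))
  then vert C d i * \prod_(a <- s) arr C a else 0.
Proof.
elim/last_ind: s al be => [|s a IH] al be; first by rewrite !big_nil !mulr1 rho_ev.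
rewrite -cats1 composable_cat => /andP[hs /andP[/eqP ta _]].
rewrite !big_cat !big_seq1 /= [X in rho al be X]mulrA [vert C d i * _]mulrA map_cat last_cat /=.
apply: etrans (rhoM d_gt0 _ _ _ _) _.
transitivity (\sum_ga (if ga == cv0 (tail a) then (if (al == cv0 i) && (be == cv0 (head a))
    then vert C d i * \prod_(b <- s) arr C b * arr C a else 0) else 0)).
  apply: eq_bigr => ga _; apply: etrans (congr2 *%R (IH al ga hs) (rho_yarr a ga be)) _.
  rewrite -ta.
  case: (al == cv0 i); case: (ga == cv0 (tail a)); case: (be == cv0 (head a));
    by rewrite /= ?mul0r ?mulr0.
exact: (sum_if (fun=> _)).
Qed.

(** Moving the source idempotent cyclically to the end of the path gives 0. *)
Lemma prP_open p : qsource p != qtarget p -> prP (pbase C p) = 0.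
Proof.
move=> ne; have hp : pah (size (qarrows p)) (pbase C p) by apply: spanG; exists p.
have e1 : pbase C p = vert C d (qsource p) * pbase C p.
  by rewrite /vert pbaseM qcat1p eqxx.
rewrite e1 (CQcyc_comm (pa_homog_vert _ _ _) hp) /vert pbaseM qcatp1 eq_sym (negbTE ne).
by rewrite (lin_0 prPL) scaler0.
Qed.

(** By [rho_path] the trace returns a closed path unchanged and gives 0 on an open one, which is 0
    in the quotient as well. *)
Lemma cyc_psiK : cancel cyc_psi cyc_phi.
Proof.
elim/cyc_ind => x; rewrite cyc_psiE cyc_phiE; move: x; apply: pa_ext.
- exact: (lin_comp prPL (lin_comp trho_linear (@psi_linear C k d))).
- exact: prPL.
move=> p; rewrite psi_pbase.
have e al : rho al al (ypath C p) =
    if al == cv0 (qsource p) then (if qsource p == qtarget p then pbase C p else 0) else 0.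
  case: p => -[i s] h; rewrite /ypath [LHS](rho_path al al h) pbase_prod.
  rewrite /qtarget /qsource /qarrows /=.
  have [->|//] := eqVneq al (cv0 i); rewrite cvertex_eq /=.
  by rewrite eqxx andbT.
rewrite /trho (eq_bigr _ (fun al _ => e al)) (sum_if (fun=> _)).
case: eqP => // /eqP ne; rewrite (lin_0 prPL); symmetry; exact: prP_open.
Qed.

Lemma cyc_phi_bij : bijective cyc_phi.
Proof. exact: (Bijective cyc_phiK cyc_psiK). Qed.

Lemma CQcyc_degP z (x : CQcyc C d) : CQcyc_deg z x ->
  x = 0 \/ exists n a, [/\ z + 1 = n%:Z, pah n a & x = prP a].
Proof. exact: cyc_shiftP. Qed.
Lemma CQcyc_deg0 z : @CQcyc_deg C k d z 0.
Proof. by apply: cyc_shift0 => n; exact: span0. Qed.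

Lemma cyc_phi_deg z x : DDcyc_deg z x <-> CQcyc_deg z (cyc_phi x).
Proof.
split.
  case/DDcyc_degP=> [->|[n [a [zn ha ->]]]].
    by rewrite (lin_0 cyc_phi_linear); exact: CQcyc_deg0.
  rewrite cyc_phiE; apply: (cyc_shiftI _ zn).
  by apply: span_sum => al _; exact: rho_homog.
rewrite -{2}(cyc_phiK x); case/CQcyc_degP=> [->|[n [a [zn ha ->]]]].
  by rewrite (lin_0 cyc_psi_linear); exact: DDcyc_deg0.
by rewrite cyc_psiE; apply: (cyc_shiftI _ zn); exact: psi_homog.
Qed.
End CyclicIso.

(** * The necklace formula *)

Section CQGrading.
Variables (C : fieldType) (k : nat) (d : 'I_k -> nat).
Local Notation P := (pathalg C d).
Local Notation pah := (@pa_homog C k d).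
Local Notation prP := (@CQcyc_proj C k d).
Local Notation deg := (@CQcyc_deg C k d).
Local Notation scomm := (@supercomm C P (@GRing.mul P) pah).
Let prPL : linear prP. Proof. exact: CQcyc_proj_linear. Qed.

Lemma CQcyc_ind (Q : CQcyc C d -> Prop) : (forall a, Q (prP a)) -> forall x, Q x.
Proof. exact: cyc_ind. Qed.

(** Scaling by c n in degree n; it yields both the projections [CQpr] and the sign operator [CQpar]
    on the quotient. *)
Definition pa_diag (c : nat -> C) (x : P) : P :=
  mext (fun p : qpath d => c (size (qarrows p)) *: pbase C p) x.

Lemma pa_diag_linear c : linear (pa_diag c). Proof. exact: mext_linear. Qed.
Lemma pa_diag_homog c n x : pah n x -> pa_diag c x = c n *: x.
Proof.
apply: span_lin_ext; [exact: pa_diag_linear | exact: (lin_scalef _ (@lin_id _ _)) |].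
by move=> _ [p <- ->]; rewrite /pa_diag unlock mextU.
Qed.
Lemma pa_homog_span (x : P) : span (fun y => exists n, pah n y) x.
Proof.
apply: (@span_map _ _ _ (fun y => exists p, y = pbase C p) _ (fun y => y)) => //.
  by move=> _ [p ->]; apply: spanG; exists (size (qarrows p)); apply: spanG; exists p.
rewrite (mext_unique (@lin_id _ _) x) /mext; apply: span_sum => p _.
by apply: spanZ; apply: spanG; exists p; rewrite unlock.
Qed.
Lemma scomm_homog x : scomm x -> exists n, pah n x.
Proof.
case=> m n a b ha hb; exists (m + n)%N; apply: spanB; first exact: pa_homogM.
by apply: spanZ; rewrite addnC; exact: pa_homogM.
Qed.

Lemma pa_diag_comm c x : scomm x -> prP (pa_diag c x) = 0.
Proof.
move=> sx; have [n hx] := scomm_homog sx; rewrite (pa_diag_homog c hx) (lin_scale prPL).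
have -> : prP x = 0; last by rewrite scaler0.
by apply: qproj_0; exact: spanG.
Qed.

Definition CQdiag (c : nat -> C) : CQcyc C d -> CQcyc C d := qlift (fun x => prP (pa_diag c x)).
Lemma CQdiag_linear c : linear (CQdiag c).
Proof. exact: (qlift_linear (lin_comp prPL (pa_diag_linear c)) (@pa_diag_comm c)). Qed.
Lemma CQdiagE c x : CQdiag c (prP x) = prP (pa_diag c x).
Proof. exact: (qliftE (lin_comp prPL (pa_diag_linear c)) (@pa_diag_comm c)). Qed.
Lemma CQdiag_homog c n x : pah n x -> CQdiag c (prP x) = c n *: prP x.
Proof. by move=> hx; rewrite CQdiagE (pa_diag_homog c hx) (lin_scale prPL). Qed.

Definition CQpr (n : nat) : CQcyc C d -> CQcyc C d := CQdiag (fun m => (m == n)%:R).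
Lemma CQpr_linear n : linear (CQpr n). Proof. exact: CQdiag_linear. Qed.

Lemma CQpr_homog m n x : pah m x -> CQpr n (prP x) = (m == n)%:R *: prP x.
Proof. exact: CQdiag_homog. Qed.

Lemma CQcyc_deg_lin z c x y : deg z x -> deg z y -> deg z (c *: x + y).
Proof.
rewrite /CQcyc_deg /cyc_shift; case: (z + 1) => [n|_].
  move=> [a ha ->] [b hb ->]; exists (c *: a + b); first exact: span_lin.
  by rewrite -[cyc_proj _ _ a]/(prP a) -[cyc_proj _ _ b]/(prP b) -prPL.
by move=> -> ->; rewrite scaler0 addr0.
Qed.

Lemma CQpr_deg z n x : deg z x -> CQpr n x = if z + 1 == n%:Z then x else 0.
Proof.
case/CQcyc_degP=> [->|[m [a [-> ha ->]]]]; first by rewrite (lin_0 (CQpr_linear n)) if_same.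
rewrite (CQpr_homog _ ha) eqz_nat; case: (m == n); first exact: scale1r.
exact: scale0r.
Qed.

Lemma CQpr_in n x : deg (n%:Z - 1) (CQpr n x).
Proof.
elim/CQcyc_ind: x => x; move: x; have L := lin_comp (CQpr_linear n) prPL.
suff h x : span (fun y => exists m, pah m y) x -> deg (n%:Z - 1) (CQpr n (prP x)).
  by move=> x; apply: h; exact: pa_homog_span.
elim=> [|{}x [m hx]|{}x y _ hx _ hy|c {}x _ hx].
- by rewrite (lin_0 L); exact: CQcyc_deg0.
- rewrite (CQpr_homog _ hx); case: eqP => [mn|_]; last by rewrite scale0r; exact: CQcyc_deg0.
  by rewrite scale1r; apply: (cyc_shiftI _ _ hx); rewrite mn subrK.
- by rewrite (lin_add L) -[CQpr n (prP x)]scale1r; exact: CQcyc_deg_lin.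
- rewrite (lin_scale L) -[_ *: _]addr0; apply: CQcyc_deg_lin hx (CQcyc_deg0 _ _ _).
Qed.

Lemma CQpr_sum x : exists N, forall M, (N <= M)%N -> x = \sum_(n < M) CQpr n x.
Proof.
elim/CQcyc_ind: x => x; move: (pa_homog_span x).
elim=> [|{}x [m hx]|{}x y _ [N hx] _ [N' hy]|c {}x _ [N hx]].
- exists 0%N => M _; rewrite (lin_0 prPL) big1 // => n _; exact: (lin_0 (CQpr_linear n)).
- exists m.+1 => M mM; rewrite (bigD1 (Ordinal mM)) //= big1 => [|n nm].
    by rewrite addr0 (CQpr_homog _ hx) eqxx scale1r.
  rewrite (CQpr_homog _ hx) (_ : (m == n) = false) ?scale0r //.
  by apply/negbTE; move: nm; rewrite -(inj_eq val_inj) eq_sym.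
- exists (maxn N N') => M; rewrite geq_max => /andP[NM N'M].
  rewrite (lin_add prPL) {1}(hx M NM) {1}(hy M N'M) -big_split; apply: eq_bigr => n _.
  by rewrite (lin_add (CQpr_linear n)).
- exists N => M NM; rewrite (lin_scale prPL) {1}(hx M NM) scaler_sumr.
  by apply: eq_bigr => n _; rewrite (lin_scale (CQpr_linear n)).
Qed.

Lemma CQcyc_grading : grading deg.
Proof.
split.
- exact: CQcyc_deg_lin.
- move=> x; have [N hN] := CQpr_sum x.
  (* The component of shifted degree z is the projection to paths of length z + 1. *)
  exists [seq n%:Z - 1 | n <- index_iota 0 N], (fun z => if z + 1 is Posz n then CQpr n x else 0).
  split=> [z|].
    case zn: (z + 1) => [n|n]; last exact: CQcyc_deg0.
    have -> : z = n%:Z - 1 by rewrite -zn addrK.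
    exact: CQpr_in.
  rewrite big_map big_mkord; apply: etrans (hN N (leqnn N)) _.
  by apply: eq_bigr => n _; rewrite subrK.
move=> s f us fdeg sum0 z zs; have fz := fdeg z.
have [//|[n [a [zn _ _]]]] := CQcyc_degP fz.
have := congr1 (CQpr n) sum0; rewrite (lin_sum (CQpr_linear n)) (lin_0 (CQpr_linear n)).
rewrite (bigD1_seq z) //= (CQpr_deg n fz) zn eqxx big1 ?addr0 // => y yz.
rewrite (CQpr_deg n (fdeg y)) -zn (inj_eq (addIr 1)) (negbTE yz); reflexivity.
Qed.

(** The sign of the shifted degree n - 1, which has the parity of n + 1. *)
Definition CQpar : CQcyc C d -> CQcyc C d := CQdiag (fun n => (-1) ^+ n.+1).
Lemma CQpar_linear : linear CQpar. Proof. exact: CQdiag_linear. Qed.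
Lemma CQpar_deg z x : deg z x -> CQpar x = (-1) ^ z *: x.
Proof.
case/CQcyc_degP=> [->|[m [a [zm ha ->]]]]; first by rewrite (lin_0 CQpar_linear) scaler0.
by apply: etrans (CQdiag_homog _ ha) _; rewrite (signz_shift C zm).
Qed.
End CQGrading.

Section Transport.
Variables (C : fieldType) (L M : lmodType C).
Variables (degL : int -> L -> Prop) (degM : int -> M -> Prop).
Variables (phi : L -> M) (psi : M -> L).
Hypotheses (phiL : linear phi) (psiL : linear psi).
Hypotheses (phiK : cancel phi psi) (psiK : cancel psi phi).
Hypothesis phi_deg : forall z x, degL z x <-> degM z (phi x).

(** The grading is established on the quiver side, where degree projections come from path length,
    and is then carried to [DDcyc]. *)
Lemma grading_transport : grading degM -> grading degL.
Proof.
case=> h1 h2 h3; split.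
- by move=> z c x y /phi_deg hx /phi_deg hy; apply/phi_deg; rewrite phiL; exact: h1.
- move=> x; have [s [f [fdeg fE]]] := h2 (phi x); exists s, (fun z => psi (f z)).
  split=> [z|]; first by apply/phi_deg; rewrite psiK.
  by rewrite -(lin_sum psiL) -fE phiK.
move=> s f us fdeg sum0 z zs; apply: (can_inj phiK); rewrite (lin_0 phiL).
apply: (h3 s (fun z => phi (f z)) us _ _ z zs) => [y|]; first exact/phi_deg.
by rewrite -(lin_sum phiL) sum0 (lin_0 phiL).
Qed.

Lemma graded_lie_transport (br : L -> L -> L) : grading degM -> graded_lie degL br ->
  graded_lie degM (fun x y => phi (br (psi x) (psi y))).
Proof.
move=> gM [[_ [br1 br2]] bdeg banti bjac].
have psi_deg z x : degM z x -> degL z (psi x) by move=> h; apply/phi_deg; rewrite psiK.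
split.
- split=> //; split=> [w|v] c x y; first by rewrite psiL br1 phiL.
  by rewrite psiL br2 phiL.
- by move=> y z a b ha hb; apply/phi_deg; apply: bdeg; exact: psi_deg.
- move=> y z a b /psi_deg ha /psi_deg hb; rewrite (banti y z _ _ ha hb).
  by rewrite (lin_opp phiL) (lin_scale phiL).
move=> y z a b c /psi_deg ha /psi_deg hb; rewrite !phiK (bjac y z _ _ _ ha hb).
exact: (lin_addZ phiL).
Qed.
End Transport.

Lemma scaler_cancel3 (C : fieldType) (V : lmodType C) g h (a b z : V) :
  h *: (g *: (a - b)) = g *: ((h *: a + z) - (z + h *: b)).
Proof.
rewrite [z + _]addrC opprD addrACA subrr addr0 -scalerBr !scalerA.
by rewrite [h * g]mulrC.
Qed.
Lemma addr_cancel3 (V : zmodType) (x y z : V) : y - z = (x - z) + (y - x).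
Proof. by rewrite [RHS]addrC addrA subrK. Qed.

(** * Brackets of words through cyclic derivatives *)

Section WordFormula.
Variables (C : fieldType) (k : nat) (d : 'I_k -> nat).
Local Notation D := (DD C d).
Local Notation E := (gE C d).
Variables (br : D -> D -> D \ox D) (brP : double_schouten br).
Variables (sg : D \ox D -> D \ox D) (sgP : is_gswap sg).
Hypothesis brA : forall m n (a b : D), dd_homog m a -> dd_homog n b ->
  br a b = - ((-1) ^+ (m.+1 * n.+1) *: sg (br b a)).
Local Notation lb := (single_bracket br).
Local Notation proj := (@DDcyc_proj C k d).
Let prL : linear proj. Proof. exact: DDcyc_proj_linear. Qed.

Lemma cder_homogS (w : seq (letter C d)) : homogS (wdeg w) (cder w).
Proof.
rewrite /cder big_seq; elim/big_ind: _ => [|x y hx hy|p pw].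
- exact: homogS_0.
- by rewrite -[x]scale1r; exact: homogS_lin.
rewrite (cuts_deg pw) -[X in homogS _ X]addr0; apply: homogS_lin; last exact: homogS_0.
by rewrite addnC; apply: homogM; exact: homog_word.
Qed.

(* Up to an inner derivation, lb (wval a) is the derivation which vanishes   *)
(* on S and maps E to the commutator of E and cder a.                        *)
Definition ecomm (n : nat) (q : D) : D := q * E - (-1) ^+ n.+1 *: (E * q).

(** The value on w of the graded derivation that kills S and sends E to [ecomm n q]; q stands for an
    element of degree n - 1. *)
Definition subst (n : nat) (q : D) (w : seq (letter C d)) : D :=
  \sum_(p <- cuts w) (-1) ^+ (n.+1 * wdeg p.1) *: (wval p.1 * ecomm n q * wval p.2).

Definition inner (n : nat) (q : D) (w : seq (letter C d)) : D :=
  q * wval w - (-1) ^+ (n.+1 * wdeg w) *: (wval w * q).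

Lemma subst_iS n q s w : subst n q (Some s :: w) = iS s * subst n q w.
Proof.
rewrite /subst (big_cuts_cons (fun x y =>
  (-1) ^+ (n.+1 * wdeg x) *: (wval x * ecomm n q * wval y))) add0r mulr_sumr.
by apply: eq_bigr => p _; rewrite wval_cons -dd_scaleAr !mulrA.
Qed.
Lemma subst_gE n q w :
  subst n q (None :: w) = ecomm n q * wval w + (-1) ^+ n.+1 *: (E * subst n q w).
Proof.
rewrite /subst (big_cuts_cons (fun x y =>
  (-1) ^+ (n.+1 * wdeg x) *: (wval x * ecomm n q * wval y))).
rewrite muln0 scale1r wval_nil mul1r mulr_sumr scaler_sumr; apply: congr1.
apply: eq_bigr => p _; rewrite wval_cons -dd_scaleAr scalerA -exprD -mulnS !mulrA.
reflexivity.
Qed.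

Lemma inner_iS n q s w :
  inner n q (Some s :: w) = iS s * inner n q w + (q * iS s - iS s * q) * wval w.
Proof.
rewrite /inner wval_cons mulrBr mulrBl -dd_scaleAr -!mulrA.
exact: addr_cancel3.
Qed.
Lemma inner_gE n q w : inner n q (None :: w) =
  (-1) ^+ n.+1 *: (E * inner n q w) + ecomm n q * wval w.
Proof.
rewrite /inner /ecomm wval_cons mulrBr mulrBl -dd_scaleAr -dd_scaleAl -!mulrA.
rewrite scalerBr scalerA -exprD.
have -> : (n.+1 + n.+1 * wdeg w)%N = (n.+1 * wdeg (None :: w))%N by rewrite -mulnS.
exact: addr_cancel3.
Qed.

(** All terms obey the same graded Leibniz rule in b. On S only [inner] contributes, and it gives
    [lb_word_iS]; on E the two derivations agree, so their difference is 0, as [lbE] requires. *)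
Lemma lb_word_word (a b : seq (letter C d)) : lb (wval a) (wval b) =
  (-1) ^+ wdeg a *: (inner (wdeg a) (cder a) b - subst (wdeg a) (cder a) b).
Proof.
have ha : dd_homog (wdeg a) (wval a) := homog_word a.
elim: b => [|l w IH].
  rewrite wval_nil (lb_1 brP) /inner /subst big_nil wval_nil muln0 scale1r.
  by rewrite mul1r mulr1 subrr subr0 scaler0.
rewrite [wval (_ :: _)]wval_cons; case: l => [s|] /=.
  rewrite (lbM brP _ ha (homog_iS s)) muln0 scale1r IH (lb_word_iS brP sgP brA).
  rewrite subst_iS inner_iS; move: (inner _ _ _) (subst _ _ _) (wval w) => x y c.
  rewrite -dd_scaleAr -dd_scaleAl -scalerDr mulrBr addrAC; reflexivity.
rewrite (lbM brP _ ha (homog_gE C d)) muln1 (lbE brP sgP brA) mul0r addr0 IH.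
rewrite subst_gE inner_gE; move: (inner _ _ _) (subst _ _ _) (ecomm _ _ * _) => x y z.
rewrite -dd_scaleAr mulrBr; exact: scaler_cancel3.
Qed.

(** The values of [inner] are supercommutators with the cyclic derivative, which has degree one less
    than a. *)
Lemma proj_lb_word (a b : seq (letter C d)) : proj (lb (wval a) (wval b)) =
  - ((-1) ^+ wdeg a *: proj (subst (wdeg a) (cder a) b)).
Proof.
apply: etrans (congr1 proj (lb_word_word a b)) _.
apply: etrans (lin_scale prL _ _) _; rewrite -scalerN; apply: congr1.
apply: etrans (lin_sub prL _ _) _; have -> : proj (inner (wdeg a) (cder a) b) = 0.
  apply: etrans (lin_sub prL _ _) _; apply/eqP; rewrite subr_eq0; apply/eqP.
  apply: etrans (DDcyc_commS (cder_homogS a) (homog_word b)) _.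
  symmetry; exact: (lin_scale prL).
exact: sub0r.
Qed.
End WordFormula.

(** * Words of arrows and the terms A and B *)

Section Necklaces.
Variables (C : fieldType) (k : nat) (d : 'I_k -> nat).
Hypothesis d_gt0 : forall i, (0 < d i)%N.
Local Notation P := (pathalg C d).
Local Notation S := (ssalg C d).
Local Notation D := (DD C d).
Local Notation E := (gE C d).
Local Notation letter := (letter C d).
Local Notation pah := (@pa_homog C k d).
Local Notation prD := (@DDcyc_proj C k d).
Local Notation prP := (@CQcyc_proj C k d).
Implicit Types (u v s : seq (arrow d)) (a b : arrow d).

Definition tail_unit a : S := eL C d (tail a) (sec a).
Definition head_unit a : S := eR C d (head a) (prim a).
(** Spells the product of the elements that represent the arrows. Each arrow contributes exactly one
    E, so that cuts correspond to positions in s. *)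
Definition flat s : seq letter :=
  flatten [seq [:: Some (tail_unit a); None; Some (head_unit a)] | a <- s].
Definition yword s : D := \prod_(a <- s) yarr C a.

Lemma yword_cons a s : yword (a :: s) = yarr C a * yword s.
Proof. exact: big_cons. Qed.
Lemma yword_rcons a s : yword (rcons s a) = yword s * yarr C a.
Proof. by rewrite /yword -cats1 big_cat big_seq1. Qed.
Lemma yword_cat s s' : yword (s ++ s') = yword s * yword s'.
Proof. exact: big_cat. Qed.

Lemma wval_flat s : wval (flat s) = yword s.
Proof.
elim: s => [|a s IH]; first by rewrite wval_nil /yword big_nil.
rewrite yword_cons -IH /flat /= !wval_cons /yarr /yconn /tail_unit /head_unit /= -!mulrA; reflexivity.
Qed.
Lemma wdeg_flat s : wdeg (flat s) = size s.
Proof. by elim: s => //= a s IH; rewrite -[in RHS]IH. Qed.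

Lemma big_cuts_flat (U : nmodType) (F : seq letter -> seq letter -> U) s :
  \sum_(p <- cuts (flat s)) F p.1 p.2 =
  \sum_(i < size s) let a := tnth (in_tuple s) i in
    F (flat (take i s) ++ [:: Some (tail_unit a)]) (Some (head_unit a) :: flat (drop i.+1 s)).
Proof.
elim: s F => [|a s IH] F; first by rewrite big_nil big_ord0.
rewrite big_ord_recl.
rewrite (big_cuts_cons F (Some (tail_unit a))) add0r.
rewrite (big_cuts_cons (fun x y => F (Some (tail_unit a) :: x) y) None).
rewrite (big_cuts_cons (fun x y => F (Some (tail_unit a) :: None :: x) y) (Some (head_unit a))) add0r.
rewrite (IH (fun x y => F (Some (tail_unit a) :: None :: Some (head_unit a) :: x) y)).
apply: congr2; first by rewrite (tnth_nth a) /= drop0.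
by apply: eq_bigr => i _; rewrite /= !(tnth_nth a).
Qed.

Lemma psi1_psi (x : P) : psi (1 : P) * psi x = psi x.
Proof. exact: etrans (esym (psiM d_gt0 1 x)) (congr1 _ (mul1r x)). Qed.
Lemma psi_psi1 (x : P) : psi x * psi (1 : P) = psi x.
Proof. exact: etrans (esym (psiM d_gt0 x 1)) (congr1 _ (mulr1 x)). Qed.
Lemma psi1_yarr a : psi (1 : P) * yarr C a = yarr C a.
Proof. rewrite -(psi_arr C d_gt0); exact: psi1_psi. Qed.
Lemma yarr_psi1 a : yarr C a * psi (1 : P) = yarr C a.
Proof. rewrite -(psi_arr C d_gt0); exact: psi_psi1. Qed.
Lemma psi1_yconn i j p q : (0 < p <= d i)%N -> (0 < q <= d j)%N ->
  psi (1 : P) * yconn C d j i p q = yconn C d j i p q.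
Proof. move=> hp hq; rewrite -(psi_conn C d_gt0 hp hq); exact: psi1_psi. Qed.
Lemma yconn_psi1 i j p q : (0 < p <= d i)%N -> (0 < q <= d j)%N ->
  yconn C d j i p q * psi (1 : P) = yconn C d j i p q.
Proof. move=> hp hq; rewrite -(psi_conn C d_gt0 hp hq); exact: psi_psi1. Qed.

Lemma yword_psi1 s : yword s * psi (1 : P) = psi (1 : P) * yword s.
Proof.
elim: s => [|a s IH]; first by rewrite /yword big_nil mulr1 mul1r.
rewrite yword_cons -[LHS]mulrA IH [LHS]mulrA yarr_psi1 [RHS]mulrA psi1_yarr; reflexivity.
Qed.
(** The factor [psi 1] accounts for empty words, whose image is the idempotent e instead of 1. *)
Lemma psi_word s : psi (word C s) = psi (1 : P) * yword s.
Proof.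
elim: s => [|a s IH]; first by rewrite /word /yword !big_nil mulr1.
apply: etrans (congr1 _ (big_cons _ _ _ _ _ _)) _; apply: etrans (psiM d_gt0 _ _) _.
apply: etrans (congr2 *%R (psi_arr C d_gt0 a) IH) _; rewrite yword_cons.
rewrite [LHS]mulrA yarr_psi1 [RHS]mulrA psi1_yarr; reflexivity.
Qed.
Lemma psi_word_closed s : (0 < size s)%N -> psi (word C s) = yword s.
Proof. by case: s => // a s _; rewrite psi_word yword_cons mulrA psi1_yarr. Qed.

Lemma word_homog s : pah (size s) (word C s).
Proof.
elim: s => [|a s IH]; rewrite /word ?big_nil ?big_cons.
  by apply: span_sum => i _; exact: pa_homog_vert.
by rewrite /= -add1n; apply: pa_homogM => //; exact: pa_homog_arr.
Qed.

(** What remains of the cycle runs from the head of the removed arrow to its tail; this lets the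
    vertex idempotents from [inl_outr] be absorbed. *)
Lemma closed_path_open v (j : 'I_(size v)) (a := tnth (in_tuple v) j) :
  closed_path v ->
  path (fun a b => head a == tail b) a (rcons (drop j.+1 v ++ take j v) a).
Proof.
case/andP=> _; rewrite -(@rot_cycle j) /rot (drop_nth a) //.
by rewrite -(tnth_nth a (in_tuple v) j).
Qed.

Lemma ev_yword_yconn a s i p q (a' := a) :
  path (fun a b => head a == tail b) a (rcons s a) -> (0 < q <= d (tail a))%N ->
  ev C d (head a) * (yword s * yconn C d (tail a) i p q) = yword s * yconn C d (tail a) i p q.
Proof.
case: s => [|b s] /= /andP[/eqP ab _] hq.
  by rewrite /yword big_nil mul1r ab ev_yconn // eqxx scale1r.
have e : ev C d (head a) * yarr C b = yarr C b by rewrite ab ev_yarr // eqxx scale1r.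
rewrite yword_cons; move: (ev _ _ _) (yarr C b) (yword s) (yconn _ _ _ _ _ _) e => x y w z e.
by rewrite !mulrA e.
Qed.

Lemma yconn_yword_ev a s j p q :
  path (fun a b => head a == tail b) a (rcons s a) -> (0 < p <= d (head a))%N ->
  yconn C d j (head a) p q * yword s * ev C d (tail a) = yconn C d j (head a) p q * yword s.
Proof.
case/lastP: s => [|s b].
  move=> /= /andP[/eqP ab _] hp.
  by rewrite /yword big_nil mulr1 -ab yconn_ev // eqxx scale1r.
rewrite rcons_path last_rcons => /andP[_ /eqP ba] hp.
have e : yarr C b * ev C d (tail a) = yarr C b by rewrite -ba yarr_ev // eqxx scale1r.
rewrite yword_rcons; move: (ev _ _ _) (yarr C b) (yword s) (yconn _ _ _ _ _ _) e => x y w z e.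
by rewrite -!mulrA e.
Qed.
End Necklaces.

Lemma mulr_splitA (R : pzRingType) (t x w' b c x' w z g : R) :
  t * x * (w' * b * (c * x') * g) * (w * z) = t * (x * w' * (b * c * (x' * g * w))) * z.
Proof. by rewrite !mulrA. Qed.
Lemma mulr_splitB (R : pzRingType) (t x w' b c x' w z g : R) :
  t * x * (g * (w' * b * (c * x'))) * (w * z) = t * (x * g * w' * (b * c) * (x' * w)) * z.
Proof. by rewrite !mulrA. Qed.

Section Absorption.
Variables (R : pzRingType) (e a b c y z : R).
Hypotheses (ea : a * e = e * a) (eb : b * e = e * b) (ec : c * e = e * c).
Hypotheses (ey : e * y = y) (ye : y * e = y).

Let pull w x : w * e = w -> w * (e * x) = w * x.
Proof. by move=> we; rewrite mulrA we. Qed.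
Let pullK w x : w * e = w -> x * e = e * x -> w * x * e = w * x.
Proof. by move=> we xe; rewrite -mulrA xe pull. Qed.
Let push x t : x * e = e * x -> e * t = t -> e * (x * t) = x * t.
Proof. by move=> ex et; rewrite mulrA -ex -mulrA et. Qed.

(** Here e stands for [psi 1], y for the connecting arrow and the others for words: every copy of e
    moves to y and disappears there. *)
Lemma absorbA : e * a * (e * b) * (e * c) * y * (e * z) = a * (b * c * y) * z.
Proof.
rewrite -!mulrA (mulrA y) ye.
have e0 : e * (y * z) = y * z by rewrite mulrA ey.
have e1 := push ec e0; have e2 := push eb e1; have e3 := push ea e2.
by rewrite e1 e2 e3.
Qed.

Lemma absorbB : e * a * y * (e * b) * (e * c) * (e * z) = a * (y * (b * c)) * z.
Proof.
have e0 : e * a * y = a * y by rewrite -ea -mulrA ey.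
have e1 : a * y * e = a * y by rewrite -mulrA ye.
have e2 := pullK e1 eb; have e3 := pullK e2 ec.
by rewrite e0 (pull b e1) (pull c e2) (pull z e3) !mulrA.
Qed.
End Absorption.

Section NecklaceTerms.
Variables (C : fieldType) (k : nat) (d : 'I_k -> nat).
Hypothesis d_gt0 : forall i, (0 < d i)%N.
Local Notation P := (pathalg C d).
Local Notation S := (ssalg C d).
Local Notation D := (DD C d).
Local Notation E := (gE C d).
Implicit Types (u v s : seq (arrow d)) (a b : arrow d).
Local Notation tail_unit := (tail_unit C).
Local Notation head_unit := (head_unit C).
Local Notation yword := (yword C).

Let iSL : linear (@iS C k d). Proof. exact: iS_linear. Qed.
Let psiL : linear (@psi C k d). Proof. exact: psi_linear. Qed.

(** The matching condition on vertices and colours is the multiplication rule of the units e_(1 q)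
    and e_(p 1). *)
Lemma inl_outr a b : iS (tail_unit a) * iS (head_unit b) =
  ((tail a == head b) && (sec a == prim b))%:R *: ev C d (tail a).
Proof.
have [_ ha _] := arrowP a; have [hb _ _] := arrowP b.
by rewrite -iSM /tail_unit /head_unit (eL_eR _ ha hb) (lin_scale iSL).
Qed.

Let zero_termA (a x t z : D) : a * (0 *: x * t) * z = 0.
Proof. by rewrite scale0r mul0r mulr0 mul0r. Qed.
Let zero_termB (a x t z : D) : a * (t * (0 *: x)) * z = 0.
Proof. by rewrite scale0r !mulr0 mul0r. Qed.
Lemma psiM5 (p q r s t : P) :
  psi (p * q * r * s * t) = psi p * psi q * psi r * psi s * psi t.
Proof. by rewrite !(psiM d_gt0). Qed.

Lemma wval_flat_rcons s x : wval (flat C s ++ [:: Some x]) = yword s * iS x.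
Proof. by rewrite wval_cat wval_flat wval_cons wval_nil mulr1. Qed.
Lemma wval_flat_cons s x : wval (Some x :: flat C s) = iS x * yword s.
Proof. by rewrite wval_cons wval_flat. Qed.

Lemma ecomm_split n (t x w' b c x' w z : D) :
  t * x * ecomm n (w' * b * (c * x')) * (w * z) =
  t * (x * w' * (b * c * (x' * E * w))) * z
  - (-1) ^+ n.+1 *: (t * (x * E * w' * (b * c) * (x' * w)) * z).
Proof.
apply: etrans (congr1 ( *%R^~ (w * z)) (mulrBr (t * x) _ _)) _.
apply: etrans (mulrBl (w * z) _ _) _; apply: congr2; first exact: mulr_splitA.
apply: congr1; apply: etrans (congr1 ( *%R^~ (w * z)) (esym (dd_scaleAr _ _ _))) _.
apply: etrans (esym (dd_scaleAl _ _ _)) _; apply: congr1; exact: mulr_splitB.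
Qed.

Section Terms.
Variables (v u : seq (arrow d)) (i : 'I_(size u)) (j : 'I_(size v)).
Hypothesis vc : closed_path v.
Let ui := tnth (in_tuple u) i.
Let vj := tnth (in_tuple v) j.
Let L := drop j.+1 v ++ take j v.

Lemma psi_termA : psi (termA C i j) =
  yword (take i u) * (iS (tail_unit ui) * iS (head_unit vj) *
    (yword (drop j.+1 v) * yword (take j v) *
      yconn C d (tail vj) (head ui) (prim ui) (sec vj))) * yword (drop i.+1 u).
Proof.
have [hu _ _] := arrowP ui; have [_ hv _] := arrowP vj.
rewrite inl_outr /termA -/ui -/vj; case: andP => [[/eqP tu _]|_]; last first.
  exact: etrans (lin_0 psiL) (esym (zero_termA _ _ _ _)).
rewrite scale1r tu -(yword_cat C (drop _ _)).
rewrite (ev_yword_yconn C d_gt0 _ _ (closed_path_open j vc) hv) yword_cat.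
apply: etrans (psiM5 _ _ _ _ _) _; rewrite !(psi_word C d_gt0) (psi_conn C d_gt0 hu hv).
exact: (absorbA _ (yword_psi1 C d_gt0 _) (yword_psi1 C d_gt0 _) (yword_psi1 C d_gt0 _)
  (psi1_yconn C d_gt0 hu hv) (yconn_psi1 C d_gt0 hu hv)).
Qed.

Lemma psi_termB : psi (termB C i j) =
  yword (take i u) * (yconn C d (tail ui) (head vj) (prim vj) (sec ui) *
    (yword (drop j.+1 v) * yword (take j v)) * (iS (tail_unit vj) * iS (head_unit ui)))
  * yword (drop i.+1 u).
Proof.
have [_ hu _] := arrowP ui; have [hv _ _] := arrowP vj.
rewrite inl_outr /termB -/ui -/vj [head ui == _]eq_sym [prim ui == _]eq_sym.
case: andP => [[/eqP tu _]|_]; last first.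
  exact: etrans (lin_0 psiL) (esym (zero_termB _ _ _ _)).
rewrite scale1r -(yword_cat C (drop _ _)).
rewrite (yconn_yword_ev C d_gt0 _ _ (closed_path_open j vc) hv) yword_cat.
apply: etrans (psiM5 _ _ _ _ _) _; rewrite !(psi_word C d_gt0) (psi_conn C d_gt0 hv hu).
exact: (absorbB _ (yword_psi1 C d_gt0 _) (yword_psi1 C d_gt0 _) (yword_psi1 C d_gt0 _)
  (psi1_yconn C d_gt0 hv hu) (yconn_psi1 C d_gt0 hv hu)).
Qed.

(** In the graded commutator of q and E, the product q E gives A and E q gives B. In each, one pair
    of units meets and imposes the matching condition; the other pair encloses E and forms the
    connecting arrow. *)
Lemma term_ecomm (n : nat) :
  wval (flat C (take i u) ++ [:: Some (tail_unit ui)]) *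
  ecomm n (wval (Some (head_unit vj) :: flat C (drop j.+1 v)) *
           wval (flat C (take j v) ++ [:: Some (tail_unit vj)])) *
  wval (Some (head_unit ui) :: flat C (drop i.+1 u))
  = psi (termA C i j) - (-1) ^+ n.+1 *: psi (termB C i j).
Proof.
apply: etrans (congr2 *%R (congr2 (fun x q => x * ecomm n q) (wval_flat_rcons _ _)
  (congr2 *%R (wval_flat_cons _ _) (wval_flat_rcons _ _))) (wval_flat_cons _ _)) _.
apply: etrans (ecomm_split _ _ _ _ _ _ _ _ _) _.
exact: (congr2 (fun p q => p - (-1) ^+ n.+1 *: q) (esym psi_termA) (esym psi_termB)).
Qed.
End Terms.

Lemma cder_flat v : cder (flat C v) = \sum_(j < size v)
  (-1) ^+ (j * (size v).+1) *:
    (wval (Some (head_unit (tnth (in_tuple v) j)) :: flat C (drop j.+1 v)) *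
     wval (flat C (take j v) ++ [:: Some (tail_unit (tnth (in_tuple v) j))])).
Proof.
rewrite /cder wdeg_flat (big_cuts_flat
  (fun x y => (-1) ^+ (wdeg x * (size v).+1) *: (wval y * wval x))).
apply: eq_bigr => j _ /=; rewrite wdeg_cat wdeg_flat size_take ltn_ord addn0; reflexivity.
Qed.

Lemma ecomm_linear n : linear (@ecomm C k d n).
Proof.
apply: lin_subf; first exact: dd_mulr_linear.
exact: (lin_scalef _ (dd_mull_linear E)).
Qed.

(** Exponents are compared modulo 2: for n > 0, [n.-1] and [n.+1] have the same parity. *)
Lemma necklace_signs (V : lmodType C) n i j (A B : V) : (0 < n)%N ->
  (-1) ^+ (n.+1 * i) *: ((-1) ^+ (j * n.+1) *: (A - (-1) ^+ n.+1 *: B)) =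
  (-1) ^+ ((i + j) * n.-1) *: A - (-1) ^+ ((i + j + 1) * n.-1) *: B.
Proof.
case: n => //= n _; rewrite scalerA -exprD scalerBr scalerA -exprD.
by congr (_ - _); apply: sgn_scale; rewrite !(oddD, oddM) /= !negbK;
  case: (odd n); case: (odd i); case: (odd j).
Qed.

(** The index i is the letter E of u that is replaced, and j the letter E of v removed by the cyclic
    derivative; [term_ecomm] compares the summands. *)
Lemma psi_necklace v u : closed_path v ->
  psi (necklace C v u) = subst (size v) (cder (flat C v)) (flat C u).
Proof.
move=> vc; rewrite /subst (big_cuts_flat (fun x y => (-1) ^+ ((size v).+1 * wdeg x) *:
  (wval x * ecomm (size v) (cder (flat C v)) * wval y))).
rewrite /necklace (lin_sum psiL); apply: eq_bigr => i _ /=.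
rewrite wdeg_cat wdeg_flat size_take ltn_ord addn0.
set x := wval (_ ++ _); set w := wval (_ :: _).
have xwL : linear (fun q => x * ecomm (size v) q * w).
  exact: (lin_comp (dd_mulr_linear w) (lin_comp (dd_mull_linear x) (@ecomm_linear _))).
rewrite cder_flat (lin_sum psiL); apply: etrans _ (esym (congr1 _ (lin_sum xwL _ _ _))).
rewrite scaler_sumr; apply: eq_bigr => j _.
apply: etrans (lin_sub psiL _ _) _.
apply: etrans (congr2 (fun p q => p - q) (lin_scale psiL _ _) (lin_scale psiL _ _)) _.
apply: etrans _ (esym (congr1 _ (etrans (lin_scale xwL _ _) (congr1 _ (term_ecomm i j vc _))))).
have /andP[sv _] := vc; symmetry; exact: (necklace_signs _ _ _ _ sv).
Qed.
End NecklaceTerms.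

(** * The Lie bracket and the necklace bracket on the quiver side *)

Section NecklaceBracket.
Variables (C : fieldType) (k : nat) (d : 'I_k -> nat).
Hypothesis d_gt0 : forall i, (0 < d i)%N.
Local Notation D := (DD C d).
Variables (br : D -> D -> D \ox D) (brP : double_schouten br).
Variables (sg : D \ox D -> D \ox D) (sgP : is_gswap sg).
Hypothesis brA : forall m n (a b : D), dd_homog m a -> dd_homog n b ->
  br a b = - ((-1) ^+ (m.+1 * n.+1) *: sg (br b a)).
Local Notation prD := (@DDcyc_proj C k d).
Local Notation prP := (@CQcyc_proj C k d).
Local Notation cb := (cyc_bracket br).
Local Notation phi := (@cyc_phi C k d).
Local Notation psi := (@cyc_psi C k d).
Local Notation par := (@CQpar C k d).

Definition quiver_bracket (x y : CQcyc C d) : CQcyc C d := phi (cb (psi x) (psi y)).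
Definition nbracket (x y : CQcyc C d) : CQcyc C d := quiver_bracket (par x) y.

Let prDL : linear prD. Proof. exact: DDcyc_proj_linear. Qed.
Let phiL : linear phi. Proof. exact: cyc_phi_linear. Qed.
Let psiL : linear psi. Proof. exact: cyc_psi_linear. Qed.
Let cbB : bilin cb. Proof. exact: cyc_bracket_bilin sgP brA. Qed.
Let phiK : cancel phi psi. Proof. exact: cyc_phiK. Qed.
Let psiK : cancel psi phi. Proof. exact: cyc_psiK. Qed.
Let phi_deg z x : DDcyc_deg z x <-> CQcyc_deg z (phi x). Proof. exact: cyc_phi_deg. Qed.

Lemma DDcyc_graded_lie : graded_lie (@DDcyc_deg C k d) cb.
Proof.
split.
- by split; first exact: (grading_transport phiL psiL phiK psiK phi_deg (CQcyc_grading C d)).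
- by move=> y z a b; exact: cb_deg sgP brA _ _ _ _.
- by move=> y z a b; exact: cb_anti sgP brA _ _ _ _.
by move=> y z a b c; exact: cb_jacobi sgP brA _ _ _ _ _.
Qed.

Lemma quiver_graded_lie : graded_lie (@CQcyc_deg C k d) quiver_bracket.
Proof.
exact: (graded_lie_transport phiL psiL phiK psiK phi_deg (CQcyc_grading C d) DDcyc_graded_lie).
Qed.

Let qbB : bilin quiver_bracket. Proof. by case: quiver_graded_lie => [[_ h]]. Qed.

Lemma nbracket_bilin : bilin nbracket.
Proof.
split=> [y|x]; last exact: (qbB.2 (par x)).
exact: (lin_comp (qbB.1 y) (@CQpar_linear C k d)).
Qed.

Lemma quiver_bracket_shifted : shifted_bracket (@CQcyc_deg C k d) nbracket quiver_bracket.
Proof.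
split=> // z x y hx; rewrite /nbracket (CQpar_deg hx) (lin_scale (qbB.1 y)).
by rewrite signz_abs signZK.
Qed.

(** For v of length n, the sign (-1)^(n + 1) of [par] cancels the sign - (-1)^n of
    [proj_lb_word]. *)
Lemma nbracket_word v u : closed_path v -> closed_path u ->
  nbracket (prP (word C v)) (prP (word C u)) = prP (necklace C v u).
Proof.
move=> vc uc; apply: (can_inj psiK); rewrite /nbracket /quiver_bracket phiK.
have e1 w : closed_path w -> psi (prP (word C w)) = prD (wval (flat C w)).
  case/andP=> sw _; rewrite wval_flat -(psi_word_closed C d_gt0 sw).
  exact: cyc_psiE.
have e2 : psi (par (prP (word C v))) = (-1) ^+ (size v).+1 *: prD (wval (flat C v)).
  apply: etrans (congr1 psi (CQdiag_homog _ (word_homog C v))) _.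
  by rewrite (lin_scale psiL) (e1 _ vc).
rewrite e2 (e1 _ uc); apply: etrans (lin_scale (cbB.1 _) _ _) _.
apply: etrans (congr1 _ (cyc_bracketE brP sgP brA _ _)) _.
apply: etrans (congr1 _ (proj_lb_word brP sgP brA _ _)) _.
rewrite wdeg_flat -(psi_necklace C d_gt0 u vc) exprS mulN1r scaleNr scalerN opprK signZK.
symmetry; exact: cyc_psiE.
Qed.

(** A vertex comes from an element of S, which brackets to 0 on the left by [lbS] and then on the
    right by antisymmetry. *)
Lemma nbracket_vert i x : nbracket (prP (vert C d i)) x = 0 /\ nbracket x (prP (vert C d i)) = 0.
Proof.
have e1 : psi (prP (vert C d i)) = prD (iS (eL C d i 1)).
  by apply: etrans (cyc_psiE d_gt0 _) _; rewrite psi_vert.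
have z1 s y : cb (prD (iS s)) y = 0.
  elim/cyc_ind: y => b; apply: etrans (cyc_bracketE brP sgP brA _ b) _.
  by rewrite (lbS brP sgP brA) (lin_0 prDL).
have z2 s y : cb y (prD (iS s)) = 0.
  elim/cyc_ind: y => b; apply: etrans (cyc_bracketE brP sgP brA b _) _.
  move: b; apply: homog_ext.
  - exact: (lin_comp prDL (lb_linl brP _)).
  - exact: lin_cst0.
  move=> n b hb; apply: etrans (proj_lb_anti sgP brA hb (homog_iS s)) _.
  by rewrite (lbS brP sgP brA) (lin_0 prDL) scaler0 oppr0.
split; rewrite /nbracket /quiver_bracket ?e1 ?z2 ?(lin_0 phiL) //.
have -> : psi (par (prP (vert C d i))) = (-1) ^+ 1 *: prD (iS (eL C d i 1)).
  apply: etrans (congr1 psi (CQdiag_homog _ (pa_homog_vert C d i))) _.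
  by rewrite (lin_scale psiL) e1.
have -> : cb ((-1) ^+ 1 *: prD (iS (eL C d i 1))) (psi x) = 0.
  by rewrite (lin_scale (cbB.1 _)) z1 scaler0.
exact: (lin_0 phiL).
Qed.

Lemma nbracket_necklace : necklace_bracket nbracket.
Proof.
by split; [exact: nbracket_bilin | exact: nbracket_word | exact: nbracket_vert].
Qed.
End NecklaceBracket.

Section PhiMorphism.
Variables (C : fieldType) (k : nat) (d : 'I_k -> nat).
Hypothesis d_gt0 : forall i, (0 < d i)%N.
Definition cyc_phi_lin : {linear DDcyc C d -> CQcyc C d} :=
  HB.pack (@cyc_phi C k d)
    (GRing.isLinear.Build C (DDcyc C d) (CQcyc C d) *:%R (@cyc_phi C k d)
      (@cyc_phi_linear C k d d_gt0)).
End PhiMorphism.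

Theorem theorem3 (C : closedFieldType) (charC : [pchar C] =i pred0)
    (k : nat) (d : 'I_k -> nat) (d_gt0 : forall i : 'I_k, (0 < d i)%N)
    (dbr : DD C d -> DD C d -> DD C d \ox DD C d)
    (dbrP : double_schouten dbr) :
  exists (brS : DDcyc C d -> DDcyc C d -> DDcyc C d)
         (nb brQ : CQcyc C d -> CQcyc C d -> CQcyc C d)
         (phi : {linear DDcyc C d -> CQcyc C d}),
    [/\ schouten_induced dbr brS /\ graded_lie (@DDcyc_deg C k d) brS,
        necklace_bracket nb,
        shifted_bracket (@CQcyc_deg C k d) nb brQ,
        graded_lie (@CQcyc_deg C k d) brQ
      & graded_lie_iso (@DDcyc_deg C k d) (@CQcyc_deg C k d) brS brQ phi].
Proof.
have [_ _ _ [sg sgP brA]] := dbrP.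
exists (cyc_bracket dbr), (nbracket dbr), (quiver_bracket dbr), (cyc_phi_lin C d_gt0).
split.
- split; last exact: DDcyc_graded_lie sgP brA.
  exact: cyc_bracketE sgP brA.
- exact: nbracket_necklace sgP brA.
- exact: quiver_bracket_shifted sgP brA.
- exact: quiver_graded_lie sgP brA.
split=> [|z x|x y]; first exact: cyc_phi_bij.
  exact: cyc_phi_deg.
(* The bracket on the quiver side is the transported one, so [cyc_phiK] suffices. *)
exact: (congr1 (@cyc_phi C k d) (congr2 (cyc_bracket dbr)
  (esym (cyc_phiK d_gt0 x)) (esym (cyc_phiK d_gt0 y)))).
Qed.
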